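(* Consider a discrete memoryless 3-receiver broadcast channel $p(y_1,y_2,z|x)$ with a common message for all three receivers and a confidential message for receivers $Y_1,Y_2$, with eavesdropper $Z$. Every non-negative rate tuple $(R_0,R_1,R_e)$ satisfying \begin{align*} R_0 &< I(U;Z),\\ R_0+R_1 &< I(U;Z)+\min\{I(V_0,V_1;Y_1|U)-I(V_1;Z|V_0),\ I(V_0,V_2;Y_2|U)-I(V_2;Z|V_0)\},\\ R_0+R_1 &< \min\{I(V_0,V_1;Y_1)-I(V_1;Z|V_0),\ I(V_0,V_2;Y_2)-I(V_2;Z|V_0)\},\\ R_e &\le R_1,\\ R_e &< \min\{I(V_0,V_1;Y_1|U)-I(V_0,V_1;Z|U),\ I(V_0,V_2;Y_2|U)-I(V_0,V_2;Z|U)\},\\ R_0+R_e &< \min\{I(V_0,V_1;Y_1)-I(V_1,V_0;Z|U),\ I(V_0,V_2;Y_2)-I(V_2,V_0;Z|U)\},\\ R_0+2R_e &< I(V_0,V_1;Y_1)+I(V_0,V_2;Y_2|U)-I(V_1;V_2|V_0)-2I(V_0;Z|U),\\ R_0+2R_e &< I(V_0,V_2;Y_2)+I(V_0,V_1;Y_1|U)-I(V_1;V_2|V_0)-2I(V_0;Z|U),\\ R_0+R_1+2R_e &< I(V_0,V_2;Y_2|U)-I(V_2;Z|V_0)+I(V_0,V_1;Y_1)+I(V_0,V_2;Y_2|U)-I(V_1;V_2|V_0)-2I(V_0;Z|U),\\ R_0+R_1+2R_e &< I(V_0,V_1;Y_1|U)-I(V_1;Z|V_0)+I(V_0,V_2;Y_2)+I(V_0,V_1;Y_1|U)-I(V_1;V_2|V_0)-2I(V_0;Z|U)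 \end{align*} for some joint pmf $p(u,v_0,v_1,v_2,x)=p(u)p(v_0|u)p(v_1,v_2|v_0)p(x|v_0,v_1,v_2)$ with $I(V_1,V_2;Z|V_0)\le I(V_1;Z|V_0)+I(V_2;Z|V_0)-I(V_1;V_2|V_0)$ (mutual informations computed under $p(u,v_0,v_1,v_2,x)p(y_1,y_2,z|x)$) belongs to the secrecy capacity region.
   Context: The channel has finite alphabets and is memoryless. A $(2^{nR_0},2^{nR_1},n)$ code consists of messages $(M_0,M_1)$ uniformly distributed on $[1:2^{nR_0}]\times[1:2^{nR_1}]$, a stochastic encoder generating $X^n$ according to $p(x^n|m_0,m_1)$, decoders at $Y_1$ and $Y_2$ that each estimate $(M_0,M_1)$ as $(\hat M_{0j},\hat M_{1j})$, $j=1,2$, and a decoder at $Z$ that estimates $M_0$ as $\hat M_{03}$. The error probability is $\mathbb{P}\{\hat M_{0j}\ne M_0\text{ for some }j\in\{1,2,3\}\text{ or }\hat M_{1j}\ne M_1\text{ for some }j\in\{1,2\}\}$. A tuple $(R_0,R_1,R_e)$ is achievable if there is a sequence of codes with error probability $\to0$ and $\liminf_{n\to\infty}\frac1nH(M_1|Z^n)\ge R_e$. The secrecy capacity region is the closure of the set of achievable tuples. *)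

(* Defs.v *)
From HB Require Import structures.
From mathcomp Require Import all_boot all_order all_algebra.
From mathcomp Require Import all_classical all_reals all_analysis.
Set Implicit Arguments. Unset Strict Implicit. Unset Printing Implicit Defensive.
Import Order.TTheory GRing.Theory Num.Theory.
Import numFieldNormedType.Exports.
Local Open Scope ring_scope.
Local Open Scope classical_set_scope.

Section Info.
Variable R : realType.

Definition is_pmf (T : finType) (p : {ffun T -> R}) : Prop :=
  (forall t, 0 <= p t) /\ \sum_(t : T) p t = 1.

(** base-2 logarithm (rates are in bits); ln 0 = 0 so 0 log 0 = 0 *)
Definition log2 (x : R) : R := ln x / ln 2.

Definition law (Om A : finType) (P : Om -> R) (f : Om -> A) (a : A) : R :=
  \sum_(w : Om | f w == a) P w.

Definition ent (Om A : finType) (P : Om -> R) (f : Om -> A) : R :=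
  - \sum_(a : A) law P f a * log2 (law P f a).

Definition cent (Om A B : finType) (P : Om -> R) (f : Om -> A) (g : Om -> B) : R :=
  ent P (fun w => (f w, g w)) - ent P g.

Definition mi (Om A B : finType) (P : Om -> R) (f : Om -> A) (g : Om -> B) : R :=
  ent P f - cent P f g.

Definition cmi (Om A B C : finType) (P : Om -> R)
  (f : Om -> A) (g : Om -> B) (h : Om -> C) : R :=
  cent P f h - cent P f (fun w => (g w, h w)).

Definition is_channel (X Y1 Y2 Z : finType) (W : X -> {ffun (Y1 * Y2 * Z) -> R}) : Prop :=
  forall x, is_pmf (W x).

Record code (X Y1 Y2 Z : finType) (N0 N1 n : nat) := Code {
  enc  : 'I_N0 -> 'I_N1 -> {ffun n.-tuple X -> R};
  dec1 : n.-tuple Y1 -> 'I_N0 * 'I_N1;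
  dec2 : n.-tuple Y2 -> 'I_N0 * 'I_N1;
  dec3 : n.-tuple Z -> 'I_N0 }.

Definition valid_code (X Y1 Y2 Z : finType) (N0 N1 n : nat)
  (c : code X Y1 Y2 Z N0 N1 n) : Prop :=
  forall m0 m1, is_pmf (enc c m0 m1).

Definition code_space (X Y1 Y2 Z : finType) (N0 N1 n : nat) : finType :=
  ('I_N0 * 'I_N1 * n.-tuple X * n.-tuple (Y1 * Y2 * Z))%type.

Definition code_pmf (X Y1 Y2 Z : finType) (W : X -> {ffun (Y1 * Y2 * Z) -> R})
  (N0 N1 n : nat) (c : code X Y1 Y2 Z N0 N1 n)
  (w : code_space X Y1 Y2 Z N0 N1 n) : R :=
  let: (m0, m1, xn, yn) := w in
  (N0 * N1)%:R^-1 * enc c m0 m1 xn * \prod_(i < n) W (tnth xn i) (tnth yn i).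

Definition rvM0 (X Y1 Y2 Z : finType) N0 N1 n (w : code_space X Y1 Y2 Z N0 N1 n) : 'I_N0 :=
  w.1.1.1.
Definition rvM1 (X Y1 Y2 Z : finType) N0 N1 n (w : code_space X Y1 Y2 Z N0 N1 n) : 'I_N1 :=
  w.1.1.2.
Definition rvY1n (X Y1 Y2 Z : finType) N0 N1 n (w : code_space X Y1 Y2 Z N0 N1 n)
  : n.-tuple Y1 := map_tuple (fun t : Y1 * Y2 * Z => t.1.1) w.2.
Definition rvY2n (X Y1 Y2 Z : finType) N0 N1 n (w : code_space X Y1 Y2 Z N0 N1 n)
  : n.-tuple Y2 := map_tuple (fun t : Y1 * Y2 * Z => t.1.2) w.2.
Definition rvZn (X Y1 Y2 Z : finType) N0 N1 n (w : code_space X Y1 Y2 Z N0 N1 n)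
  : n.-tuple Z := map_tuple (fun t : Y1 * Y2 * Z => t.2) w.2.

Definition err_event (X Y1 Y2 Z : finType) N0 N1 n (c : code X Y1 Y2 Z N0 N1 n)
  (w : code_space X Y1 Y2 Z N0 N1 n) : bool :=
  [|| dec1 c (rvY1n w) != (rvM0 w, rvM1 w),
      dec2 c (rvY2n w) != (rvM0 w, rvM1 w) |
      dec3 c (rvZn w) != rvM0 w].

Definition err_prob (X Y1 Y2 Z : finType) (W : X -> {ffun (Y1 * Y2 * Z) -> R})
  N0 N1 n (c : code X Y1 Y2 Z N0 N1 n) : R :=
  \sum_(w : code_space X Y1 Y2 Z N0 N1 n | err_event c w) code_pmf W c w.

Definition equivocation (X Y1 Y2 Z : finType) (W : X -> {ffun (Y1 * Y2 * Z) -> R})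
  N0 N1 n (c : code X Y1 Y2 Z N0 N1 n) : R :=
  cent (code_pmf W c) (@rvM1 X Y1 Y2 Z N0 N1 n) (@rvZn X Y1 Y2 Z N0 N1 n).

(** message set size 2^{nR}, with the convention [1:2^{nR}] = [1:2^{ceil(nR)}] *)
Definition msize (n : nat) (r : R) : nat := (2 ^ `|Num.ceil (n%:R * r)|)%N.

Definition achievable (X Y1 Y2 Z : finType) (W : X -> {ffun (Y1 * Y2 * Z) -> R})
  (r : R * R * R) : Prop :=
  let: (R0, R1, Re) := r in
  0 <= R0 /\ 0 <= R1 /\
  exists c : forall n : nat, code X Y1 Y2 Z (msize n R0) (msize n R1) n,
    (forall n, valid_code (c n)) /\
    err_prob W (c n) @[n --> \oo] --> (0 : R) /\
    (Re%:E <= limn_einf (fun n => ((n%:R)^-1 * equivocation W (c n))%:E))%E.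

Definition secrecy_capacity_region (X Y1 Y2 Z : finType)
  (W : X -> {ffun (Y1 * Y2 * Z) -> R}) : set (R * R * R) :=
  closure (achievable W).

Definition aux_space (U V0 V1 V2 X Y1 Y2 Z : finType) : finType :=
  (U * V0 * V1 * V2 * X * (Y1 * Y2 * Z))%type.

Definition aux_pmf (U V0 V1 V2 X Y1 Y2 Z : finType)
  (pu : {ffun U -> R}) (pv0 : U -> {ffun V0 -> R})
  (pv12 : V0 -> {ffun (V1 * V2) -> R}) (px : V0 * V1 * V2 -> {ffun X -> R})
  (W : X -> {ffun (Y1 * Y2 * Z) -> R})
  (w : aux_space U V0 V1 V2 X Y1 Y2 Z) : R :=
  let: (u, v0, v1, v2, x, y) := w in
  pu u * pv0 u v0 * pv12 v0 (v1, v2) * px (v0, v1, v2) x * W x y.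

Section Proj.
Variables U V0 V1 V2 X Y1 Y2 Z : finType.
Implicit Type w : aux_space U V0 V1 V2 X Y1 Y2 Z.
Definition aU w : U := w.1.1.1.1.1.
Definition aV0 w : V0 := w.1.1.1.1.2.
Definition aV1 w : V1 := w.1.1.1.2.
Definition aV2 w : V2 := w.1.1.2.
Definition aX w : X := w.1.2.
Definition aY1 w : Y1 := w.2.1.1.
Definition aY2 w : Y2 := w.2.1.2.
Definition aZ w : Z := w.2.2.
End Proj.

End Info.

(* Main.v *)
(** One-shot random coding followed by tensorization. The first message and a part [a] of the
second one index the cloud centres [u]; the rest of the second message splits into a part [s]
of rate [Re] that is kept secret and a part [b] that, together with local randomness [t],
indexes the [v0]-codewords. Above each [v0] there are independent families of [v1]- and
[v2]-codewords, from which the encoder draws a pair with probability proportional to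
[p(v1,v2|v0) / (p(v1|v0) p(v2|v0))]; this replaces the joint typicality selection of Marton
coding. Receivers 1 and 2 decode by maximum likelihood over all codewords and [Z] decodes the
cloud centre. Conditioning on the codewords in use, Jensen's inequality for [min(1, x)] and
[ln x] bounds the expected error probability and the expected divergence between the output
law given [s] and the one given only [u] by moments of order at most 1 of likelihood ratios.
Such moments are multiplicative over the letters, hence decay exponentially when the rates are
on the right side of the mean log-likelihoods, which are the mutual informations of the
statement. *)
Require Import Defs.
From HB Require Import structures.
From mathcomp Require Import all_boot all_order all_algebra.
From mathcomp Require Import all_classical all_reals all_analysis.
From mathcomp Require Import ring lra.
Import Order.TTheory GRing.Theory Num.Theory.
Local Open Scope ring_scope.
Set Implicit Arguments. Unset Strict Implicit. Unset Printing Implicit Defensive.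

(** * Random codebooks *)

(** The difficulty is that a Marton encoder correlates its choice with the whole codebook. The soft
    draw keeps this tractable: weighting independently generated pairs by the density of p(v1,v2|v0)
    against p(v1|v0)p(v2|v0) is a change of measure, so codebook averages over the drawn word are
    expectations under the target pmf, up to the error in the total mass of the weights. Jensen
    needs only the mean of a sum over codewords given one of them, so pairwise marginals of the
    codebook suffice. Small orders s matter: the first moment of a likelihood ratio is a Renyi-type
    quantity, and mutual information appears as the derivative at s = 0. The leakage need not
    vanish: the equivocation is divided by n, so a bound independent of n is enough. The comparison
    law at Z is conditioned on the cloud centre, as if [M0] and the part a were revealed. The
    condition on the pmf enters through the rates: satellite rates just above I(V1;Z|V0) and
    I(V2;Z|V0) then suffice both for the draw, which needs a sum above I(V1;V2|V0), and for masking
    the pair of satellites from Z. *)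

Section ProductMeasure.
Variables (R : realType) (I A : finType) (p : A -> R).
Hypothesis p1 : \sum_a p a = 1.

Lemma iid_prod (h : I -> A -> R) :
  \sum_(f : {ffun I -> A}) (\prod_i p (f i)) * \prod_i h i (f i)
  = \prod_i \sum_a p a * h i a.
Proof.
rewrite (bigA_distr_bigA (fun i a => p a * h i a)).
by apply: eq_bigr => f _; rewrite big_split.
Qed.

Lemma iid_sum1 : \sum_(f : {ffun I -> A}) \prod_i p (f i) = 1.
Proof.
rewrite -(bigA_distr_bigA (fun _ a => p a)) big1 // => i _; exact: p1.
Qed.

Lemma iid_marg2 (i0 i1 : I) (a b : A -> R) : i0 != i1 ->
  \sum_(f : {ffun I -> A}) (\prod_i p (f i)) * (a (f i0) * b (f i1))
  = (\sum_x p x * a x) * (\sum_x p x * b x).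
Proof.
move=> ne; have ne' : i1 != i0 by rewrite eq_sym.
pose h i x := if i == i0 then a x else if i == i1 then b x else 1.
transitivity (\sum_(f : {ffun I -> A}) (\prod_i p (f i)) * \prod_i h i (f i)).
  apply: eq_bigr => f _; congr (_ * _).
  rewrite (bigD1 i0) //= (bigD1 i1) //= big1 => [|i /andP[i_0 i_1]].
    by rewrite /h eqxx (negbTE ne') eqxx mulr1.
  by rewrite /h (negbTE i_0) (negbTE i_1).
rewrite iid_prod (bigD1 i0) //= (bigD1 i1) //= [X in _ * (_ * X)]big1 => [|i /andP[i_0 i_1]].
  by rewrite /h eqxx (negbTE ne') eqxx mulr1.
by rewrite /h (negbTE i_0) (negbTE i_1) -[RHS]p1; apply: eq_bigr => x _; rewrite mulr1.
Qed.

Lemma iid_marg1 (i0 : I) (a : A -> R) :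
  \sum_(f : {ffun I -> A}) (\prod_i p (f i)) * a (f i0) = \sum_x p x * a x.
Proof.
pose h i x := if i == i0 then a x else 1.
transitivity (\sum_(f : {ffun I -> A}) (\prod_i p (f i)) * \prod_i h i (f i)).
  apply: eq_bigr => f _; congr (_ * _).
  rewrite (bigD1 i0) //= big1 => [|i /negbTE ni]; last by rewrite /h ni.
  by rewrite /h eqxx mulr1.
rewrite iid_prod (bigD1 i0) //= [X in _ * X]big1 => [|i /negbTE ni].
  by rewrite /h eqxx mulr1.
by rewrite /h ni -[RHS]p1; apply: eq_bigr => x _; rewrite mulr1.
Qed.

End ProductMeasure.

Section Codebook.
Variables (R : realType) (U V0 V1 V2 K L T1 T2 : finType).
Variables (pu : U -> R) (pv0 : U -> V0 -> R) (p1 : V0 -> V1 -> R) (p2 : V0 -> V2 -> R).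
Hypotheses (pu_ge0 : forall u, 0 <= pu u) (pv0_ge0 : forall u v, 0 <= pv0 u v)
  (p1_ge0 : forall v x, 0 <= p1 v x) (p2_ge0 : forall v x, 0 <= p2 v x).
Hypotheses (pu_sum : \sum_u pu u = 1) (pv0_sum : forall u, \sum_v pv0 u v = 1)
  (p1_sum : forall v, \sum_x p1 v x = 1) (p2_sum : forall v, \sum_x p2 v x = 1).

(* [K] indexes the u-codewords, [L] the v0-codewords of each of them, [T1] and [T2] the v1- and
   v2-codewords of each v0-codeword. *)
Definition cloud : finType := (V0 * {ffun T1 -> V1} * {ffun T2 -> V2})%type.
Definition codebook : finType := {ffun K -> U * {ffun L -> cloud}}.
Definition wordT : finType := (U * V0 * V1 * V2)%type.
Definition idxT : finType := (K * L * T1 * T2)%type.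

Definition cloud_word (u : U) (d : cloud) (t1 : T1) (t2 : T2) : wordT :=
  (u, d.1.1, d.1.2 t1, d.2 t2).
Definition cword (c : codebook) (i : idxT) : wordT :=
  let: (k, l, t1, t2) := i in cloud_word (c k).1 ((c k).2 l) t1 t2.

Definition cloud_pmf (u : U) (d : cloud) : R :=
  pv0 u d.1.1 * (\prod_t p1 d.1.1 (d.1.2 t)) * (\prod_t p2 d.1.1 (d.2 t)).
Definition row_pmf (g : U * {ffun L -> cloud}) : R :=
  pu g.1 * \prod_l cloud_pmf g.1 (g.2 l).
Definition cb_pmf (c : codebook) : R := \prod_k row_pmf (c k).

(** Law of one codeword. Given v0 the components v1 and v2 are independent here, whatever the target
    pmf; [wt] restores the dependence. *)
Definition mu (x : wordT) : R :=
  let: (u, v0, v1, v2) := x in pu u * pv0 u v0 * p1 v0 v1 * p2 v0 v2.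

Lemma sum_word (F : wordT -> R) :
  \sum_x F x = \sum_u \sum_v0 \sum_v1 \sum_v2 F (u, v0, v1, v2).
Proof.
rewrite pair_bigA /= pair_bigA /= pair_bigA /=.
by apply: eq_bigr => -[[[u v0] v1] v2] _.
Qed.

Lemma sum_cloud (F : cloud -> R) :
  \sum_d F d = \sum_v0 \sum_f1 \sum_f2 F (v0, f1, f2).
Proof.
by rewrite pair_bigA /= pair_bigA /=; apply: eq_bigr => -[[v0 f1] f2] _.
Qed.

Lemma cloud_pmf_sum u : \sum_d cloud_pmf u d = 1.
Proof.
rewrite sum_cloud -[RHS](pv0_sum u); apply: eq_bigr => v0 _ /=.
under eq_bigr => f1 _.
  rewrite /cloud_pmf /= -mulr_sumr iid_sum1 // mulr1; over.
by rewrite -mulr_sumr iid_sum1 // mulr1.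
Qed.

Lemma sum_row (F : U * {ffun L -> cloud} -> R) :
  \sum_g F g = \sum_u \sum_(h : {ffun L -> cloud}) F (u, h).
Proof. by rewrite pair_bigA /=; apply: eq_bigr => -[u h] _. Qed.

Lemma row_pmf_sum : \sum_g row_pmf g = 1.
Proof.
rewrite sum_row -[RHS]pu_sum; apply: eq_bigr => u _.
by rewrite /row_pmf /= -mulr_sumr (iid_sum1 L (cloud_pmf_sum u)) mulr1.
Qed.

Lemma cb_pmf_sum : \sum_c cb_pmf c = 1.
Proof. exact: (iid_sum1 K row_pmf_sum). Qed.

Lemma cloud_pmf_ge0 u d : 0 <= cloud_pmf u d.
Proof. by rewrite !mulr_ge0 // prodr_ge0. Qed.

Lemma cb_pmf_ge0 c : 0 <= cb_pmf c.
Proof.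
apply: prodr_ge0 => k _; apply: mulr_ge0 => //.
by apply: prodr_ge0 => l _; exact: cloud_pmf_ge0.
Qed.

Lemma mu_ge0 x : 0 <= mu x.
Proof. by case: x => [[[u v0] v1] v2]; rewrite !mulr_ge0. Qed.

(** Conditional means under [mu] given the components that a second codeword may share with the
    first: u only, then also v0, then also one of the two satellites. *)
Definition cond_u (D : wordT -> R) u : R :=
  \sum_v0 \sum_v1 \sum_v2 pv0 u v0 * p1 v0 v1 * p2 v0 v2 * D (u, v0, v1, v2).
Definition cond_v0 (D : wordT -> R) u v0 : R :=
  \sum_v1 \sum_v2 p1 v0 v1 * p2 v0 v2 * D (u, v0, v1, v2).
Definition cond_v1 (D : wordT -> R) u v0 v1 : R :=
  \sum_v2 p2 v0 v2 * D (u, v0, v1, v2).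
Definition cond_v2 (D : wordT -> R) u v0 v2 : R :=
  \sum_v1 p1 v0 v1 * D (u, v0, v1, v2).

Lemma cond_uE D u : cond_u D u = \sum_v0 pv0 u v0 * cond_v0 D u v0.
Proof.
apply: eq_bigr => v0 _; rewrite /cond_v0 mulr_sumr; apply: eq_bigr => v1 _.
by rewrite mulr_sumr; apply: eq_bigr => v2 _; rewrite !mulrA.
Qed.

Lemma sum_mu D : \sum_x mu x * D x = \sum_u pu u * cond_u D u.
Proof.
rewrite sum_word; apply: eq_bigr => u _; rewrite /cond_u mulr_sumr.
apply: eq_bigr => v0 _; rewrite mulr_sumr; apply: eq_bigr => v1 _.
by rewrite mulr_sumr; apply: eq_bigr => v2 _; rewrite !mulrA.
Qed.

Lemma cloud_E1 u (a : wordT -> R) t1 t2 :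
  \sum_d cloud_pmf u d * a (cloud_word u d t1 t2) = cond_u a u.
Proof.
rewrite sum_cloud cond_uE; apply: eq_bigr => v0 _ /=.
rewrite /cloud_pmf /=.
under eq_bigr => f1 _.
  under eq_bigr => f2 _ do rewrite -!mulrA /cloud_word /=.
  rewrite -mulr_sumr -mulr_sumr.
  rewrite (iid_marg1 (p2_sum v0) t2 (fun v2 => a (u, v0, f1 t1, v2))); over.
rewrite -mulr_sumr (iid_marg1 (p1_sum v0) t1 (fun v1 => cond_v1 a u v0 v1)).
congr (_ * _); rewrite /cond_v0; apply: eq_bigr => v1 _.
by rewrite mulr_sumr; apply: eq_bigr => v2 _; rewrite !mulrA.
Qed.

(** Mean of [D] at a second codeword above the same v0-codeword, given that the first one is x; the
    flags tell whether the v1- and v2-indices coincide. *)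
Definition same_cloud (b1 b2 : bool) (D : wordT -> R) (x : wordT) : R :=
  let: (u, v0, v1, v2) := x in
  match b1, b2 with
  | true, true => D (u, v0, v1, v2)
  | true, false => cond_v1 D u v0 v1
  | false, true => cond_v2 D u v0 v2
  | false, false => cond_v0 D u v0
  end.

Lemma cloud_E2 u (a b : wordT -> R) t1 t2 t1' t2' :
  \sum_d cloud_pmf u d * (a (cloud_word u d t1 t2) * b (cloud_word u d t1' t2'))
  = cond_u (fun x => a x * same_cloud (t1 == t1') (t2 == t2') b x) u.
Proof.
rewrite sum_cloud cond_uE; apply: eq_bigr => v0 _ /=.
rewrite /cloud_pmf /=.
under eq_bigr => f1 _.
  under eq_bigr => f2 _ do rewrite -!mulrA /cloud_word /=.
  rewrite -mulr_sumr -mulr_sumr; over.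
rewrite -mulr_sumr; congr (_ * _); rewrite /cond_v0.
have sp v1 (F : wordT -> R) :
   \sum_v2 p1 v0 v1 * p2 v0 v2 * F (u, v0, v1, v2)
   = p1 v0 v1 * \sum_v2 p2 v0 v2 * F (u, v0, v1, v2).
  by rewrite mulr_sumr; apply: eq_bigr => v2 _; rewrite !mulrA.
under [RHS]eq_bigr => v1 _ do rewrite (sp v1 (fun x => a x * same_cloud _ _ b x)) /=.
case: (eqVneq t2 t2') => [<-|n2].
  under [LHS]eq_bigr => f1 _.
    rewrite (iid_marg1 (p2_sum v0) t2
      (fun v2 => a (u, v0, f1 t1, v2) * b (u, v0, f1 t1', v2))) mulr_sumr; over.
  rewrite [LHS]exchange_big /=.
  under [RHS]eq_bigr => v1 _ do rewrite mulr_sumr.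
  rewrite [RHS]exchange_big /=; apply: eq_bigr => v2 _.
  case: (eqVneq t1 t1') => [<-|n1].
    rewrite (iid_marg1 (p1_sum v0) t1 (fun v1 => p2 v0 v2 *
      (a (u, v0, v1, v2) * b (u, v0, v1, v2)))).
    by [].
  under [LHS]eq_bigr => f1 _ do rewrite mulrCA.
  rewrite -mulr_sumr (iid_marg2 (p1_sum v0) (fun v1 => a (u, v0, v1, v2))
    (fun v1 => b (u, v0, v1, v2)) n1).
  rewrite -/(cond_v2 b u v0 v2) mulr_suml mulr_sumr; apply: eq_bigr => v1 _.
  by ring.
under [LHS]eq_bigr => f1 _.
  rewrite (iid_marg2 (p2_sum v0) (fun v2 => a (u, v0, f1 t1, v2))
    (fun v2 => b (u, v0, f1 t1', v2)) n2); over.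
case: (eqVneq t1 t1') => [<-|n1].
  rewrite (iid_marg1 (p1_sum v0) t1 (fun v1 => cond_v1 a u v0 v1 * cond_v1 b u v0 v1)).
  apply: eq_bigr => v1 _; rewrite /cond_v1 mulr_suml; congr (_ * _).
  by apply: eq_bigr => v2 _; rewrite mulrA.
rewrite (iid_marg2 (p1_sum v0) (fun v1 => cond_v1 a u v0 v1) (fun v1 => cond_v1 b u v0 v1) n1).
rewrite mulr_suml; apply: eq_bigr => v1 _.
rewrite -mulrA; congr (_ * _); rewrite mulr_suml; apply: eq_bigr => v2 _.
rewrite -!mulrA; congr (_ * (_ * _)); rewrite /cond_v0; apply: eq_bigr => x _.
by rewrite mulr_sumr; apply: eq_bigr => y _; rewrite !mulrA.
Qed.

(** Conditional mean of [D] at codeword i' given that codeword i equals x. Indices are compared from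
    the cloud centre down; whatever lies below a difference is drawn afresh. *)
Definition pair_cond (i i' : idxT) (D : wordT -> R) (x : wordT) : R :=
  if i.1.1.1 != i'.1.1.1 then \sum_y mu y * D y
  else if i.1.1.2 != i'.1.1.2 then cond_u D x.1.1.1
  else same_cloud (i.1.2 == i'.1.2) (i.2 == i'.2) D x.

Lemma cb_E1 (a : wordT -> R) i :
  \sum_c cb_pmf c * a (cword c i) = \sum_x mu x * a x.
Proof.
case: i => [[[k l] t1] t2].
rewrite (iid_marg1 row_pmf_sum k
  (fun g => a (cloud_word g.1 (g.2 l) t1 t2))) sum_row sum_mu.
apply: eq_bigr => u _; rewrite /row_pmf /=.
under eq_bigr => h _ do rewrite -mulrA.
rewrite -mulr_sumr (iid_marg1 (cloud_pmf_sum u) l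
  (fun d => a (cloud_word u d t1 t2))).
by rewrite cloud_E1.
Qed.

Lemma cond_uZl (a D : wordT -> R) u (F : U -> R) :
  cond_u (fun x => a x * F x.1.1.1) u = cond_u a u * F u.
Proof.
rewrite /cond_u mulr_suml; apply: eq_bigr => v0 _.
rewrite mulr_suml; apply: eq_bigr => v1 _.
by rewrite mulr_suml; apply: eq_bigr => v2 _; rewrite mulrA.
Qed.

(** Tower property for two codewords; every later average that involves a competing codeword reduces
    to it. Different rows, and different clouds within a row, are independent, which leaves the case
    of a common cloud to [cloud_E2]. *)
Lemma cb_E2 (a b : wordT -> R) i i' :
  \sum_c cb_pmf c * (a (cword c i) * b (cword c i'))
  = \sum_x mu x * (a x * pair_cond i i' b x).
Proof.
case: i i' => [[[k l] t1] t2] [[[k' l'] t1'] t2']; rewrite /pair_cond /=.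
case: (eqVneq k k') => [<-|nk] /=; last first.
  rewrite (iid_marg2 row_pmf_sum (fun g => a (cloud_word g.1 (g.2 l) t1 t2))
    (fun g => b (cloud_word g.1 (g.2 l') t1' t2')) nk).
  have h (d : wordT -> R) l0 s1 s2 : \sum_g row_pmf g * d (cloud_word g.1 (g.2 l0) s1 s2)
      = \sum_x mu x * d x.
    rewrite -(cb_E1 d (k, l0, s1, s2)).
    by rewrite (iid_marg1 row_pmf_sum k
      (fun g => d (cloud_word g.1 (g.2 l0) s1 s2))).
  by rewrite !h mulr_suml; apply: eq_bigr => x _; rewrite mulrA.
rewrite (iid_marg1 row_pmf_sum k (fun g => a (cloud_word g.1 (g.2 l) t1 t2) *
    b (cloud_word g.1 (g.2 l') t1' t2'))) sum_row sum_mu.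
apply: eq_bigr => u _; rewrite /row_pmf /=.
under eq_bigr => h _ do rewrite -mulrA.
rewrite -mulr_sumr; congr (_ * _).
case: (eqVneq l l') => [<-|nl] /=.
  by rewrite (iid_marg1 (cloud_pmf_sum u) l (fun d => a (cloud_word u d t1 t2) *
    b (cloud_word u d t1' t2'))) cloud_E2.
rewrite (iid_marg2 (cloud_pmf_sum u) (fun d => a (cloud_word u d t1 t2))
    (fun d => b (cloud_word u d t1' t2')) nl).
by rewrite !cloud_E1 (cond_uZl _ a).
Qed.

End Codebook.

Arguments cword : simpl never.

(** * Conditional Jensen bounds *)

Section Jensen.
Variables (R : realType) (C T : finType) (P : C -> R) (X : C -> T).
Variables (phi : T -> R) (H : C -> R) (h : T -> R).
Hypotheses (P_ge0 : forall c, 0 <= P c) (phi_ge0 : forall x, 0 <= phi x).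
Hypothesis Hh : forall psi : T -> R, (forall x, 0 <= psi x) ->
  \sum_c P c * (psi (X c) * H c) <= \sum_c P c * (psi (X c) * h (X c)).

(** Hypothesis [Hh] is the weak form of E[H | X] <= h(X), tested against non-negative functions of
    X. Since min(1, y) lies below both 1 and y, either line may be chosen as a function of X; the
    choice [s], exact at h(X), leaves a bound linear in H. *)
Lemma jensen_min : (forall c, 0 <= H c) ->
  \sum_c P c * (phi (X c) * Num.min 1 (H c)) <=
  \sum_c P c * (phi (X c) * Num.min 1 (h (X c))).
Proof.
move=> H_ge0.
pose s x : R := (h x < 1)%R%:R.
have bnd c : Num.min 1 (H c) <= (1 - s (X c)) + s (X c) * H c.
  rewrite /s; case: ltP => _; first by rewrite mul1r subrr add0r ge_min lexx orbT.
  by rewrite mul0r subr0 addr0 ge_min lexx.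
have bndh x : Num.min 1 (h x) = (1 - s x) + s x * h x.
  by rewrite /s; case: ltP => _; rewrite ?(mul1r, mul0r, subrr, subr0, add0r, addr0).
have s_ge0 x : 0 <= s x by rewrite ler0n.
under [leRHS]eq_bigr => c _ do rewrite bndh mulrDr mulrDr.
rewrite big_split /=.
apply: (@le_trans _ _ (\sum_c (P c * (phi (X c) * (1 - s (X c)))
   + P c * (phi (X c) * (s (X c) * H c))))).
  apply: ler_sum => c _; rewrite -!mulrDr; do 2 (apply: ler_wpM2l => //).
rewrite big_split /= lerD2l.
have e (G : C -> R) : \sum_c P c * (phi (X c) * (s (X c) * G c)) =
    \sum_c P c * (phi (X c) * s (X c) * G c).
  by apply: eq_bigr => c _; rewrite (mulrA (phi _)).
by rewrite !e; exact: (Hh (fun x => mulr_ge0 (phi_ge0 x) (s_ge0 x))).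
Qed.

(** The tangent of ln at h(X) has slope 1 / h(X), a function of X, so [Hh] applies with the test
    function phi / h. Where H vanishes phi has to vanish too, because the tangent bound can fail for
    the default ln 0 = 0. *)
Lemma jensen_ln : (forall c, phi (X c) = 0 \/ 0 < H c) -> (forall x, 0 < h x) ->
  \sum_c P c * (phi (X c) * ln (H c)) <= \sum_c P c * (phi (X c) * ln (h (X c))).
Proof.
move=> H_gt0 h_gt0.
apply: (@le_trans _ _ (\sum_c P c * (phi (X c) * (ln (h (X c)) - 1))
   + \sum_c P c * (phi (X c) / h (X c) * H c))).
  rewrite -big_split /=; apply: ler_sum => c _; rewrite -mulrDr ler_wpM2l //.
  case: (H_gt0 c) => [->|Hc]; first by rewrite !mul0r addr0.
  rewrite -mulrA -mulrDr ler_wpM2l //.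
  have hx := h_gt0 (X c).
  have e : H c = h (X c) * ((h (X c))^-1 * H c) by rewrite mulrA divff ?gt_eqF// mul1r.
  have rp : 0 < (h (X c))^-1 * H c by rewrite mulr_gt0 ?invr_gt0.
  rewrite {1}e lnM ?posrE // -addrA lerD2l.
  have := le_ln1Dx (x := (h (X c))^-1 * H c - 1).
  rewrite [1 + _]addrC subrK [-1 + _]addrC => -> //.
  by rewrite ltrBrDr addNr.
have psi_ge0 x : 0 <= phi x / h x by rewrite divr_ge0 // ltW.
apply: le_trans (lerD (lexx _) (Hh psi_ge0)) _.
rewrite -big_split /=; apply: ler_sum => c _; rewrite -mulrDr ler_wpM2l //.
by rewrite mulfVK ?gt_eqF // mulrBr mulr1 subrK.
Qed.

End Jensen.

(** * Decoding and covering bounds for the random codebook *)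

Section CodebookBounds.
Variables (R : realType) (U V0 V1 V2 K L T1 T2 : finType).
Variables (pu : U -> R) (pv0 : U -> V0 -> R) (p1 : V0 -> V1 -> R) (p2 : V0 -> V2 -> R).
Hypotheses (pu_ge0 : forall u, 0 <= pu u) (pv0_ge0 : forall u v, 0 <= pv0 u v)
  (p1_ge0 : forall v x, 0 <= p1 v x) (p2_ge0 : forall v x, 0 <= p2 v x).
Hypotheses (pu_sum : \sum_u pu u = 1) (pv0_sum : forall u, \sum_v pv0 u v = 1)
  (p1_sum : forall v, \sum_x p1 v x = 1) (p2_sum : forall v, \sum_x p2 v x = 1).

Local Notation wordT := (wordT U V0 V1 V2).
Local Notation idxT := (idxT K L T1 T2).
Local Notation cb := (codebook U V0 V1 V2 K L T1 T2).
Local Notation P := (@cb_pmf R U V0 V1 V2 K L T1 T2 pu pv0 p1 p2).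
Local Notation mu := (@mu R U V0 V1 V2 pu pv0 p1 p2).
Local Notation cond_u := (cond_u pv0 p1 p2).
Local Notation cond_v0 := (cond_v0 p1 p2).
Local Notation E1 := (cb_E1 pu_sum pv0_sum p1_sum p2_sum).
Local Notation E2 := (cb_E2 pu_sum pv0_sum p1_sum p2_sum).

(** [d] bounds the conditional mean score of each competitor in [F], so given the codeword in use x
    the sum of score ratios has mean at most #|F| * d x / sc x. *)
Lemma jensen_min_pair (i : idxT) (phi sc : wordT -> R) (F : {set idxT}) (d : wordT -> R) :
  (forall x, 0 <= phi x) -> (forall x, 0 <= sc x) ->
  (forall i' x, i' \in F -> pair_cond pu pv0 p1 p2 i i' sc x <= d x) ->
  \sum_(c : cb) P c * (phi (cword c i) *
     Num.min 1 (\sum_(i' in F) sc (cword c i') / sc (cword c i)))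
  <= \sum_x mu x * (phi x * Num.min 1 (#|F|%:R * d x / sc x)).
Proof.
move=> phi_ge0 sc_ge0 dP.
rewrite -(E1 (fun x => phi x * Num.min 1 (#|F|%:R * d x / sc x)) i).
apply: (jensen_min (X := fun c => cword c i) (h := fun x => #|F|%:R * d x / sc x)) => //.
- by move=> c; exact: cb_pmf_ge0.
- move=> psi psi_ge0.
  rewrite (E1 (fun x => psi x * (#|F|%:R * d x / sc x)) i).
  under eq_bigr => c _ do rewrite 2!mulr_sumr.
  rewrite exchange_big /=.
  apply: (@le_trans _ _ (\sum_(i' in F) \sum_x mu x * (psi x / sc x * d x))).
    apply: ler_sum => i' Fi'.
    have := E2 (fun x => psi x / sc x) sc i i' => E.
    apply: (@le_trans _ _ (\sum_x mu x * (psi x / sc x * pair_cond pu pv0 p1 p2 i i' sc x))).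
      rewrite -E; apply: ler_sum => c _; by rewrite le_eqVlt; apply/orP; left; apply/eqP; ring.
    apply: ler_sum => x _; rewrite ler_wpM2l ?mu_ge0 //.
    by rewrite ler_wpM2l ?divr_ge0 //; exact: dP.
  rewrite sumr_const -[X in X <= _]mulr_natl mulr_sumr; apply: ler_sum => x _.
  by rewrite le_eqVlt; apply/orP; left; apply/eqP; ring.
- by move=> c; apply: sumr_ge0 => i' _; rewrite divr_ge0.
Qed.

(** A maximum likelihood error requires a competitor whose score ratio is at least 1, so its
    indicator is at most min(1, sum of the ratios). Competitors in [Fa] have another cloud centre
    and mean score at most [ca]; those in [Fb] share the centre u and have conditional mean score at
    most [fb u]. That phi vanishes with sc makes the default x / 0 = 0 harmless. *)
Lemma receiver_bound (i : idxT) (phi sc : wordT -> R) (Fa Fb : {set idxT}) (ca : R)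
    (fb : U -> R) (Na Nb : R) :
  (forall x, 0 <= phi x) -> (forall x, 0 <= sc x) -> (forall x, sc x = 0 -> phi x = 0) ->
  \sum_x mu x * sc x <= ca -> (forall u, cond_u sc u <= fb u) ->
  (forall i', i' \in Fa -> i.1.1.1 != i'.1.1.1) ->
  (forall i', i' \in Fb -> i.1.1.1 = i'.1.1.1 /\ i.1.1.2 != i'.1.1.2) ->
  #|Fa|%:R <= Na -> #|Fb|%:R <= Nb ->
  \sum_(c : cb) P c * (phi (cword c i) *
     ([exists i', (i' \in Fa :|: Fb) && (sc (cword c i) <= sc (cword c i'))%R])%:R)
  <= \sum_x mu x * (phi x * (Num.min 1 (Na * ca / sc x)
                             + Num.min 1 (Nb * fb x.1.1.1 / sc x))).
Proof.
move=> phi_ge0 sc_ge0 sc0 caP fbP FaP FbP NaP NbP.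
have ca_ge0 : 0 <= ca.
  by apply: le_trans caP; apply: sumr_ge0 => x _; rewrite mulr_ge0 ?mu_ge0.
have fb_ge0 u : 0 <= fb u.
  apply: le_trans (fbP u); do 3 (apply: sumr_ge0 => ? _).
  by rewrite !mulr_ge0.
have ja := @jensen_min_pair i phi sc Fa (fun=> ca) phi_ge0 sc_ge0.
have jb := @jensen_min_pair i phi sc Fb (fun x => fb x.1.1.1) phi_ge0 sc_ge0.
apply: (@le_trans _ _ (\sum_c P c * (phi (cword c i) *
     Num.min 1 (\sum_(i' in Fa) sc (cword c i') / sc (cword c i))) +
     \sum_c P c * (phi (cword c i) *
     Num.min 1 (\sum_(i' in Fb) sc (cword c i') / sc (cword c i))))).
  rewrite -big_split /=; apply: ler_sum => c _; rewrite -mulrDr.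
  rewrite ler_wpM2l ?cb_pmf_ge0 //.
  set x := cword c i.
  have [/sc0 ->|scx] := eqVneq (sc x) 0; first by rewrite !mul0r addr0.
  have scp : 0 < sc x by rewrite lt_def scx sc_ge0.
  rewrite -mulrDr ler_wpM2l //.
  have mge0 (F : {set idxT}) : 0 <= Num.min 1 (\sum_(i' in F) sc (cword c i') / sc x).
    by rewrite le_min ler01 /=; apply: sumr_ge0 => i' _; rewrite divr_ge0.
  have m1 (F : {set idxT}) i' : i' \in F -> sc x <= sc (cword c i') ->
      Num.min 1 (\sum_(i' in F) sc (cword c i') / sc x) = 1.
    move=> Fi' le; apply/min_idPl; rewrite (bigD1 i') //=.
    apply: (@le_trans _ _ (sc (cword c i') / sc x)); first by rewrite ler_pdivlMr // mul1r.
    by rewrite lerDl; apply: sumr_ge0 => ? _; rewrite divr_ge0.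
  case: existsP => [[i' /andP[]]|_]; last by rewrite addr_ge0.
  rewrite inE => /orP[] Fi' le.
    by rewrite (m1 _ _ Fi' le) lerDl.
  by rewrite (m1 _ _ Fi' le) lerDr.
apply: (@le_trans _ _ (\sum_x mu x * (phi x * Num.min 1 (#|Fa|%:R * ca / sc x)) +
  \sum_x mu x * (phi x * Num.min 1 (#|Fb|%:R * fb x.1.1.1 / sc x)))).
  apply: lerD.
    by apply: ja => i' x /FaP ne; rewrite /pair_cond ne.
  by apply: jb => i' x /FbP[e ne]; rewrite /pair_cond e eqxx ne; exact: fbP.
rewrite -big_split /=; apply: ler_sum => x _.
rewrite -mulrDr ler_wpM2l ?mu_ge0 // -mulrDr ler_wpM2l //.
have mm (a b : R) : a <= b -> Num.min 1 a <= Num.min 1 b.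
  by move=> ab; rewrite le_min !ge_min lexx ab orbT.
by apply: lerD; apply: mm; rewrite // ler_wpM2r ?invr_ge0 // ler_wpM2r.
Qed.

Local Notation cond_v1 := (cond_v1 p2).
Local Notation cond_v2 := (cond_v2 p1).
Local Notation same_cloud := (same_cloud p1 p2).

(** Adding the four cases instead of selecting one makes the bound linear in the indicators of index
    coincidences, so that sums over indices become counts. *)
Lemma same_cloud_le (D : wordT -> R) b1 b2 (x : wordT) : (forall x, 0 <= D x) ->
  same_cloud b1 b2 D x <= cond_v0 D x.1.1.1 x.1.1.2 + b1%:R * cond_v1 D x.1.1.1 x.1.1.2 x.1.2
    + b2%:R * cond_v2 D x.1.1.1 x.1.1.2 x.2 + (b1 && b2)%:R * D x.
Proof.
case: x => [[[u v0] v1] v2] D_ge0 /=.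
have h0 : 0 <= cond_v0 D u v0 by do 2 (apply: sumr_ge0 => ? _); rewrite !mulr_ge0.
have h1 : 0 <= cond_v1 D u v0 v1 by apply: sumr_ge0 => ? _; rewrite mulr_ge0.
have h2 : 0 <= cond_v2 D u v0 v2 by apply: sumr_ge0 => ? _; rewrite mulr_ge0.
have h3 := D_ge0 (u, v0, v1, v2).
by case: b1; case: b2; rewrite /= ?mul1r ?mul0r ?addr0; lra.
Qed.

(** Mean total of [D] over all satellite pairs of the v0-words in [Ls], given the word in use. The
    five terms count these pairs by what they share with it: u only, v0, v0 and v1, v0 and v2,
    everything. *)
Lemma cover_moment (k : K) (l : L) (t1 : T1) (t2 : T2) (Ls : {set L}) (D psi : wordT -> R) :
  (forall x, 0 <= D x) -> (forall x, 0 <= psi x) ->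
  \sum_(c : cb) P c * (psi (cword c (k, l, t1, t2)) *
     \sum_(l' in Ls) \sum_t1' \sum_t2' D (cword c (k, l', t1', t2')))
  <= \sum_x mu x * (psi x * (#|T1|%:R * #|T2|%:R * #|Ls :\ l|%:R * cond_u D x.1.1.1
       + #|T1|%:R * #|T2|%:R * cond_v0 D x.1.1.1 x.1.1.2
       + #|T2|%:R * cond_v1 D x.1.1.1 x.1.1.2 x.1.2
       + #|T1|%:R * cond_v2 D x.1.1.1 x.1.1.2 x.2 + D x)).
Proof.
move=> D_ge0 psi_ge0.
have cu_ge0 u : 0 <= cond_u D u by do 3 (apply: sumr_ge0 => ? _); rewrite !mulr_ge0.
have h0 u v0 : 0 <= cond_v0 D u v0 by do 2 (apply: sumr_ge0 => ? _); rewrite !mulr_ge0.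
have h1 u v0 v1 : 0 <= cond_v1 D u v0 v1 by apply: sumr_ge0 => ? _; rewrite mulr_ge0.
have h2 u v0 v2 : 0 <= cond_v2 D u v0 v2 by apply: sumr_ge0 => ? _; rewrite mulr_ge0.
pose bd (x : wordT) l' t1' t2' : R := (l != l')%:R * cond_u D x.1.1.1 + (l == l')%:R *
  (cond_v0 D x.1.1.1 x.1.1.2 + (t1 == t1')%:R * cond_v1 D x.1.1.1 x.1.1.2 x.1.2
    + (t2 == t2')%:R * cond_v2 D x.1.1.1 x.1.1.2 x.2 + (t1 == t1')%:R * (t2 == t2')%:R * D x).
have step l' t1' t2' : \sum_(c : cb) P c * (psi (cword c (k, l, t1, t2)) *
    D (cword c (k, l', t1', t2'))) <= \sum_x mu x * (psi x * bd x l' t1' t2').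
  rewrite E2; apply: ler_sum => x _; rewrite ler_wpM2l ?mu_ge0 // ler_wpM2l //.
  rewrite /pair_cond /bd /= eqxx /=; case: eqVneq => [_|_] /=.
    rewrite mul1r mul0r add0r; apply: le_trans (same_cloud_le _ _ _ D_ge0) _.
    by rewrite -mulnb natrM.
  by rewrite mul0r mul1r addr0.
under eq_bigr => c _.
  rewrite mulr_sumr mulr_sumr.
  under eq_bigr => l' _.
    rewrite mulr_sumr mulr_sumr.
    under eq_bigr => t1' _ do rewrite mulr_sumr mulr_sumr.
    over.
  over.
rewrite exchange_big /=.
apply: (@le_trans _ _ (\sum_(l' in Ls) \sum_t1' \sum_t2' \sum_x mu x * (psi x * bd x l' t1' t2'))).
  apply: ler_sum => l' _; rewrite exchange_big /=; apply: ler_sum => t1' _.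
  by rewrite exchange_big /=; apply: ler_sum => t2' _; exact: step.
have xch (F : wordT -> L -> T1 -> T2 -> R) :
    \sum_(l' in Ls) \sum_t1' \sum_t2' \sum_x F x l' t1' t2' =
    \sum_x \sum_(l' in Ls) \sum_t1' \sum_t2' F x l' t1' t2'.
  rewrite [RHS]exchange_big /=; apply: eq_bigr => l' _.
  rewrite [RHS]exchange_big /=; apply: eq_bigr => t1' _.
  by rewrite exchange_big.
rewrite xch; apply: ler_sum => x _.
have fac (F : L -> T1 -> T2 -> R) : \sum_(l' in Ls) \sum_t1' \sum_t2' mu x * (psi x * F l' t1'
  t2') =
    mu x * (psi x * \sum_(l' in Ls) \sum_t1' \sum_t2' F l' t1' t2').
  rewrite 2!mulr_sumr; apply: eq_bigr => l' _; rewrite 2!mulr_sumr; apply: eq_bigr => t1' _.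
  by rewrite 2!mulr_sumr.
rewrite fac ler_wpM2l ?mu_ge0 // ler_wpM2l //.
rewrite /bd.
set cu := cond_u _ _; set c0 := cond_v0 _ _ _; set c1 := cond_v1 _ _ _ _.
set c2 := cond_v2 _ _ _ _.
have sum1 (T : finType) (t : T) : \sum_t' (t == t')%:R = 1 :> R.
  rewrite (bigD1 t) //= eqxx big1 ?addr0 // => t' /negbTE; by rewrite eq_sym => ->.
have e l' : \sum_t1' \sum_t2' ((l != l')%:R * cu + (l == l')%:R * (c0 + (t1 == t1')%:R * c1 +
    (t2 == t2')%:R * c2 + (t1 == t1')%:R * (t2 == t2')%:R * D x)) =
    (l != l')%:R * (#|T1|%:R * #|T2|%:R * cu) + (l == l')%:R * (#|T1|%:R * #|T2|%:R * c0 +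
      #|T2|%:R * c1
      + #|T1|%:R * c2 + D x).
  have e2 t1' : \sum_t2' ((l != l')%:R * cu + (l == l')%:R * (c0 + (t1 == t1')%:R * c1 +
    (t2 == t2')%:R * c2 + (t1 == t1')%:R * (t2 == t2')%:R * D x)) =
    #|T2|%:R * ((l != l')%:R * cu + (l == l')%:R * c0) + (l == l')%:R * c2
    + (t1 == t1')%:R * ((l == l')%:R * (#|T2|%:R * c1 + D x)).
    transitivity (\sum_t2' (((l != l')%:R * cu + (l == l')%:R * c0 + (l == l')%:R * (t1 ==
      t1')%:R * c1)
       + (t2 == t2')%:R * ((l == l')%:R * (c2 + (t1 == t1')%:R * D x)))).
      by apply: eq_bigr => t2' _; ring.
    rewrite big_split /= sumr_const -mulr_natl -mulr_suml sum1; ring.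
  under eq_bigr => t1' _ do rewrite e2.
  rewrite big_split /= sumr_const -mulr_natl -mulr_suml sum1; ring.
under eq_bigr => l' _ do rewrite e.
rewrite big_split /= -!mulr_suml.
(* The index [l] may lie outside [Ls], hence an inequality. *)
have le1 : \sum_(l' in Ls) (l == l')%:R <= 1 :> R.
  rewrite -[leRHS](sum1 _ l) [leRHS](bigID (mem Ls)) /= lerDl.
  by apply: sumr_ge0 => *; rewrite ler0n.
set s1 := \sum_(l' in Ls) _ in le1 *.
pose m := #|T1|%:R * #|T2|%:R * c0 + #|T2|%:R * c1 + #|T1|%:R * c2 + D x.
rewrite -/m.
have m_ge0 : 0 <= m.
  by rewrite /m !addr_ge0 ?D_ge0 // mulr_ge0 ?mulr_ge0 ?ler0n // /c0 /c1 /c2 ?h0 ?h1 ?h2.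
have -> : \sum_(l' in Ls) (l != l')%:R = #|Ls :\ l|%:R :> R.
  rewrite -sumr_const big_mkcond [RHS]big_mkcond; apply: eq_bigr => l' _.
  by rewrite !inE eq_sym andbC; case: (l' \in Ls) => //; case: eqP.
have -> : #|T1|%:R * #|T2|%:R * #|Ls :\ l|%:R * cu + #|T1|%:R * #|T2|%:R * c0 + #|T2|%:R * c1 +
  #|T1|%:R * c2 + D x = #|Ls :\ l|%:R * (#|T1|%:R * #|T2|%:R * cu) + m by rewrite /m; ring.
by rewrite lerD2l -[leRHS]mul1r ler_wpM2r.
Qed.

End CodebookBounds.

(** * Likelihood ratios *)

Section Kernels.
Variables (R : realType) (U V0 V1 V2 X O B : finType).

(* Exchanges the roles of receivers 1 and 2. *)
Definition swp (A1 A2 A3 C : Type) (q : A1 -> A2 -> A3 -> C) a1 a3 a2 := q a1 a2 a3.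

Definition chan (px : V0 -> V1 -> V2 -> X -> R) (W : X -> O -> R) (f : O -> B) v0 v1 v2 b : R :=
  \sum_x px v0 v1 v2 x * \sum_(o | f o == b) W x o.
Definition marg (A1 A2 A3 : finType) (q : A1 -> A2 -> A3 -> R) v0 v1 : R := \sum_v2 q v0 v1 v2.
(** p(v1, b | v0); dividing by [marg] gives p(b | v0, v1). The next three are the output laws given
    v0, given u, and without conditioning. *)
Definition kap (q : V0 -> V1 -> V2 -> R) (G : V0 -> V1 -> V2 -> B -> R) v0 v1 b : R :=
  \sum_v2 q v0 v1 v2 * G v0 v1 v2 b.
Definition out0 q G v0 b : R := \sum_v1 kap q G v0 v1 b.
Definition outu (pv0 : U -> V0 -> R) q G u b : R := \sum_v0 pv0 u v0 * out0 q G v0 b.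
Definition outm (pu : U -> R) pv0 q G b : R := \sum_u pu u * outu pv0 q G u b.
(* p(v1,v2|v0) / (p(v1|v0) p(v2|v0)); the factor [pv0 u v0] only makes the ratio vanish
   (x/0 = 0) outside the support of p(v0|u). *)
Definition wt (pv0 : U -> V0 -> R) (q : V0 -> V1 -> V2 -> R) u v0 v1 v2 : R :=
  pv0 u v0 * q v0 v1 v2 / (pv0 u v0 * marg q v0 v1 * marg (swp q) v0 v2).
Definition EP pu (pv0 : U -> V0 -> R) q (G : V0 -> V1 -> V2 -> B -> R)
    (F : U -> V0 -> V1 -> V2 -> B -> R) : R :=
  \sum_u \sum_v0 \sum_v1 \sum_v2 \sum_b
    pu u * pv0 u v0 * q v0 v1 v2 * G v0 v1 v2 b * F u v0 v1 v2 b.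

(* Likelihood ratios whose logarithms have means -I(V0,V1;Y), -I(V0,V1;Y|U), -I(U;Y), I(V0;Y|U),
   I(V0,V1;Y|U), I(V0,V1,V2;Y|U) + I(V1;V2|V0) and I(V1;V2|V0), up to the factor ln 2. *)
Definition rho_m pu pv0 q G (u : U) v0 v1 (v2 : V2) b : R :=
  outm pu pv0 q G b / (kap q G v0 v1 b / marg q v0 v1).
Definition rho_u pv0 q G (u : U) v0 v1 (v2 : V2) b : R :=
  outu pv0 q G u b / (kap q G v0 v1 b / marg q v0 v1).
Definition rho_z pu pv0 q G (u : U) (v0 : V0) (v1 : V1) (v2 : V2) b : R :=
  outm pu pv0 q G b / outu pv0 q G u b.
Definition rho_0 pv0 q G (u : U) (v0 : V0) (v1 : V1) (v2 : V2) b : R :=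
  out0 q G v0 b / outu pv0 q G u b.
Definition rho_1 pv0 q G (u : U) (v0 : V0) (v1 : V1) (v2 : V2) b : R :=
  kap q G v0 v1 b / marg q v0 v1 / outu pv0 q G u b.
Definition rho_12 pv0 q G (u : U) (v0 : V0) (v1 : V1) (v2 : V2) b : R :=
  wt pv0 q u v0 v1 v2 * G v0 v1 v2 b / outu pv0 q G u b.
Definition rho_w pv0 q (u : U) (v0 : V0) (v1 : V1) (v2 : V2) (b : B) : R :=
  wt pv0 q u v0 v1 v2.

End Kernels.

Section SwapKernels.
Variables (R : realType) (U V0 V1 V2 B : finType).
Variables (pu : U -> R) (pv0 : U -> V0 -> R) (q : V0 -> V1 -> V2 -> R)
  (G : V0 -> V1 -> V2 -> B -> R).

Lemma out0_swp v0 b : out0 (swp q) (swp G) v0 b = out0 q G v0 b.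
Proof. by rewrite /out0 /kap exchange_big. Qed.

Lemma outu_swp u b : outu pv0 (swp q) (swp G) u b = outu pv0 q G u b.
Proof. by apply: eq_bigr => v0 _; rewrite out0_swp. Qed.

Lemma outm_swp b : outm pu pv0 (swp q) (swp G) b = outm pu pv0 q G b.
Proof. by apply: eq_bigr => u _; rewrite outu_swp. Qed.

Lemma EP_swp F : EP pu pv0 (swp q) (swp G) F =
  EP pu pv0 q G (fun u v0 v1 v2 b => F u v0 v2 v1 b).
Proof.
by apply: eq_bigr => u _; apply: eq_bigr => v0 _; rewrite exchange_big.
Qed.

End SwapKernels.

Section KernelFacts.
Variables (R : realType) (U V0 V1 V2 : finType).
Variables (pu : U -> R) (pv0 : U -> V0 -> R) (q : V0 -> V1 -> V2 -> R).
Hypotheses (pu_ge0 : forall u, 0 <= pu u) (pv0_ge0 : forall u v, 0 <= pv0 u v)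
  (q_ge0 : forall v0 v1 v2, 0 <= q v0 v1 v2).
Hypotheses (pu_sum : \sum_u pu u = 1) (pv0_sum : forall u, \sum_v pv0 u v = 1)
  (q_sum : forall v0, \sum_v1 \sum_v2 q v0 v1 v2 = 1).

Local Notation p1 := (marg q).
Local Notation p2 := (marg (swp q)).
Local Notation mu := (mu pu pv0 p1 p2).
Local Notation wordT := (wordT U V0 V1 V2).

Lemma marg_ge0 v0 v1 : 0 <= p1 v0 v1.
Proof. by apply: sumr_ge0. Qed.

Lemma margs_ge0 v0 v2 : 0 <= p2 v0 v2.
Proof. by apply: sumr_ge0 => ? _; exact: q_ge0. Qed.

Lemma marg_sum v0 : \sum_v1 p1 v0 v1 = 1.
Proof. exact: q_sum. Qed.

Lemma margs_sum v0 : \sum_v2 p2 v0 v2 = 1.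
Proof. by rewrite -[RHS](q_sum v0) exchange_big. Qed.

Lemma q_le_marg v0 v1 v2 : q v0 v1 v2 <= p1 v0 v1.
Proof. by rewrite /marg (bigD1 v2) //= lerDl sumr_ge0. Qed.

Lemma q_le_margs v0 v1 v2 : q v0 v1 v2 <= p2 v0 v2.
Proof. by rewrite /marg /swp (bigD1 v1) //= lerDl sumr_ge0. Qed.

Definition piw (x : wordT) : R :=
  let: (u, v0, v1, v2) := x in pu u * pv0 u v0 * q v0 v1 v2.
Definition wtx (x : wordT) : R := let: (u, v0, v1, v2) := x in wt pv0 q u v0 v1 v2.

Lemma wtxE u v0 v1 v2 : wtx (u, v0, v1, v2) = wt pv0 q u v0 v1 v2.
Proof. by []. Qed.

Lemma wt_ge0 u v0 v1 v2 : 0 <= wt pv0 q u v0 v1 v2.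
Proof. by rewrite divr_ge0 ?mulr_ge0 ?marg_ge0 ?margs_ge0. Qed.

Lemma wtx_ge0 x : 0 <= wtx x.
Proof. by case: x => [[[u v0] v1] v2]; exact: wt_ge0. Qed.

Lemma piw_ge0 x : 0 <= piw x.
Proof. by case: x => [[[u v0] v1] v2]; rewrite !mulr_ge0. Qed.

Lemma q_eq0 v0 v1 v2 : p1 v0 v1 = 0 \/ p2 v0 v2 = 0 -> q v0 v1 v2 = 0.
Proof.
move=> [] e; apply/eqP; rewrite eq_le q_ge0 andbT -e; [exact: q_le_marg|exact: q_le_margs].
Qed.

(** The change of measure behind the soft draw: [wt] is the density of the target law with respect
    to the codebook law. The zero cases are consistent because q is dominated by both of its
    marginals. *)
Lemma mu_wt x : mu x * wtx x = piw x.
Proof.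
case: x => [[[u v0] v1] v2] /=; rewrite /wt.
have [->|nv] := eqVneq (pv0 u v0) 0; first by rewrite !(mulr0, mul0r).
have [e|n1] := eqVneq (p1 v0 v1) 0; first by rewrite e q_eq0; [rewrite !(mulr0, mul0r)|left].
have [e|n2] := eqVneq (p2 v0 v2) 0; first by rewrite e q_eq0; [rewrite !(mulr0, mul0r)|right].
by field; rewrite n1 n2 nv.
Qed.

(** Only an inequality because [wt] is forced to 0 where pv0 u v0 = 0, while q need not vanish
    there. *)
Lemma wt_le_c0 u v0 v1 v2 : p1 v0 v1 * p2 v0 v2 * wt pv0 q u v0 v1 v2 <= q v0 v1 v2.
Proof.
rewrite /wt.
have [->|nv] := eqVneq (pv0 u v0) 0; first by rewrite !(mulr0, mul0r).
have [e|n1] := eqVneq (p1 v0 v1) 0; first by rewrite e !(mulr0, mul0r).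
have [e|n2] := eqVneq (p2 v0 v2) 0; first by rewrite e !(mulr0, mul0r).
rewrite le_eqVlt; apply/orP; left; apply/eqP.
by field; rewrite n1 n2 nv.
Qed.

Lemma wt_le_c1 u v0 v1 v2 : p2 v0 v2 * wt pv0 q u v0 v1 v2 <= q v0 v1 v2 / p1 v0 v1.
Proof.
have [e|n1] := eqVneq (p1 v0 v1) 0; first by rewrite /wt e invr0 !(mulr0, mul0r, invr0).
rewrite ler_pdivlMr ?lt_def ?n1 ?marg_ge0 // mulrC mulrA; exact: wt_le_c0.
Qed.

Lemma wt_le_c2 u v0 v1 v2 : p1 v0 v1 * wt pv0 q u v0 v1 v2 <= q v0 v1 v2 / p2 v0 v2.
Proof.
have [e|n1] := eqVneq (p2 v0 v2) 0; first by rewrite /wt e invr0 !(mulr0, mul0r, invr0).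
rewrite ler_pdivlMr ?lt_def ?n1 ?margs_ge0 // mulrAC; exact: wt_le_c0.
Qed.

Lemma piw_sum : \sum_x piw x = 1.
Proof.
rewrite sum_word -[RHS]pu_sum; apply: eq_bigr => u _ /=.
rewrite -[RHS]mulr1 -(pv0_sum u) mulr_sumr; apply: eq_bigr => v0 _.
rewrite -[RHS]mulr1 -(q_sum v0) mulr_sumr; apply: eq_bigr => v1 _.
by rewrite mulr_sumr.
Qed.

Section Output.
Variables (B : finType) (G : V0 -> V1 -> V2 -> B -> R).
Hypotheses (G_ge0 : forall v0 v1 v2 b, 0 <= G v0 v1 v2 b)
  (G_sum : forall v0 v1 v2, \sum_b G v0 v1 v2 b = 1).

Definition Gx (b : B) (x : wordT) : R := let: (u, v0, v1, v2) := x in G v0 v1 v2 b.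

Lemma GxE b u v0 v1 v2 : Gx b (u, v0, v1, v2) = G v0 v1 v2 b.
Proof. by []. Qed.

Lemma Gx_ge0 b x : 0 <= Gx b x.
Proof. by case: x => [[[u v0] v1] v2] /=. Qed.

Lemma EPE F : EP pu pv0 q G F =
  \sum_x \sum_b piw x * Gx b x * F x.1.1.1 x.1.1.2 x.1.2 x.2 b.
Proof. by rewrite sum_word; reflexivity. Qed.

Lemma kap_ge0 v0 v1 b : 0 <= kap q G v0 v1 b.
Proof. by apply: sumr_ge0 => ? _; rewrite mulr_ge0. Qed.

Lemma out0_ge0 v0 b : 0 <= out0 q G v0 b.
Proof. by apply: sumr_ge0 => ? _; exact: kap_ge0. Qed.

Lemma outu_ge0 u b : 0 <= outu pv0 q G u b.
Proof. by apply: sumr_ge0 => ? _; rewrite mulr_ge0 ?out0_ge0. Qed.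

Lemma outm_ge0 b : 0 <= outm pu pv0 q G b.
Proof. by apply: sumr_ge0 => ? _; rewrite mulr_ge0 ?outu_ge0. Qed.

Lemma out0_sum v0 : \sum_b out0 q G v0 b = 1.
Proof.
rewrite exchange_big -[RHS](q_sum v0); apply: eq_bigr => v1 _.
rewrite exchange_big; apply: eq_bigr => v2 _.
by rewrite -mulr_sumr G_sum mulr1.
Qed.

Lemma outu_sum u : \sum_b outu pv0 q G u b = 1.
Proof.
rewrite exchange_big -[RHS](pv0_sum u); apply: eq_bigr => v0 _.
by rewrite -mulr_sumr out0_sum mulr1.
Qed.

Lemma EP_sum1 F : EP pu pv0 q G (fun u v0 v1 v2 _ => F u v0 v1 v2)
  = \sum_x piw x * F x.1.1.1 x.1.1.2 x.1.2 x.2.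
Proof.
rewrite EPE; apply: eq_bigr => x _; rewrite -mulr_suml -mulr_sumr.
by case: x => [[[u v0] v1] v2] /=; rewrite G_sum mulr1.
Qed.

(** A competitor drawn afresh below u scores p(b | v0, v1), which averages to p(b | u). This is why
    [outu] is the numerator of [rho_u], and its mean [outm] that of [rho_m]. *)
Lemma cond_u_score1 b u :
  cond_u pv0 p1 p2 (fun x => kap q G x.1.1.2 x.1.2 b / p1 x.1.1.2 x.1.2) u
  <= outu pv0 q G u b.
Proof.
rewrite cond_uE; apply: ler_sum => v0 _; rewrite ler_wpM2l //.
apply: ler_sum => v1 _ /=; rewrite -[leRHS]mulr1 -(margs_sum v0) mulr_sumr.
apply: ler_sum => v2 _; rewrite mulrAC ler_wpM2r ?margs_ge0 //.
have [->|n1] := eqVneq (p1 v0 v1) 0; first by rewrite mul0r kap_ge0.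
by rewrite mulrC divfK.
Qed.

Lemma cond_u_scoreu b u :
  cond_u pv0 p1 p2 (fun x => outu pv0 q G x.1.1.1 b) u <= outu pv0 q G u b.
Proof.
rewrite cond_uE /cond_v0 /=.
under eq_bigr => v0 _.
  under eq_bigr => v1 _.
    rewrite -mulr_suml -mulr_sumr margs_sum mulr1; over.
  rewrite -mulr_suml marg_sum mul1r; over.
by rewrite -mulr_suml pv0_sum mul1r.
Qed.

Lemma sum_mu_le (sc : wordT -> R) b :
  (forall u, cond_u pv0 p1 p2 sc u <= outu pv0 q G u b) ->
  \sum_x mu x * sc x <= outm pu pv0 q G b.
Proof.
by move=> h; rewrite sum_mu; apply: ler_sum => u _; rewrite ler_wpM2l.
Qed.

Lemma cond_u_wt b u :
  cond_u pv0 p1 p2 (fun x => wtx x * Gx b x) u <= outu pv0 q G u b.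
Proof.
rewrite cond_uE; apply: ler_sum => v0 _; rewrite ler_wpM2l //.
apply: ler_sum => v1 _; apply: ler_sum => v2 _.
by rewrite /= mulrA ler_wpM2r // wt_le_c0.
Qed.

Lemma cond_v0_wt b u v0 :
  cond_v0 p1 p2 (fun x => wtx x * Gx b x) u v0 <= out0 q G v0 b.
Proof.
apply: ler_sum => v1 _; apply: ler_sum => v2 _.
by rewrite /= mulrA ler_wpM2r // wt_le_c0.
Qed.

Lemma cond_v1_wt b u v0 v1 :
  cond_v1 p2 (fun x => wtx x * Gx b x) u v0 v1 <= kap q G v0 v1 b / p1 v0 v1.
Proof.
rewrite /kap mulr_suml; apply: ler_sum => v2 _.
by rewrite /= mulrA [leRHS]mulrAC ler_wpM2r // wt_le_c1.
Qed.

Lemma cond_v2_wt b u v0 v2 :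
  cond_v2 p1 (fun x => wtx x * Gx b x) u v0 v2 <= kap (swp q) (swp G) v0 v2 b / p2 v0 v2.
Proof.
rewrite /kap mulr_suml; apply: ler_sum => v1 _.
by rewrite /= mulrA [leRHS]mulrAC ler_wpM2r // wt_le_c2.
Qed.

End Output.
End KernelFacts.

Arguments wtx : simpl never.
Arguments Gx : simpl never.
Arguments piw : simpl never.
Arguments chan : simpl never.
Arguments swp : simpl never.
Arguments marg : simpl never.
Arguments kap : simpl never.
Arguments wt : simpl never.

(** * Elementary inequalities for logarithms and powers *)

Section RealInequalities.
Variable R : realType.
Implicit Types x y s S : R.

Lemma ge1BV_ln x : 0 < x -> 1 - x^-1 <= ln x.
Proof.
move=> x0; have := le_ln1Dx (x := x^-1 - 1).
rewrite [1 + _]addrC subrK lnV ?posrE // => h.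
have : - ln x <= x^-1 - 1 by apply: h; rewrite ltrBrDr addNr invr_gt0.
lra.
Qed.

Lemma min1_powR s x : 0 < s <= 1 -> 0 <= x -> Num.min 1 x <= x `^ s.
Proof.
move=> /andP[s0 s1]; rewrite le_eqVlt => /predU1P[<-|x0].
  by rewrite powR0 ?gt_eqF // ge_min lexx orbT.
have [x1|x1] := leP 1 x.
  rewrite -(powRr0 x); apply: ler_powR => //; exact: ltW.
by apply: ger1_powR => //; rewrite x0 ltW.
Qed.

Lemma ln_powR_le s x : 0 < s -> 0 < x -> ln x <= s^-1 * x `^ s.
Proof.
move=> s0 x0; rewrite ler_pdivlMl // -ln_powR.
exact/ltW/ln_sublinear/powR_gt0.
Qed.

(** For x < 1 use ln(1 + x) <= x <= x^s; for x >= 1 use ln(1 + x) <= ln 2 + ln x with ln 2 <= 1 <=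
    x^s and ln x <= x^s / s. *)
Lemma ln1D_powR s x : 0 < s <= 1 -> 0 <= x -> ln (1 + x) <= (1 + s^-1) * x `^ s.
Proof.
move=> /andP[s0 s1] x_ge0.
have sV : 0 <= s^-1 by rewrite invr_ge0 ltW.
have [x1|x1] := leP 1 x; last first.
  apply: le_trans (le_ln1Dx _) _; first by apply: lt_le_trans x_ge0; rewrite ltrN10.
  apply: (@le_trans _ _ (x `^ s)).
    have := min1_powR (s := s) (x := x); rewrite s0 s1 => /(_ isT x_ge0).
    by case: ltP x1.
  by rewrite mulrDl mul1r lerDl mulr_ge0 ?powR_ge0.
have x0 : 0 < x by apply: lt_le_trans x1.
apply: (@le_trans _ _ (ln (2 * x))).
  by rewrite ler_ln ?posrE ?addr_gt0 ?mulr_gt0 // mulr_natl mulr2n lerD2r.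
rewrite lnM ?posrE // mulrDl mul1r; apply: lerD; last exact: ln_powR_le.
apply: (@le_trans _ _ 1).
  have := le_ln1Dx (x := 1 : R); rewrite -natr1 addrC; apply.
  by apply: lt_trans ltr01; rewrite ltrN10.
by rewrite -(powRr0 x); apply: ler_powR => //; exact: ltW.
Qed.

Lemma ln1D2 x y : 0 <= x -> 0 <= y -> ln (1 + (x + y)) <= ln (1 + x) + ln (1 + y).
Proof.
move=> x0 y0.
have x1 : 0 < 1 + x by rewrite ltr_pwDl.
have y1 : 0 < 1 + y by rewrite ltr_pwDl.
rewrite -lnM ?posrE // ler_ln ?posrE ?mulr_gt0 ?ltr_pwDl ?addr_ge0 //.
have := mulr_ge0 x0 y0; lra.
Qed.

(** With r = sqrt S, comparing Hellinger distance and divergence gives (1 - r)^2 <= S ln S - S + 1.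
    For r <= 1 one has 1 - S <= 2 (1 - r) and 2 (1 - r) eta <= eta^2 + (1 - r)^2. A small relative
    entropy thus becomes a small deficit of mass, with [eta] free to be optimized. *)
Lemma deficit_xlnx (eta S : R) : 0 < eta -> 0 <= S ->
  Num.max 0 (1 - S) <= eta + eta^-1 * (S * ln S - S + 1).
Proof.
move=> eta0 S0.
set r := Num.sqrt S.
have rS : S = r ^+ 2 by rewrite sqr_sqrtr.
have r0 : 0 <= r by exact: sqrtr_ge0.
have key : (1 - r) ^+ 2 <= S * ln S - S + 1.
  have [r00|rp] := eqVneq r 0.
    by rewrite rS r00 expr0n /= mul0r !subr0 !add0r expr1n lexx.
  have {}rp : 0 < r by rewrite lt_def rp.
  have := ge1BV_ln rp => h.
  have e : ln S = 2 * ln r by rewrite rS lnXn // mulr2n mulr_natl mulr2n.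
  have : r ^+ 2 * (1 - r^-1) <= r ^+ 2 * ln r by rewrite ler_pM2l ?exprn_gt0.
  have -> : r ^+ 2 * (1 - r^-1) = r ^+ 2 - r by field; rewrite gt_eqF.
  rewrite e rS; lra.
have D0 : 0 <= S * ln S - S + 1 by apply: le_trans key; exact: sqr_ge0.
rewrite ge_max; apply/andP; split.
  by rewrite addr_ge0 ?mulr_ge0 // ?invr_ge0 ltW.
rewrite -(ler_pM2l eta0) [leRHS]mulrDr [eta * (_^-1 * _)]mulrA divff ?gt_eqF // mul1r.
apply: le_trans (lerD (lexx _) key).
rewrite rS.
have [r1|r1] := leP r 1; last first.
  apply: (@le_trans _ _ 0); last by rewrite -expr2 addr_ge0 ?sqr_ge0.
  by apply: mulr_ge0_le0; [exact: ltW|rewrite subr_le0; nra].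
have h1 : eta * (1 - r ^+ 2) <= eta * (2 * (1 - r)).
  by rewrite ler_pM2l //; nra.
apply: le_trans h1 _; have := sqr_ge0 (eta - (1 - r)); nra.
Qed.

End RealInequalities.

(** * The one-shot bound *)

Section OneShot.
Variables (R : realType) (U V0 V1 V2 X O : finType).
Variables (pu : U -> R) (pv0 : U -> V0 -> R) (q : V0 -> V1 -> V2 -> R)
  (px : V0 -> V1 -> V2 -> X -> R) (W : X -> O -> R).
Hypotheses (pu_ge0 : forall u, 0 <= pu u) (pv0_ge0 : forall u v, 0 <= pv0 u v)
  (q_ge0 : forall v0 v1 v2, 0 <= q v0 v1 v2)
  (px_ge0 : forall v0 v1 v2 x, 0 <= px v0 v1 v2 x) (W_ge0 : forall x o, 0 <= W x o).
Hypotheses (pu_sum : \sum_u pu u = 1) (pv0_sum : forall u, \sum_v pv0 u v = 1)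
  (q_sum : forall v0, \sum_v1 \sum_v2 q v0 v1 v2 = 1)
  (px_sum : forall v0 v1 v2, \sum_x px v0 v1 v2 x = 1) (W_sum : forall x, \sum_o W x o = 1).
Variables (K S J T1 T2 : finType) (k0 : K) (s0 : S) (j0 : J) (t10 : T1) (t20 : T2).

Local Notation L := (S * J)%type.
Local Notation p1 := (marg q).
Local Notation p2 := (marg (swp q)).
Local Notation mu := (mu pu pv0 p1 p2).
Local Notation piw := (piw pu pv0 q).
Local Notation wtx := (wtx pv0 q).
Local Notation wordT := (wordT U V0 V1 V2).
Local Notation idxT := (idxT K L T1 T2).
Local Notation cb := (codebook U V0 V1 V2 K L T1 T2).
Local Notation P := (@cb_pmf R U V0 V1 V2 K L T1 T2 pu pv0 p1 p2).

Let p1_ge0 := marg_ge0 q_ge0.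
Let p2_ge0 := margs_ge0 q_ge0.
Let p1_sum := marg_sum q_sum.
Let p2_sum := margs_sum q_sum.

Lemma P_ge0 c : 0 <= P c.
Proof. exact: cb_pmf_ge0. Qed.

Section Output.
Variables (B : finType) (f : O -> B).
Local Notation G := (chan px W f).
Local Notation Gx := (Gx G).

Lemma chan_ge0 v0 v1 v2 b : 0 <= G v0 v1 v2 b.
Proof. by apply: sumr_ge0 => x _; rewrite mulr_ge0 // sumr_ge0. Qed.

Lemma chan_sum v0 v1 v2 : \sum_b G v0 v1 v2 b = 1.
Proof.
rewrite exchange_big -[RHS](px_sum v0 v1 v2); apply: eq_bigr => x _.
rewrite -mulr_sumr -[RHS]mulr1 -(W_sum x); congr (_ * _).
by rewrite [RHS](partition_big f xpredT).
Qed.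

Definition pxw (y : wordT) x : R := let: (u, v0, v1, v2) := y in px v0 v1 v2 x.
(** p(x | u), the input law that fills a deficit of drawing mass; the output law it induces is
    exactly [outu], the comparison law at Z. *)
Definition pxu (u : U) x : R := \sum_v0 \sum_v1 \sum_v2 pv0 u v0 * q v0 v1 v2 * px v0 v1 v2 x.

Lemma pxw_ge0 y x : 0 <= pxw y x.
Proof. by case: y => [[[u v0] v1] v2] /=. Qed.

Lemma pxu_ge0 u x : 0 <= pxu u x.
Proof. by do 3 (apply: sumr_ge0 => ? _); rewrite !mulr_ge0. Qed.

Lemma pxw_sum y : \sum_x pxw y x = 1.
Proof. by case: y => [[[u v0] v1] v2] /=. Qed.

Lemma pxu_lin u (phi : X -> R) : \sum_x pxu u x * phi x =
  \sum_v0 \sum_v1 \sum_v2 pv0 u v0 * q v0 v1 v2 * \sum_x px v0 v1 v2 x * phi x.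
Proof.
under eq_bigr => x _ do rewrite mulr_suml.
rewrite exchange_big; apply: eq_bigr => v0 _.
under eq_bigr => x _ do rewrite mulr_suml.
rewrite exchange_big; apply: eq_bigr => v1 _.
under eq_bigr => x _ do rewrite mulr_suml.
rewrite exchange_big; apply: eq_bigr => v2 _.
by rewrite mulr_sumr; apply: eq_bigr => x _; rewrite mulrA.
Qed.

Lemma pxu_sum u : \sum_x pxu u x = 1.
Proof.
transitivity (\sum_x pxu u x * 1); first by apply: eq_bigr => x _; rewrite mulr1.
rewrite (pxu_lin u (fun=> 1)) -[RHS](pv0_sum u); apply: eq_bigr => v0 _.
rewrite -[RHS]mulr1 -[in RHS](q_sum v0) mulr_sumr; apply: eq_bigr => v1 _.
rewrite mulr_sumr; apply: eq_bigr => v2 _.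
by under eq_bigr => x _ do rewrite mulr1; rewrite px_sum mulr1.
Qed.

Lemma pxw_chan y b : \sum_x pxw y x * \sum_(o | f o == b) W x o = Gx b y.
Proof. by case: y => [[[u v0] v1] v2]. Qed.

Lemma pxu_chan u b : \sum_x pxu u x * \sum_(o | f o == b) W x o = outu pv0 q G u b.
Proof.
rewrite pxu_lin; apply: eq_bigr => v0 _; rewrite mulr_sumr; apply: eq_bigr => v1 _.
by rewrite mulr_sumr; apply: eq_bigr => v2 _; rewrite mulrA.
Qed.

Lemma pxw_event y (e : B -> bool) :
  \sum_x pxw y x * \sum_o W x o * (e (f o))%:R = \sum_b Gx b y * (e b)%:R.
Proof.
under [RHS]eq_bigr => b _ do rewrite -pxw_chan mulr_suml.
rewrite [RHS]exchange_big; apply: eq_bigr => x _.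
under [RHS]eq_bigr => b _ do rewrite -mulrA.
rewrite -mulr_sumr; congr (_ * _).
rewrite (partition_big f xpredT) //=; apply: eq_bigr => b _.
by rewrite mulr_suml; apply: eq_bigr => o /eqP ->.
Qed.

(** [receiver_bound] is applied to each output letter b with weight wtx * Gx; the change of measure
    then turns [mu] into [piw], and min(1, y) <= y^s extracts the numbers of competitors. *)
Lemma recv_bound (sc : B -> wordT -> R) (err : cb -> B -> bool) (i : idxT)
    (Fa Fb : {set idxT}) (Na Nb s : R) :
  0 < s <= 1 ->
  (forall b x, 0 <= sc b x) -> (forall b x, sc b x = 0 -> wtx x * Gx b x = 0) ->
  (forall b u, cond_u pv0 p1 p2 (sc b) u <= outu pv0 q G u b) ->
  (forall i', i' \in Fa -> i.1.1.1 != i'.1.1.1) ->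
  (forall i', i' \in Fb -> i.1.1.1 = i'.1.1.1 /\ i.1.1.2 != i'.1.1.2) ->
  #|Fa|%:R <= Na -> #|Fb|%:R <= Nb ->
  (forall c b, err c b -> [exists i', (i' \in Fa :|: Fb) &&
     (sc b (cword c i) <= sc b (cword c i'))%R]) ->
  \sum_c P c * (wtx (cword c i) * \sum_b Gx b (cword c i) * (err c b)%:R) <=
  Na `^ s * (\sum_x \sum_b piw x * Gx b x * (outm pu pv0 q G b / sc b x) `^ s)
  + Nb `^ s * (\sum_x \sum_b piw x * Gx b x * (outu pv0 q G x.1.1.1 b / sc b x) `^ s).
Proof.
move=> s01 sc_ge0 sc0 scu FaP FbP NaP NbP errP.
have Na0 : 0 <= Na by apply: le_trans NaP.
have Nb0 : 0 <= Nb by apply: le_trans NbP.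
have wG_ge0 b x : 0 <= wtx x * Gx b x.
  by rewrite mulr_ge0 ?wtx_ge0 ?Gx_ge0 //; exact: chan_ge0.
apply: (@le_trans _ _ (\sum_b \sum_c P c * (wtx (cword c i) * Gx b (cword c i) *
    ([exists i', (i' \in Fa :|: Fb) &&
     (sc b (cword c i) <= sc b (cword c i'))%R])%:R))).
  rewrite exchange_big; apply: ler_sum => c _; rewrite -mulr_sumr ler_wpM2l ?P_ge0 //.
  rewrite mulr_sumr; apply: ler_sum => b _; rewrite mulrA ler_wpM2l //.
  by rewrite ler_nat; case: (err c b) (@errP c b) => [->|] //; rewrite leq0n.
rewrite !mulr_sumr -big_split /=.
apply: (@le_trans _ _ (\sum_b \sum_x mu x * (wtx x * Gx b x *
  (Num.min 1 (Na * outm pu pv0 q G b / sc b x)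
                + Num.min 1 (Nb * outu pv0 q G x.1.1.1 b / sc b x))))).
  apply: ler_sum => b _.
  apply: (receiver_bound pu_ge0 pv0_ge0 p1_ge0 p2_ge0 pu_sum pv0_sum p1_sum p2_sum
     (fb := fun u => outu pv0 q G u b)) => //.
    exact: sc0.
  exact: sum_mu_le.
rewrite exchange_big; apply: ler_sum => x _.
rewrite !mulr_sumr -big_split /=; apply: ler_sum => b _.
rewrite (mulrA (mu x)) (mulrA (mu x)) mu_wt // mulrDr.
have GP : 0 <= piw x * Gx b x by rewrite mulr_ge0 ?piw_ge0 ?Gx_ge0 //; exact: chan_ge0.
have st N y : 0 <= N -> 0 <= y ->
   piw x * Gx b x * Num.min 1 (N * y / sc b x) <=
   N `^ s * (piw x * Gx b x * (y / sc b x) `^ s).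
  move=> N0 y0; have yr0 : 0 <= y / sc b x by rewrite divr_ge0.
  by rewrite mulrCA -powRM // -(mulrA N) ler_wpM2l // min1_powR // mulr_ge0.
apply: lerD; apply: st => //; [apply: outm_ge0|apply: outu_ge0] => //; exact: chan_ge0.
Qed.

End Output.

(** * The soft-draw encoder and its mass *)

Local Notation Nt := (#|T1|%:R * #|T2|%:R : R).
Local Notation cword := (@cword U V0 V1 V2 K L T1 T2).

Definition Qw (c : cb) k l t1 t2 : R := Nt^-1 * wtx (cword c (k, l, t1, t2)).
Definition Sm (c : cb) k l : R := \sum_t1 \sum_t2 Qw c k l t1 t2.
(* The mass of the drawing weights is only close to 1: an excess is normalized away and a deficit
   is filled with p(x|u). *)
Definition encE (c : cb) k l x : R :=
  (Num.max 1 (Sm c k l))^-1 *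
    (\sum_t1 \sum_t2 Qw c k l t1 t2 * pxw (cword c (k, l, t1, t2)) x)
  + (1 - (Num.max 1 (Sm c k l))^-1 * Sm c k l) * pxu (c k).1 x.

Lemma card_gt0R (T : finType) (t : T) : 0 < #|T|%:R :> R.
Proof. by rewrite ltr0n; apply/card_gt0P; exists t. Qed.

Lemma Nt_gt0 : 0 < Nt.
Proof. by rewrite mulr_gt0 ?(card_gt0R t10) ?(card_gt0R t20). Qed.

Lemma sum_const2 (x : R) : \sum_(t1 : T1) \sum_(t2 : T2) x = Nt * x.
Proof.
by rewrite !sumr_const -[LHS]mulr_natl -[x *+ _]mulr_natl mulrA.
Qed.

Lemma Qw_ge0 c k l t1 t2 : 0 <= Qw c k l t1 t2.
Proof. by rewrite mulr_ge0 ?invr_ge0 ?(ltW Nt_gt0) ?wtx_ge0. Qed.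

Lemma Sm_ge0 c k l : 0 <= Sm c k l.
Proof. by do 2 (apply: sumr_ge0 => ? _); exact: Qw_ge0. Qed.

Lemma max1_gt0 y : 0 < Num.max 1 y :> R.
Proof. by rewrite lt_max ltr01. Qed.

Lemma deficitE y : 1 - (Num.max 1 y)^-1 * y = Num.max 0 (1 - y) :> R.
Proof.
have [y1|y1] := leP 1 y; last first.
  by rewrite invr1 mul1r max_r // subr_ge0 ltW.
by rewrite mulVf ?gt_eqF ?(lt_le_trans ltr01) // subrr max_l // subr_le0.
Qed.

Lemma deficit_ge0 y : 0 <= Num.max 0 (1 - y) :> R.
Proof. by rewrite le_max lexx. Qed.

Lemma deficit_le1 y : 0 <= y -> Num.max 0 (1 - y) <= 1 :> R.
Proof. by move=> y0; rewrite ge_max ler01 /=; lra. Qed.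

Lemma encE_ge0 c k l x : 0 <= encE c k l x.
Proof.
rewrite addr_ge0 ?mulr_ge0 ?deficitE ?deficit_ge0 ?pxu_ge0 ?invr_ge0 ?(ltW (max1_gt0 _)) //.
by do 2 (apply: sumr_ge0 => ? _); rewrite mulr_ge0 ?Qw_ge0 ?pxw_ge0.
Qed.

Lemma encE_lin c k l (phi : X -> R) : \sum_x encE c k l x * phi x =
  (Num.max 1 (Sm c k l))^-1 * (\sum_t1 \sum_t2 Qw c k l t1 t2 *
     \sum_x pxw (cword c (k, l, t1, t2)) x * phi x)
  + (1 - (Num.max 1 (Sm c k l))^-1 * Sm c k l) * \sum_x pxu (c k).1 x * phi x.
Proof.
under eq_bigr => x _ do rewrite mulrDl -!mulrA.
rewrite big_split /= -!mulr_sumr; congr (_ * _ + _).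
under [LHS]eq_bigr => x _ do rewrite mulr_suml.
rewrite [LHS]exchange_big; apply: eq_bigr => t1 _.
under [LHS]eq_bigr => x _ do rewrite mulr_suml.
rewrite [LHS]exchange_big; apply: eq_bigr => t2 _.
by rewrite mulr_sumr; apply: eq_bigr => x _; rewrite mulrA.
Qed.

Lemma encE_sum c k l : \sum_x encE c k l x = 1.
Proof.
transitivity (\sum_x encE c k l x * 1); first by apply: eq_bigr => x _; rewrite mulr1.
rewrite encE_lin.
have -> : \sum_x pxu (c k).1 x * 1 = 1.
  by rewrite -[RHS](pxu_sum (c k).1); apply: eq_bigr => x _; rewrite mulr1.
have -> : \sum_t1 \sum_t2 Qw c k l t1 t2 * (\sum_x pxw (cword c (k, l, t1, t2)) x * 1)
   = Sm c k l.
  apply: eq_bigr => t1 _; apply: eq_bigr => t2 _.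
  by under eq_bigr => x _ do rewrite mulr1; rewrite pxw_sum mulr1.
by rewrite mulr1 addrC subrK.
Qed.

(** The normalizing factor is at most 1 and is dropped. What remains is linear in the drawing
    weights, so that codebook averages act term by term, plus the deficit. *)
Lemma encE_le c k l (phi : X -> R) : (forall x, 0 <= phi x) ->
  \sum_x encE c k l x * phi x <=
  (\sum_t1 \sum_t2 Qw c k l t1 t2 * \sum_x pxw (cword c (k, l, t1, t2)) x * phi x)
  + Num.max 0 (1 - Sm c k l) * \sum_x pxu (c k).1 x * phi x.
Proof.
move=> phi_ge0; rewrite encE_lin deficitE lerD2r -[leRHS]mul1r ler_wpM2r //.
  do 2 (apply: sumr_ge0 => ? _); rewrite mulr_ge0 ?Qw_ge0 //.
  by apply: sumr_ge0 => ? _; rewrite mulr_ge0 ?pxw_ge0.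
by rewrite invf_le1 ?max1_gt0 // le_max lexx.
Qed.

Local Notation E1 := (cb_E1 pu_sum pv0_sum p1_sum p2_sum).

Lemma Sm_mean k l : \sum_c P c * Sm c k l = 1.
Proof.
have e t1 t2 : \sum_c P c * Qw c k l t1 t2 = Nt^-1.
  rewrite /Qw; under eq_bigr => c _ do rewrite mulrCA.
  rewrite -mulr_sumr (E1 wtx (k, l, t1, t2)).
  by under eq_bigr => x _ do rewrite mu_wt //; rewrite piw_sum // mulr1.
under eq_bigr => c _ do rewrite mulr_sumr.
rewrite exchange_big /=.
under eq_bigr => t1 _.
  under eq_bigr => c _ do rewrite mulr_sumr.
  rewrite exchange_big /=; under eq_bigr => t2 _ do rewrite e.
  over.
by rewrite sum_const2 divff // gt_eqF // Nt_gt0.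
Qed.

Lemma wtx_cond_v0 u v0 : cond_v0 p1 p2 wtx u v0 <= 1.
Proof.
rewrite -(q_sum v0); apply: ler_sum => v1 _; apply: ler_sum => v2 _; exact: wt_le_c0.
Qed.

Lemma wtx_cond_v1 u v0 v1 : cond_v1 p2 wtx u v0 v1 <= 1.
Proof.
apply: (@le_trans _ _ (\sum_v2 q v0 v1 v2 / p1 v0 v1)).
  by apply: ler_sum => v2 _; exact: wt_le_c1.
rewrite -mulr_suml -/(marg q v0 v1); have [->|n] := eqVneq (p1 v0 v1) 0.
  by rewrite mul0r.
by rewrite divff.
Qed.

Lemma wtx_cond_v2 u v0 v2 : cond_v2 p1 wtx u v0 v2 <= 1.
Proof.
apply: (@le_trans _ _ (\sum_v1 q v0 v1 v2 / p2 v0 v2)).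
  by apply: ler_sum => v1 _; exact: wt_le_c2.
rewrite -mulr_suml -[\sum_v1 _]/(marg (swp q) v0 v2).
have [->|n] := eqVneq (p2 v0 v2) 0; first by rewrite mul0r.
by rewrite divff.
Qed.

(** Mutual covering. One factor [Sm] selects a drawn word, which has the target law after the change
    of measure; given that word, Jensen for ln needs only the mean of [Sm]. Fresh pairs contribute
    at most 1, pairs sharing v1 or v2 at most 1 / #|T1| and 1 / #|T2|, and the word itself wtx /
    (#|T1| * #|T2|), whose moment of order s is small when the satellite rates sum to more than
    I(V1;V2|V0). *)
Lemma Sm_entropy s k l : 0 < s <= 1 -> \sum_c P c * (Sm c k l * ln (Sm c k l)) <=
  #|T1|%:R^-1 + #|T2|%:R^-1 +
  (1 + s^-1) * (Nt^-1 `^ s * \sum_x piw x * wtx x `^ s).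
Proof.
move=> s01.
have NV : 0 <= Nt^-1 by rewrite invr_ge0 ltW // Nt_gt0.
have sp : 0 <= 1 + s^-1 by case/andP: s01 => s_gt0 _; rewrite addr_ge0 ?invr_ge0 // ltW.
have T1V : 0 <= #|T1|%:R^-1 :> R by rewrite invr_ge0.
have T2V : 0 <= #|T2|%:R^-1 :> R by rewrite invr_ge0.
pose h x := 1 + (#|T1|%:R^-1 + #|T2|%:R^-1 + Nt^-1 * wtx x).
have y_ge0 x : 0 <= Nt^-1 * wtx x by rewrite mulr_ge0 ?wtx_ge0.
have h_gt0 x : 0 < h x by rewrite /h ltr_pwDl // !addr_ge0.
set CB := (X in _ <= X).
have main t1 t2 : \sum_c P c * (wtx (cword c (k, l, t1, t2)) * ln (Sm c k l)) <= CB.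
  apply: (@le_trans _ _ (\sum_c P c * (wtx (cword c (k, l, t1, t2)) *
            ln (h (cword c (k, l, t1, t2)))))).
    apply: (jensen_ln (X := fun c => cword c (k, l, t1, t2)) (phi := wtx)) => //.
    - exact: P_ge0.
    - by move=> x; exact: wtx_ge0.
    - move=> psi psi_ge0.
      rewrite (E1 (fun x => psi x * h x) (k, l, t1, t2)).
      have := cover_moment pu_ge0 pv0_ge0 p1_ge0 p2_ge0 pu_sum pv0_sum p1_sum p2_sum
        k l t1 t2 [set l] (wtx_ge0 pv0_ge0 q_ge0) psi_ge0.
      rewrite finset.setDv cards0 => cm.
      have -> : \sum_c P c * (psi (cword c (k, l, t1, t2)) * Sm c k l) =
         Nt^-1 * \sum_(c : cb) P c * (psi (cword c (k, l, t1, t2)) *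
     \sum_(l' in [set l]) \sum_t1' \sum_t2' wtx (cword c (k, l', t1', t2'))).
        rewrite mulr_sumr; apply: eq_bigr => c _; rewrite big_set1 [RHS]mulrCA; congr (_ * _).
        rewrite [RHS]mulrCA; congr (_ * _); rewrite mulr_sumr; apply: eq_bigr => t1' _.
        by rewrite mulr_sumr.
      apply: le_trans (ler_wpM2l NV cm) _.
      rewrite mulr_sumr; apply: ler_sum => x _; rewrite [leLHS]mulrCA ler_wpM2l ?mu_ge0 //.
      rewrite [leLHS]mulrCA ler_wpM2l // mulr0 mul0r add0r.
      have n1 := card_gt0R t10; have n2 := card_gt0R t20.
      apply: (@le_trans _ _ (Nt^-1 * (Nt * 1 + #|T2|%:R * 1 + #|T1|%:R * 1 + wtx x))).
        rewrite ler_wpM2l // lerD2r; apply: lerD; last first.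
          by rewrite ler_wpM2l // wtx_cond_v2.
        apply: lerD; last by rewrite ler_wpM2l // wtx_cond_v1.
        by rewrite ler_wpM2l ?wtx_cond_v0 // ltW // Nt_gt0.
      rewrite /h le_eqVlt; apply/orP; left; apply/eqP.
      by field; rewrite !gt_eqF.
    - move=> c; have [e|n] := eqVneq (wtx (cword c (k, l, t1, t2))) 0; first by left.
      right; rewrite /Sm (bigD1 t1) //= (bigD1 t2) //=.
      rewrite ltr_pwDl //; last first.
        by do 2 (apply: sumr_ge0 => ? _); exact: Qw_ge0.
      rewrite ltr_pwDl //; last by apply: sumr_ge0 => ? _; exact: Qw_ge0.
      by rewrite mulr_gt0 ?invr_gt0 ?Nt_gt0 // lt_def n wtx_ge0.
  rewrite (E1 (fun x => wtx x * ln (h x)) (k, l, t1, t2)).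
  apply: (@le_trans _ _ (\sum_x piw x * (#|T1|%:R^-1 + #|T2|%:R^-1
      + (1 + s^-1) * (Nt^-1 `^ s * wtx x `^ s)))).
    apply: ler_sum => x _; rewrite mulrA mu_wt // ler_wpM2l ?piw_ge0 //.
    apply: le_trans (ln1D2 _ _) _; rewrite ?addr_ge0 //.
    apply: lerD.
      by apply: le_ln1Dx; apply: lt_le_trans (addr_ge0 T1V T2V); rewrite ltrN10.
    by rewrite -powRM ?wtx_ge0 // ln1D_powR.
  under eq_bigr => x _ do rewrite mulrDr.
  rewrite big_split /= -mulr_suml piw_sum // mul1r lerD2l.
  rewrite !mulr_sumr; apply: ler_sum => x _.
  by rewrite le_eqVlt; apply/orP; left; apply/eqP; ring.
have -> : \sum_c P c * (Sm c k l * ln (Sm c k l)) =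
    \sum_t1 \sum_t2 Nt^-1 * \sum_c P c * (wtx (cword c (k, l, t1, t2)) * ln (Sm c k l)).
  under [RHS]eq_bigr => t1 _ do under eq_bigr => t2 _ do rewrite mulr_sumr.
  under [RHS]eq_bigr => t1 _ do rewrite exchange_big.
  rewrite [RHS]exchange_big /=; apply: eq_bigr => c _.
  rewrite {1}/Sm mulr_suml mulr_sumr; apply: eq_bigr => t1 _.
  rewrite mulr_suml mulr_sumr; apply: eq_bigr => t2 _.
  by rewrite /Qw; ring.
apply: (@le_trans _ _ (\sum_(t1 : T1) \sum_(t2 : T2) Nt^-1 * CB)).
  by do 2 (apply: ler_sum => ? _); rewrite ler_wpM2l.
by rewrite sum_const2 mulrA divff ?mul1r // gt_eqF // Nt_gt0.
Qed.

(** In the mean of S ln S - S + 1 the last two terms cancel, because [Sm] has mean 1. *)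
Lemma deficit_bound s eta k l : 0 < s <= 1 -> 0 < eta ->
  \sum_c P c * Num.max 0 (1 - Sm c k l) <= eta + eta^-1 * (#|T1|%:R^-1 + #|T2|%:R^-1 +
  (1 + s^-1) * (Nt^-1 `^ s * \sum_x piw x * wtx x `^ s)).
Proof.
move=> s01 eta0.
apply: (@le_trans _ _ (\sum_c P c * (eta + eta^-1 * (Sm c k l * ln (Sm c k l) - Sm c k l + 1)))).
  by apply: ler_sum => c _; rewrite ler_wpM2l ?P_ge0 // deficit_xlnx ?Sm_ge0.
have Psum : \sum_c P c = 1 by exact: cb_pmf_sum.
rewrite [leLHS](_ : _ = eta + eta^-1 * \sum_c P c * (Sm c k l * ln (Sm c k l))).
  by rewrite lerD2l ler_wpM2l ?invr_ge0 ?(ltW eta0) // Sm_entropy.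
transitivity (\sum_c (P c * eta + eta^-1 * (P c * (Sm c k l * ln (Sm c k l))) 
   - eta^-1 * (P c * Sm c k l) + eta^-1 * P c)).
  by apply: eq_bigr => c _; ring.
by rewrite !big_split /= sumrN -mulr_suml -!mulr_sumr Psum Sm_mean; ring.
Qed.

(** * Soft covering at the eavesdropper *)

Section Leakage.
Variables (Z : finType) (fz : O -> Z).
Local Notation Gz := (chan px W fz).
Local Notation Gx := (Gx Gz).
Local Notation qz := (outu pv0 q Gz).
Local Notation Jn := (#|J|%:R : R).
Let Gz_ge0 := chan_ge0 fz.
Let Gz_sum := chan_sum fz.

(** Idealized output measure at Z for given k and s: drawing weights without normalization or
    filler, hence of mass 1 only on average. [Pz] is the actual output law. *)
Definition Gs (c : cb) k s z : R := Jn^-1 * \sum_j \sum_t1 \sum_t2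
  Qw c k (s, j) t1 t2 * Gx z (cword c (k, (s, j), t1, t2)).
Definition Pz (c : cb) k s z : R := Jn^-1 * \sum_j \sum_x
  encE c k (s, j) x * \sum_(o | fz o == z) W x o.

(** Here the factor [pv0 u v0] in [wt] pays off: words outside the support of p(v0|u) get weight 0,
    so the idealized output is dominated by [qz]. *)
Lemma wG_dom z x : qz x.1.1.1 z = 0 -> wtx x * Gx z x = 0.
Proof.
case: x => [[[u v0] v1] v2]; rewrite wtxE GxE /wt /= => q0.
have : pv0 u v0 * q v0 v1 v2 * Gz v0 v1 v2 z = 0.
  apply/eqP; rewrite eq_le !mulr_ge0 ?andbT //.
  rewrite -q0 /outu (bigD1 v0) //= /out0 (bigD1 v1) //= /kap (bigD1 v2) //=.
  rewrite !mulrDr mulrA -!addrA lerDl !addr_ge0 ?mulr_ge0 //.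
  - by apply: sumr_ge0 => ? _; rewrite mulr_ge0.
  - by do 2 (apply: sumr_ge0 => ? _); rewrite mulr_ge0.
  - by apply: sumr_ge0 => ? _; rewrite mulr_ge0 //; exact: out0_ge0.
by move=> e; rewrite mulrAC e mul0r.
Qed.

Lemma Gs_ge0 (c : cb) k s z : 0 <= Gs c k s z.
Proof.
rewrite mulr_ge0 ?invr_ge0 //; do 3 (apply: sumr_ge0 => ? _).
by rewrite mulr_ge0 ?Qw_ge0 ?Gx_ge0.
Qed.

Lemma Pz_ge0 (c : cb) k s z : 0 <= Pz c k s z.
Proof.
rewrite mulr_ge0 ?invr_ge0 //; do 2 (apply: sumr_ge0 => ? _).
by rewrite mulr_ge0 ?encE_ge0 // sumr_ge0.
Qed.

Lemma qz_ge0 u z : 0 <= qz u z.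
Proof. exact: outu_ge0. Qed.

Lemma Gs_dom (c : cb) k s z : qz (c k).1 z = 0 -> Gs c k s z = 0.
Proof.
move=> q0; rewrite /Gs big1 ?mulr0 // => j _; rewrite big1 // => t1 _.
rewrite big1 // => t2 _; rewrite /Qw -mulrA wG_dom ?mulr0 //.
Qed.

Lemma Jn_gt0 : 0 < Jn.
Proof. exact: card_gt0R j0. Qed.

Lemma sumJ_const (x : R) : Jn^-1 * \sum_(j : J) x = x.
Proof. by rewrite sumr_const -[x *+ _]mulr_natl mulrA mulVf ?mul1r // gt_eqF // Jn_gt0. Qed.

(** Normalization only decreases the drawn part, and the filler contributes a fraction of [qz]
    itself. *)
Lemma Pz_le (c : cb) k s z : Pz c k s z <= Gs c k s z + qz (c k).1 z.
Proof.
have Wz_ge0 x : 0 <= \sum_(o | fz o == z) W x o by apply: sumr_ge0.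
rewrite -[qz _ _]sumJ_const -mulrDr ler_wpM2l ?invr_ge0 // -big_split /=.
apply: ler_sum => j _; apply: le_trans (encE_le _ _ _ Wz_ge0) _.
apply: lerD.
  by do 2 (apply: ler_sum => ? _); rewrite pxw_chan.
rewrite pxu_chan -[leRHS]mul1r ler_wpM2r ?qz_ge0 // deficit_le1 // Sm_ge0 //.
Qed.

Lemma Pz_dom (c : cb) k s z : qz (c k).1 z = 0 -> Pz c k s z = 0.
Proof.
move=> q0; apply/eqP; rewrite eq_le Pz_ge0 andbT.
by apply: le_trans (Pz_le _ _ _ _) _; rewrite Gs_dom // q0 addr0.
Qed.

Lemma Gs_sum (c : cb) k s : \sum_z Gs c k s z = Jn^-1 * \sum_j Sm c k (s, j).
Proof.
rewrite -mulr_sumr exchange_big; congr (_ * _); apply: eq_bigr => j _.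
rewrite exchange_big; apply: eq_bigr => t1 _.
rewrite exchange_big; apply: eq_bigr => t2 _.
rewrite -mulr_sumr -[RHS]mulr1; congr (_ * _).
exact: Gz_sum.
Qed.

(** The summand 1 inside ln makes every term non-negative, so that a Markov argument can choose the
    codebook; the sum still dominates the divergence of [Pz] from [qz]. *)
Definition leak (c : cb) k s : R := \sum_z Pz c k s z * ln (1 + Pz c k s z / qz (c k).1 z).

Lemma leak_ge0 (c : cb) k s : 0 <= leak c k s.
Proof.
apply: sumr_ge0 => z _; rewrite mulr_ge0 ?Pz_ge0 // ln_ge0 // lerDl.
by rewrite divr_ge0 ?Pz_ge0 ?qz_ge0.
Qed.

(** Write P, g, w for the values of [Pz], [Gs], [qz]. From P <= g + w follows ln(1 + P/w) <= ln 2 +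
    ln(1 + g/w), and the cross term w ln(1 + g/w) is at most g. *)
Lemma leak_le (c : cb) k s : leak c k s <=
  ln 2 * (Jn^-1 * (\sum_j Sm c k (s, j)) + 1) + Jn^-1 * (\sum_j Sm c k (s, j))
  + \sum_z Gs c k s z * ln (1 + Gs c k s z / qz (c k).1 z).
Proof.
rewrite -Gs_sum.
have q1 : \sum_z qz (c k).1 z = 1 by apply: outu_sum.
rewrite [leRHS](_ : _ = ln 2 * (\sum_z Gs c k s z + \sum_z qz (c k).1 z) + \sum_z Gs c k s z
  + \sum_z Gs c k s z * ln (1 + Gs c k s z / qz (c k).1 z)); last by rewrite q1.
rewrite -big_split /= mulr_sumr -!big_split /=; apply: ler_sum => z _.
set g := Gs _ _ _ _; set w := qz _ _; set p := Pz _ _ _ _.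
have g0 : 0 <= g by exact: Gs_ge0.
have w0 : 0 <= w by exact: qz_ge0.
have p0 : 0 <= p by exact: Pz_ge0.
have gw0 : 0 <= g / w by rewrite divr_ge0.
have ln2 : 0 <= ln 2 :> R by rewrite ln_ge0 // ler1n.
have l0 : 0 <= ln (1 + g / w) by rewrite ln_ge0 // lerDl.
have pw : p / w <= 1 + g / w.
  have [e|wn] := eqVneq w 0; first by rewrite e invr0 !mulr0 addr0.
  rewrite addrC -(divff wn) -mulrDl ler_wpM2r ?invr_ge0 //; exact: Pz_le.
have lp : ln (1 + p / w) <= ln 2 + ln (1 + g / w).
  apply: le_trans (_ : ln (1 + (1 + g / w)) <= _).
    by rewrite ler_ln ?lerD2l // posrE ltr_pwDl ?addr_ge0 ?divr_ge0.
  by apply: le_trans (ln1D2 _ _) _.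
apply: (@le_trans _ _ ((g + w) * (ln 2 + ln (1 + g / w)))).
  apply: ler_pM => //; first by rewrite ln_ge0 // lerDl divr_ge0.
  exact: Pz_le.
have wl : w * ln (1 + g / w) <= g.
  have [e|wn] := eqVneq w 0; first by rewrite e mul0r.
  have wp : 0 < w by rewrite lt_def wn.
  apply: (@le_trans _ _ (w * (g / w))); last by rewrite mulrC divfK.
  rewrite ler_wpM2l //; apply: le_ln1Dx; apply: lt_le_trans gw0; by rewrite ltrN10.
have -> : (g + w) * (ln 2 + ln (1 + g / w)) = ln 2 * (g + w) + w * ln (1 + g / w) + g * ln (1 + g
  / w) by ring.
by rewrite lerD2r lerD2l.
Qed.

(** The four moments stem from codewords that share with the one in use v0 only, v0 and v1, v0 and
    v2, or everything. They stay bounded when the rates of [J], of [J] with [T1], of [J] with [T2]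
    and of all three exceed I(V0;Z|U), I(V0,V1;Z|U), I(V0,V2;Z|U) and I(V0,V1,V2;Z|U) +
    I(V1;V2|V0). *)
Definition leak_bound (s : R) : R := ln 2 + (1 + s^-1) *
  (Jn^-1 `^ s * EP pu pv0 q Gz (fun u v0 v1 v2 z => rho_0 pv0 q Gz u v0 v1 v2 z `^ s) +
   (Jn^-1 * #|T1|%:R^-1) `^ s *
     EP pu pv0 q Gz (fun u v0 v1 v2 z => rho_1 pv0 q Gz u v0 v1 v2 z `^ s) +
   (Jn^-1 * #|T2|%:R^-1) `^ s *
     EP pu pv0 (swp q) (swp Gz)
       (fun u v0 v2 v1 z => rho_1 pv0 (swp q) (swp Gz) u v0 v2 v1 z `^ s) +
   (Jn^-1 * Nt^-1) `^ s *
     EP pu pv0 q Gz (fun u v0 v1 v2 z => rho_12 pv0 q Gz u v0 v1 v2 z `^ s)).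

(** The device of [Sm_entropy] again: one factor [Gs] selects the word in use, and Jensen for ln
    needs only the mean of Gs / qz given this word, which [cover_moment] supplies. *)
Lemma Gs_entropy s k s1 : 0 < s <= 1 ->
  \sum_c P c * (\sum_z Gs c k s1 z * ln (1 + Gs c k s1 z / qz (c k).1 z)) <= leak_bound s.
Proof.
move=> s01.
have NV : 0 <= Nt^-1 by rewrite invr_ge0 ltW // Nt_gt0.
have JV : 0 <= Jn^-1 by rewrite invr_ge0 ltW // Jn_gt0.
have sp : 0 <= 1 + s^-1 by case/andP: s01 => s_gt0 _; rewrite addr_ge0 ?invr_ge0 // ltW.
have T1V : 0 <= #|T1|%:R^-1 :> R by rewrite invr_ge0.
have T2V : 0 <= #|T2|%:R^-1 :> R by rewrite invr_ge0.
have k1_ge0 v0 v1 z : 0 <= kap q Gz v0 v1 z by apply: kap_ge0.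
have k2_ge0 v0 v2 z : 0 <= kap (swp q) (swp Gz) v0 v2 z.
  by apply: sumr_ge0 => v1 _; rewrite /swp mulr_ge0.
have o0_ge0 v0 z : 0 <= out0 q Gz v0 z by apply: out0_ge0.
pose a0 (x : wordT) z := Jn^-1 * rho_0 pv0 q Gz x.1.1.1 x.1.1.2 x.1.2 x.2 z.
pose a1 (x : wordT) z := Jn^-1 * #|T1|%:R^-1 * rho_1 pv0 q Gz x.1.1.1 x.1.1.2 x.1.2 x.2 z.
pose a2 (x : wordT) z := Jn^-1 * #|T2|%:R^-1 *
  rho_1 pv0 (swp q) (swp Gz) x.1.1.1 x.1.1.2 x.2 x.1.2 z.
pose a12 (x : wordT) z := Jn^-1 * Nt^-1 * rho_12 pv0 q Gz x.1.1.1 x.1.1.2 x.1.2 x.2 z.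
have r0_ge0 (x : wordT) z : 0 <= rho_0 pv0 q Gz x.1.1.1 x.1.1.2 x.1.2 x.2 z.
  by apply: divr_ge0 => //; exact: qz_ge0.
have r1_ge0 (x : wordT) z : 0 <= rho_1 pv0 q Gz x.1.1.1 x.1.1.2 x.1.2 x.2 z.
  by apply: divr_ge0; [apply: divr_ge0 => //; exact: p1_ge0|exact: qz_ge0].
have r2_ge0 (x : wordT) z :
    0 <= rho_1 pv0 (swp q) (swp Gz) x.1.1.1 x.1.1.2 x.2 x.1.2 z.
  rewrite /rho_1 outu_swp.
  by apply: divr_ge0; [apply: divr_ge0 => //; exact: p2_ge0|exact: qz_ge0].
have r12_ge0 (x : wordT) z : 0 <= rho_12 pv0 q Gz x.1.1.1 x.1.1.2 x.1.2 x.2 z.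
  by apply: divr_ge0; [apply: mulr_ge0 => //; exact: wt_ge0|exact: qz_ge0].
have JT1 : 0 <= Jn^-1 * #|T1|%:R^-1 by exact: mulr_ge0.
have JT2 : 0 <= Jn^-1 * #|T2|%:R^-1 by exact: mulr_ge0.
have JN : 0 <= Jn^-1 * Nt^-1 by exact: mulr_ge0.
have a0_ge0 x z : 0 <= a0 x z by exact: mulr_ge0.
have a1_ge0 x z : 0 <= a1 x z by exact: mulr_ge0.
have a2_ge0 x z : 0 <= a2 x z by exact: mulr_ge0.
have a12_ge0 x z : 0 <= a12 x z by exact: mulr_ge0.
(* The outer 1 is the one inside ln; the inner 1 bounds the contribution of fresh v0-words, whose
   mean output is [qz]. Together they produce the constant ln 2. *)
pose h z x := 1 + (1 + (a0 x z + (a1 x z + (a2 x z + a12 x z)))).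
have h_gt0 z x : 0 < h z x by rewrite /h ltr_pwDl // !addr_ge0.
have wG_ge0 z x : 0 <= wtx x * Gx z x by rewrite mulr_ge0 ?wtx_ge0 ?Gx_ge0.
pose CB : R := \sum_x \sum_z piw x * Gx z x * (ln 2 + (1 + s^-1) * (a0 x z `^ s + a1 x z `^ s
  + a2 x z `^ s + a12 x z `^ s)).
have CBE : CB = leak_bound s.
  rewrite /leak_bound.
  rewrite (EP_swp pu pv0 q Gz (fun u v0 v2 v1 z => rho_1 pv0 (swp q) (swp Gz) u v0 v2 v1 z `^ s)).
  rewrite !EPE // !mulr_sumr.
  have one : \sum_x \sum_z piw x * Gx z x = 1.
    rewrite -[RHS](piw_sum pu_sum pv0_sum q_sum); apply: eq_bigr => -[[[u v0] v1] v2] _.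
    by rewrite -mulr_sumr (eq_bigr _ (fun b _ => GxE Gz b u v0 v1 v2)) Gz_sum mulr1.
  have ln2E : ln 2 = \sum_x \sum_z piw x * Gx z x * ln 2.
    under eq_bigr => x _ do rewrite -mulr_suml.
    by rewrite -mulr_suml one mul1r.
  rewrite [X in _ = X + _]ln2E -!big_split /= mulr_sumr -big_split /=.
  apply: eq_bigr => x _; rewrite !mulr_sumr -!big_split /= mulr_sumr -big_split /=.
  apply: eq_bigr => z _; rewrite /a0 /a1 /a2 /a12.
  rewrite (powRM s JV (r0_ge0 x z)) (powRM s JT1 (r1_ge0 x z)) (powRM s JT2 (r2_ge0 x z)).
  rewrite (powRM s JN (r12_ge0 x z)).
  move: (rho_0 _ _ _ _ _ _ _ _ `^ s) (rho_1 pv0 q _ _ _ _ _ _ `^ s)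
    (rho_1 pv0 (swp q) _ _ _ _ _ _ `^ s) (rho_12 _ _ _ _ _ _ _ _ `^ s) => ? ? ? ?.
  by ring.
have main j t1 t2 : \sum_c P c * (\sum_z wtx (cword c (k, (s1, j), t1, t2)) *
     Gx z (cword c (k, (s1, j), t1, t2)) * ln (1 + Gs c k s1 z / qz (c k).1 z)) <= CB.
  set i := (k, (s1, j), t1, t2) : idxT.
  under eq_bigr => c _ do rewrite mulr_sumr.
  rewrite exchange_big /= /CB [leRHS]exchange_big /=; apply: ler_sum => z _.
  apply: (@le_trans _ _ (\sum_c P c * (wtx (cword c i) * Gx z (cword c i) *
            ln (h z (cword c i))))).
    apply: (jensen_ln (X := fun c => cword c i) (phi := fun x => wtx x * Gx z x)) => //.
    - exact: P_ge0.
    - move=> psi psi_ge0.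
      rewrite (E1 (fun x => psi x * h z x) i).
      (* The word in use determines u, so after division by [qz] this is still a test function of
         that word. *)
      pose psi' x := psi x / qz x.1.1.1 z.
      have psi'_ge0 x : 0 <= psi' x by rewrite divr_ge0 ?qz_ge0.
      pose Ls : {set L} := [set l : L | l.1 == s1].
      have := cover_moment pu_ge0 pv0_ge0 p1_ge0 p2_ge0 pu_sum pv0_sum p1_sum p2_sum
        k (s1, j) t1 t2 Ls (wG_ge0 z) psi'_ge0.
      rewrite -/i => cm.
      have cardLs : #|Ls :\ (s1, j)|%:R <= Jn.
        rewrite ler_nat; apply: leq_trans (subset_leq_card (subD1set _ _)) _.
        have -> : Ls = finset.setX [set s1] [set: J].
          by apply/setP => -[a b]; rewrite !inE /= andbT.
        by rewrite cardsX cards1 cardsT mul1n.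
      have e1 c : psi (cword c i) * (1 + Gs c k s1 z / qz (c k).1 z) =
          psi (cword c i) + Jn^-1 * Nt^-1 * (psi' (cword c i) *
          \sum_(l' in Ls) \sum_t1' \sum_t2' wtx (cword c (k, l', t1', t2')) *
             Gx z (cword c (k, l', t1', t2'))).
        have -> : \sum_(l' in Ls) \sum_t1' \sum_t2' wtx (cword c (k, l', t1', t2')) *
             Gx z (cword c (k, l', t1', t2')) = Jn * Nt * Gs c k s1 z.
          have cancelJ (y : R) : Jn * Nt * (Jn^-1 * y) = Nt * y.
            by rewrite mulrACA mulrA mulrAC divff ?gt_eqF ?Jn_gt0 // mul1r mulrC.
          rewrite /Gs cancelJ [RHS]mulr_sumr.
          transitivity (\sum_(l' : L) \sum_t1' \sum_t2' (l'.1 == s1)%:R * (wtx (cword c (k, l',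
            t1', t2')) *
             Gx z (cword c (k, l', t1', t2')))).
            rewrite big_mkcond; apply: eq_bigr => l' _; rewrite inE.
            case: eqP => _; last first.
              by rewrite big1 // => ? _; rewrite big1 // => ? _; rewrite mul0r.
            by apply: eq_bigr => ? _; apply: eq_bigr => ? _; rewrite mul1r.
          have sumL (F : L -> R) : \sum_l' F l' = \sum_s' \sum_j' F (s', j').
            by rewrite pair_bigA; apply: eq_bigr => -[].
          rewrite sumL /=.
          rewrite (bigD1 s1) //= [X in _ + X]big1 ?addr0; last first.
            move=> s' /negbTE ->; rewrite big1 // => ? _; rewrite big1 // => ? _.
            by rewrite big1 // => ? _; rewrite mul0r.
          apply: eq_bigr => j' _; rewrite mulr_sumr; apply: eq_bigr => t1' _.
          rewrite mulr_sumr; apply: eq_bigr => t2' _.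
          by rewrite eqxx mul1r /Qw !mulrA divff ?mul1r // gt_eqF // Nt_gt0.
        rewrite /psi' mulrDr mulr1; congr (_ + _).
        have -> : (cword c i).1.1.1 = (c k).1 by [].
        rewrite [RHS](_ : _ = (Jn^-1 * Jn) * (Nt^-1 * Nt) *
           (psi (cword c i) * (Gs c k s1 z / qz (c k).1 z))); last by ring.
        by rewrite !mulVf ?mul1r // gt_eqF ?Nt_gt0 ?Jn_gt0.
      under eq_bigr => c _ do rewrite e1 mulrDr.
      rewrite big_split /= (E1 psi i).
      have -> : \sum_x mu x * (psi x * h z x) = \sum_x mu x * psi x + \sum_x mu x *
         (psi x * (1 + (a0 x z + (a1 x z + (a2 x z + a12 x z))))).
        by rewrite -big_split /=; apply: eq_bigr => x _; rewrite /h; ring.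
      rewrite lerD2l.
      under eq_bigr => c _ do rewrite mulrCA.
      rewrite -mulr_sumr; apply: le_trans (ler_wpM2l _ cm) _; first by rewrite mulr_ge0.
      rewrite mulr_sumr; apply: ler_sum => x _.
      rewrite [leLHS]mulrCA ler_wpM2l ?mu_ge0 // /psi' -[psi x / _ * _]mulrA [leLHS]mulrCA.
      rewrite ler_wpM2l //.
      have [q0|qn] := eqVneq (qz x.1.1.1 z) 0.
        by rewrite q0 invr0 mul0r mulr0 !addr_ge0.
      have qp : 0 < qz x.1.1.1 z by rewrite lt_def qn qz_ge0.
      have n1 := card_gt0R t10; have n2 := card_gt0R t20; have n3 := Jn_gt0.
      apply: (@le_trans _ _ (Jn^-1 * Nt^-1 * ((qz x.1.1.1 z)^-1 *
        (Nt * Jn * qz x.1.1.1 z + Nt * out0 q Gz x.1.1.2 z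
         + #|T2|%:R * (kap q Gz x.1.1.2 x.1.2 z / p1 x.1.1.2 x.1.2)
         + #|T1|%:R * (kap (swp q) (swp Gz) x.1.1.2 x.2 z / p2 x.1.1.2 x.2)
         + wtx x * Gx z x)))).
        apply: ler_wpM2l; first by rewrite mulr_ge0.
        apply: ler_wpM2l; first by rewrite invr_ge0 ltW.
        rewrite lerD2r; apply: lerD; last by rewrite ler_wpM2l // cond_v2_wt.
        apply: lerD; last by rewrite ler_wpM2l // cond_v1_wt.
        apply: lerD; last by rewrite ler_wpM2l ?cond_v0_wt // ltW // Nt_gt0.
        have cu0 : 0 <= cond_u pv0 p1 p2 (fun y => wtx y * Gx z y) x.1.1.1.
          do 3 (apply: sumr_ge0 => ? _); apply: mulr_ge0; last exact: wG_ge0.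
          by rewrite !mulr_ge0 ?p1_ge0 ?p2_ge0.
        have N_ge0 : 0 <= Nt by exact: ltW Nt_gt0.
        have NL : 0 <= Nt * #|Ls :\ (s1, j)|%:R by exact: mulr_ge0.
        apply: (ler_pM NL cu0); first exact: ler_wpM2l.
        exact: cond_u_wt.
      rewrite le_eqVlt; apply/orP; left; apply/eqP.
      rewrite /a0 /a1 /a2 /a12 /rho_0 /rho_1 /rho_12 (outu_swp pv0 q Gz).
      have -> : wtx x = wt pv0 q x.1.1.1 x.1.1.2 x.1.2 x.2 by case: (x) => [[[? ?] ?] ?].
      have -> : Gx z x = Gz x.1.1.2 x.1.2 x.2 z by case: (x) => [[[? ?] ?] ?].
      set kk1 := _ / p1 _ _; set kk2 := _ / p2 _ _.
      by field; rewrite !gt_eqF.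
    - move=> c; right; rewrite ltr_pwDl // divr_ge0 ?Gs_ge0 ?qz_ge0 //.
  rewrite (E1 (fun x => wtx x * Gx z x * ln (h z x)) i).
  apply: ler_sum => x _; rewrite mulrA (mulrA (mu x)) mu_wt //.
  rewrite ler_wpM2l ?mulr_ge0 ?piw_ge0 ?Gx_ge0 //.
  apply: le_trans (ln1D2 _ _) _; rewrite ?addr_ge0 //.
  apply: lerD => //.
  apply: le_trans (ln1D2 _ _) _; rewrite ?addr_ge0 //.
  rewrite -!addrA [leRHS]mulrDr; apply: lerD; first exact: ln1D_powR.
  apply: le_trans (ln1D2 _ _) _; rewrite ?addr_ge0 //.
  rewrite [leRHS]mulrDr; apply: lerD; first exact: ln1D_powR.
  apply: le_trans (ln1D2 _ _) _; rewrite ?addr_ge0 //.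
  by rewrite [leRHS]mulrDr; apply: lerD; exact: ln1D_powR.
rewrite -CBE.
have -> : \sum_c P c * (\sum_z Gs c k s1 z * ln (1 + Gs c k s1 z / qz (c k).1 z)) =
  Jn^-1 * \sum_j Nt^-1 * \sum_t1 \sum_t2 \sum_c P c * (\sum_z wtx (cword c (k, (s1, j), t1, t2)) *
     Gx z (cword c (k, (s1, j), t1, t2)) * ln (1 + Gs c k s1 z / qz (c k).1 z)).
  transitivity (\sum_c Jn^-1 * \sum_j Nt^-1 * \sum_t1 \sum_t2 P c * (\sum_z wtx (cword c (k, (s1,
    j), t1, t2)) *
     Gx z (cword c (k, (s1, j), t1, t2)) * ln (1 + Gs c k s1 z / qz (c k).1 z))).
    apply: eq_bigr => c _.
    rewrite mulr_sumr [RHS]mulr_sumr.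
    under eq_bigr => z _.
      rewrite {1}/Gs mulr_sumr mulr_suml mulr_sumr; over.
    rewrite exchange_big; apply: eq_bigr => j _.
    rewrite mulr_sumr [RHS]mulr_sumr.
    under eq_bigr => z _.
      rewrite mulr_sumr mulr_suml mulr_sumr; over.
    rewrite exchange_big; apply: eq_bigr => t1 _.
    rewrite !mulr_sumr.
    under eq_bigr => z _.
      rewrite mulr_sumr mulr_suml mulr_sumr; over.
    rewrite exchange_big; apply: eq_bigr => t2 _.
    rewrite !mulr_sumr; apply: eq_bigr => z _; rewrite /Qw; ring.
  rewrite -mulr_sumr; congr (_ * _); rewrite exchange_big; apply: eq_bigr => j _.
  rewrite -mulr_sumr; congr (_ * _); rewrite exchange_big; apply: eq_bigr => t1 _.
  by rewrite exchange_big.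
rewrite -[leRHS]sumJ_const ler_wpM2l //; apply: ler_sum => j _.
apply: (@le_trans _ _ (Nt^-1 * \sum_(t1 : T1) \sum_(t2 : T2) CB)).
  by rewrite ler_wpM2l //; do 2 (apply: ler_sum => ? _); exact: main.
by rewrite sum_const2 mulrA mulVf ?mul1r // gt_eqF // Nt_gt0.
Qed.

(** The masses in [leak_le] average to 1, so its first part becomes ln 2 * (1 + 1) + 1. *)
Lemma leak_mean s k s1 : 0 < s <= 1 ->
  \sum_c P c * leak c k s1 <= 2 * ln 2 + 1 + leak_bound s.
Proof.
move=> s01.
apply: (@le_trans _ _ (\sum_c P c * (ln 2 * (Jn^-1 * (\sum_j Sm c k (s1, j)) + 1) + Jn^-1 *
  (\sum_j Sm c k (s1, j))
  + \sum_z Gs c k s1 z * ln (1 + Gs c k s1 z / qz (c k).1 z)))).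
  by apply: ler_sum => c _; rewrite ler_wpM2l ?P_ge0 // leak_le.
have Psum : \sum_c P c = 1 by exact: cb_pmf_sum.
have JS : \sum_c P c * (Jn^-1 * \sum_j Sm c k (s1, j)) = 1.
  under eq_bigr => c _ do rewrite mulrCA mulr_sumr.
  rewrite -mulr_sumr exchange_big /=.
  under eq_bigr => j _ do rewrite Sm_mean.
  exact: sumJ_const.
under eq_bigr => c _ do rewrite mulrDr.
rewrite big_split /= lerD ?Gs_entropy // [leLHS](_ : _ = 2 * ln 2 + 1) //.
transitivity ((ln 2 + 1) * (\sum_c P c * (Jn^-1 * \sum_j Sm c k (s1, j))) + ln 2 * \sum_c P c).
  by rewrite !mulr_sumr -big_split /=; apply: eq_bigr => c _; ring.
by rewrite JS Psum; ring.
Qed.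

End Leakage.

(** * Maximum likelihood receivers and the choice of a codebook *)

Definition best (sc : wordT -> R) (c : cb) : idxT :=
  [arg max_(j > ((k0, (s0, j0), t10, t20) : idxT)) sc (cword c j)]%O.

Lemma best_ge sc c i : sc (cword c i) <= sc (cword c (best sc c)).
Proof. by rewrite /best; case: arg_maxP => // j _; exact. Qed.

Section Receivers.
Variables (B1 B2 Z : finType) (f1 : O -> B1) (f2 : O -> B2) (fz : O -> Z).
Local Notation G1 := (chan px W f1).
Local Notation G2 := (chan px W f2).
Local Notation Gz := (chan px W fz).
Local Notation Kn := (#|K|%:R : R).
Local Notation Ln := (#|{: L}|%:R : R).

Definition sc1 b (x : wordT) := kap q G1 x.1.1.2 x.1.2 b / p1 x.1.1.2 x.1.2.
Definition sc2 b (x : wordT) := kap (swp q) (swp G2) x.1.1.2 x.2 b / p2 x.1.1.2 x.2.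
Definition sc3 z (x : wordT) := outu pv0 q Gz x.1.1.1 z.

Definition decode1 c b : K * L := (best (sc1 b) c).1.1.
Definition decode2 c b : K * L := (best (sc2 b) c).1.1.
Definition decode3 c z : K := (best (sc3 z) c).1.1.1.

Definition errs (c : cb) k l o : bool :=
  [|| decode1 c (f1 o) != (k, l), decode2 c (f2 o) != (k, l) | decode3 c (fz o) != k].

Definition err_code (c : cb) k l : R :=
  \sum_x encE c k l x * \sum_o W x o * (errs c k l o)%:R.

(** [sc1] does not read the v2-index, so each competitor may be represented with the index t2 of the
    word in use, which reduces their number to #|K| * #|L| * #|T1|. A wrong v1-index with the right
    k and l is not an error, hence no term for it. *)
Lemma recv1 s k l t1 t2 : 0 < s <= 1 ->
  \sum_c P c * (wtx (cword c (k, l, t1, t2)) *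
    \sum_b Gx G1 b (cword c (k, l, t1, t2)) * (decode1 c b != (k, l))%:R) <=
  (Kn * Ln * #|T1|%:R) `^ s *
    EP pu pv0 q G1 (fun u v0 v1 v2 b => rho_m pu pv0 q G1 u v0 v1 v2 b `^ s)
  + (Ln * #|T1|%:R) `^ s *
    EP pu pv0 q G1 (fun u v0 v1 v2 b => rho_u pv0 q G1 u v0 v1 v2 b `^ s).
Proof.
move=> s01; rewrite !EPE.
have := @recv_bound B1 f1 sc1 (fun c b => decode1 c b != (k, l)) (k, l, t1, t2)
  [set j : idxT | (j.2 == t2) && (j.1.1.1 != k)]
  [set j : idxT | [&& j.2 == t2, j.1.1.1 == k & j.1.1.2 != l]]
  (Kn * Ln * #|T1|%:R) (Ln * #|T1|%:R) s s01.
apply => //.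
- by move=> b x; rewrite divr_ge0 ?kap_ge0 ?p1_ge0 //; exact: chan_ge0.
- move=> b [[[u v0] v1] v2]; rewrite /sc1 /wtx /Gx /wt /= => e.
  have Gb := chan_ge0 f1.
  have qG : q v0 v1 v2 * G1 v0 v1 v2 b = 0.
    have [p10|p1n] := eqVneq (p1 v0 v1) 0.
      by rewrite (q_eq0 q_ge0 (or_introl p10)) mul0r.
    move/eqP: e; rewrite mulf_eq0 invr_eq0 (negbTE p1n) orbF => /eqP e.
    apply/eqP; rewrite eq_le mulr_ge0 // andbT -e /kap (bigD1 v2) //= lerDl.
    by apply: sumr_ge0 => ? _; rewrite mulr_ge0.
  by rewrite mulrAC -(mulrA (pv0 u v0) (q v0 v1 v2)) qG mulr0 mul0r.
- by move=> b u; apply: cond_u_score1 => //; exact: chan_ge0.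
- by move=> i'; rewrite inE => /andP[_]; rewrite eq_sym.
- by move=> i'; rewrite inE => /and3P[_ /eqP -> ?]; rewrite eq_sym.
- rewrite -!natrM ler_nat.
  apply: (@leq_trans #|finset.setX [set: K * L * T1] [set t2]|).
    apply: subset_leq_card; apply/fintype.subsetP => -[[[? ?] ?] ?].
    by rewrite !inE /= => /andP[-> _].
  by rewrite cardsX cardsT cards1 muln1 !card_prod.
- rewrite -!natrM ler_nat.
  apply: (@leq_trans #|finset.setX (finset.setX (finset.setX [set k] [set: L]) [set: T1]) [set
    t2]|).
    apply: subset_leq_card; apply/fintype.subsetP => -[[[? ?] ?] ?].
    by rewrite !inE /= => /and3P[-> -> _].
  by rewrite !cardsX !cardsT !cards1 mul1n muln1.
- move=> c b ne; apply/existsP.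
  set j := best (sc1 b) c.
  exists (j.1.1, j.1.2, t2); rewrite !inE /= eqxx /=; apply/andP; split.
    move: ne; rewrite /decode1 -/j; case: (j) => [[[k' l'] ?] ?] /=.
    by rewrite xpair_eqE negb_and; case: eqVneq.
  apply: le_trans (best_ge (sc1 b) c _) _; rewrite -/j.
  by case: (j) => [[[? ?] ?] ?].
Qed.

Lemma recv2 s k l t1 t2 : 0 < s <= 1 ->
  \sum_c P c * (wtx (cword c (k, l, t1, t2)) *
    \sum_b Gx G2 b (cword c (k, l, t1, t2)) * (decode2 c b != (k, l))%:R) <=
  (Kn * Ln * #|T2|%:R) `^ s *
    EP pu pv0 (swp q) (swp G2)
      (fun u v0 v2 v1 b => rho_m pu pv0 (swp q) (swp G2) u v0 v2 v1 b `^ s)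
  + (Ln * #|T2|%:R) `^ s *
    EP pu pv0 (swp q) (swp G2)
      (fun u v0 v2 v1 b => rho_u pv0 (swp q) (swp G2) u v0 v2 v1 b `^ s).
Proof.
move=> s01.
rewrite (EP_swp pu pv0 q G2
      (fun u v0 v2 v1 b => rho_m pu pv0 (swp q) (swp G2) u v0 v2 v1 b `^ s)).
rewrite (EP_swp pu pv0 q G2
      (fun u v0 v2 v1 b => rho_u pv0 (swp q) (swp G2) u v0 v2 v1 b `^ s)) !EPE.
have k2_ge0 v0 v2 b : 0 <= kap (swp q) (swp G2) v0 v2 b.
  by apply: sumr_ge0 => v1 _; rewrite /swp mulr_ge0 //; exact: chan_ge0.
have := @recv_bound B2 f2 sc2 (fun c b => decode2 c b != (k, l)) (k, l, t1, t2)
  [set j : idxT | (j.1.2 == t1) && (j.1.1.1 != k)]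
  [set j : idxT | [&& j.1.2 == t1, j.1.1.1 == k & j.1.1.2 != l]]
  (Kn * Ln * #|T2|%:R) (Ln * #|T2|%:R) s s01.
move=> rb; apply: le_trans (rb _ _ _ _ _ _ _ _) _ => //.
- by move=> b x; rewrite divr_ge0 ?p2_ge0.
- move=> b [[[u v0] v1] v2]; rewrite /sc2 /wtx /Gx /wt /= => e.
  have Gb := chan_ge0 f2.
  have qG : q v0 v1 v2 * G2 v0 v1 v2 b = 0.
    have [p10|p1n] := eqVneq (p2 v0 v2) 0.
      by rewrite (q_eq0 q_ge0 (or_intror p10)) mul0r.
    move/eqP: e; rewrite mulf_eq0 invr_eq0 (negbTE p1n) orbF => /eqP e.
    apply/eqP; rewrite eq_le mulr_ge0 // andbT -e /kap (bigD1 v1) //= /swp lerDl.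
    by apply: sumr_ge0 => ? _; rewrite mulr_ge0.
  by rewrite mulrAC -(mulrA (pv0 u v0) (q v0 v1 v2)) qG mulr0 mul0r.
- move=> b u; rewrite cond_uE -outu_swp; apply: ler_sum => v0 _; rewrite ler_wpM2l //.
  rewrite /cond_v0 exchange_big; apply: ler_sum => v2 _ /=.
  rewrite -[leRHS]mulr1 -[in leRHS](p1_sum v0) mulr_sumr.
  apply: ler_sum => v1 _; rewrite /sc2 /=.
  rewrite -mulrA mulrC ler_wpM2r ?p1_ge0 //.
  have [->|n1] := eqVneq (p2 v0 v2) 0; first by rewrite mul0r.
  by rewrite mulrC divfK.
- by move=> i'; rewrite inE => /andP[_]; rewrite eq_sym.
- by move=> i'; rewrite inE => /and3P[_ /eqP -> ?]; rewrite eq_sym.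
- rewrite -!natrM ler_nat.
  apply: (@leq_trans #|finset.setX (finset.setX [set: K * L] [set t1]) [set: T2]|).
    apply: subset_leq_card; apply/fintype.subsetP => -[[[? ?] ?] ?].
    by rewrite !inE /= => /andP[-> _].
  by rewrite !cardsX !cardsT !cards1 muln1 !card_prod.
- rewrite -!natrM ler_nat.
  apply: (@leq_trans #|finset.setX (finset.setX (finset.setX [set k] [set: L]) [set t1]) [set:
    T2]|).
    apply: subset_leq_card; apply/fintype.subsetP => -[[[? ?] ?] ?].
    by rewrite !inE /= => /and3P[-> -> _].
  by rewrite !cardsX !cardsT !cards1 mul1n muln1.
- move=> c b ne; apply/existsP.
  set j := best (sc2 b) c.
  exists (j.1.1, t1, j.2); rewrite !inE /= eqxx /=; apply/andP; split.
    move: ne; rewrite /decode2 -/j; case: (j) => [[[k' l'] ?] ?] /=.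
    by rewrite xpair_eqE negb_and; case: eqVneq.
  apply: le_trans (best_ge (sc2 b) c _) _; rewrite -/j.
  by case: (j) => [[[? ?] ?] ?].
- rewrite /rho_m /rho_u.
  apply: lerD; (apply: ler_wpM2l; first exact: powR_ge0).
    by apply: ler_sum => x _; apply: ler_sum => b _; rewrite outm_swp lexx.
  by apply: ler_sum => x _; apply: ler_sum => b _; rewrite outu_swp lexx.
Qed.

Lemma recv3 s k l t1 t2 : 0 < s <= 1 ->
  \sum_c P c * (wtx (cword c (k, l, t1, t2)) *
    \sum_z Gx Gz z (cword c (k, l, t1, t2)) * (decode3 c z != k)%:R) <=
  Kn `^ s * EP pu pv0 q Gz (fun u v0 v1 v2 z => rho_z pu pv0 q Gz u v0 v1 v2 z `^ s).
Proof.
move=> s01; rewrite !EPE.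
(* [sc3] reads only k, so competitors keep all other indices of the word in use. The class sharing
   the cloud centre is empty, and its term vanishes as 0 to the power s. *)
have := @recv_bound Z fz sc3 (fun c z => decode3 c z != k) (k, l, t1, t2)
  [set j : idxT | [&& j.1.1.2 == l, j.1.2 == t1, j.2 == t2 & j.1.1.1 != k]]
  finset.set0 Kn 0 s s01.
have s_neq0 : s != 0 by case/andP: s01 => sp _; rewrite gt_eqF.
rewrite powR0 // mul0r addr0.
apply => //.
- by move=> z x; apply: outu_ge0 => //; exact: chan_ge0.
- by move=> z x; apply: wG_dom.
- by move=> z u; apply: cond_u_scoreu => //; exact: chan_ge0.
- by move=> i'; rewrite inE => /and4P[_ _ _]; rewrite eq_sym.
- by move=> i'; rewrite inE.
- rewrite ler_nat.
  apply: (@leq_trans #|finset.setX (finset.setX (finset.setX [set: K] [set l]) [set t1]) [set t2]|).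
    apply: subset_leq_card; apply/fintype.subsetP => -[[[? ?] ?] ?].
    by rewrite !inE /= => /and4P[-> -> -> _].
  by rewrite !cardsX !cardsT !cards1 !muln1.
- by rewrite cards0.
- move=> c z ne; apply/existsP.
  set j := best (sc3 z) c.
  exists (j.1.1.1, l, t1, t2); rewrite !inE /= !eqxx orbF /=; apply/andP; split; first exact: ne.
  apply: le_trans (best_ge (sc3 z) c _) _; rewrite -/j.
  by case: (j) => [[[? ?] ?] ?].
Qed.

(** Receivers 1 and 2 have one term for a wrong cloud centre and one for a right centre with a wrong
    v0-index; Z has one term. The deficit of drawing mass is charged entirely as error. *)
Definition err_bound (s eta : R) : R :=
  (Kn * Ln * #|T1|%:R) `^ s *
    EP pu pv0 q G1 (fun u v0 v1 v2 b => rho_m pu pv0 q G1 u v0 v1 v2 b `^ s)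
  + (Ln * #|T1|%:R) `^ s *
    EP pu pv0 q G1 (fun u v0 v1 v2 b => rho_u pv0 q G1 u v0 v1 v2 b `^ s)
  + ((Kn * Ln * #|T2|%:R) `^ s *
    EP pu pv0 (swp q) (swp G2)
      (fun u v0 v2 v1 b => rho_m pu pv0 (swp q) (swp G2) u v0 v2 v1 b `^ s)
  + (Ln * #|T2|%:R) `^ s *
    EP pu pv0 (swp q) (swp G2)
      (fun u v0 v2 v1 b => rho_u pv0 (swp q) (swp G2) u v0 v2 v1 b `^ s))
  + Kn `^ s * EP pu pv0 q Gz (fun u v0 v1 v2 z => rho_z pu pv0 q Gz u v0 v1 v2 z `^ s)
  + (eta + eta^-1 * (#|T1|%:R^-1 + #|T2|%:R^-1 + (1 + s^-1) * (Nt^-1 `^ s *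
      EP pu pv0 q Gz (fun u v0 v1 v2 z => rho_w pv0 q u v0 v1 v2 z `^ s)))).

Lemma err_code_ge0 c k l : 0 <= err_code c k l.
Proof.
apply: sumr_ge0 => x _; rewrite mulr_ge0 ?encE_ge0 //.
by apply: sumr_ge0 => o _; rewrite mulr_ge0.
Qed.

Lemma err_code_mean s eta k l : 0 < s <= 1 -> 0 < eta ->
  \sum_c P c * err_code c k l <= err_bound s eta.
Proof.
move=> s01 eta0.
pose ev (c : cb) t1 t2 : R := let y := cword c (k, l, t1, t2) in
  \sum_b Gx G1 b y * (decode1 c b != (k, l))%:R
  + \sum_b Gx G2 b y * (decode2 c b != (k, l))%:R
  + \sum_z Gx Gz z y * (decode3 c z != k)%:R.
apply: (@le_trans _ _ (\sum_c P c * ((\sum_t1 \sum_t2 Qw c k l t1 t2 * ev c t1 t2)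
    + Num.max 0 (1 - Sm c k l)))).
  apply: ler_sum => c _; rewrite ler_wpM2l ?P_ge0 //.
  apply: le_trans (encE_le _ _ _ _) _.
    by move=> x; apply: sumr_ge0 => o _; rewrite mulr_ge0.
  apply: lerD.
    do 2 (apply: ler_sum => ? _); rewrite ler_wpM2l ?Qw_ge0 // /ev -!pxw_event -!big_split /=.
    apply: ler_sum => x _; rewrite -!mulrDr ler_wpM2l ?pxw_ge0 // -!big_split /=.
    apply: ler_sum => o _; rewrite -!mulrDr ler_wpM2l // -!natrD ler_nat /errs.
    by case: (_ != _); case: (_ != _); case: (_ != _).
  rewrite -[leRHS]mulr1 ler_wpM2l ?deficit_ge0 // -[leRHS](pxu_sum (c k).1).
  apply: ler_sum => x _; rewrite -[leRHS]mulr1 ler_wpM2l ?pxu_ge0 // -[leRHS](W_sum x).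
  apply: ler_sum => o _; rewrite -[leRHS]mulr1; apply: ler_wpM2l => //.
  by case: errs; rewrite ?lexx ?ler01.
under eq_bigr => c _ do rewrite mulrDr.
rewrite big_split /= /err_bound; apply: lerD; last first.
  have -> : EP pu pv0 q Gz (fun u v0 v1 v2 z => rho_w pv0 q u v0 v1 v2 z `^ s) =
      \sum_x piw x * wtx x `^ s.
    rewrite /rho_w (EP_sum1 pu pv0 q (chan_sum fz) (fun u v0 v1 v2 => wt pv0 q u v0 v1 v2 `^ s)).
    by apply: eq_bigr => -[[[? ?] ?] ?] _.
  exact: deficit_bound.
set EB := (X in _ <= X).
have -> : \sum_c P c * (\sum_t1 \sum_t2 Qw c k l t1 t2 * ev c t1 t2) =
    Nt^-1 * \sum_t1 \sum_t2 \sum_c P c * (wtx (cword c (k, l, t1, t2)) * ev c t1 t2).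
  rewrite mulr_sumr.
  under [RHS]eq_bigr => t1 _ do (rewrite exchange_big mulr_sumr /=).
  rewrite [RHS]exchange_big; apply: eq_bigr => c _; rewrite mulr_sumr; apply: eq_bigr => t1 _.
  rewrite !mulr_sumr; apply: eq_bigr => t2 _; rewrite /Qw -mulrA.
  by rewrite [LHS]mulrCA.
apply: (@le_trans _ _ (Nt^-1 * \sum_(t1 : T1) \sum_(t2 : T2) EB)).
  rewrite ler_wpM2l ?invr_ge0 ?(ltW Nt_gt0) //; apply: ler_sum => t1 _; apply: ler_sum => t2 _.
  rewrite /ev /=; under eq_bigr => c _ do rewrite !mulrDr.
  rewrite !big_split /=; apply: lerD; last exact: recv3.
  by apply: lerD; [exact: recv1|exact: recv2].
by rewrite sum_const2 mulrA mulVf ?mul1r // gt_eqF // Nt_gt0.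
Qed.

(** If every codebook violated one of the two bounds, A / eps + D / C would exceed 2 everywhere,
    against a mean of at most 2. *)
Theorem one_shot (s eta eps C : R) : 0 < s <= 1 -> 0 < eta -> 0 < eps -> 0 < C ->
  err_bound s eta <= eps -> 2 * ln 2 + 1 + leak_bound fz s <= C ->
  exists c : cb,
    (Kn * Ln)^-1 * \sum_k \sum_l err_code c k l <= 2 * eps /\
    (Kn * #|S|%:R)^-1 * \sum_k \sum_s1 leak fz c k s1 <= 2 * C.
Proof.
move=> s01 eta0 eps0 C0 eb lb.
have Psum : \sum_c P c = 1 by exact: cb_pmf_sum.
have Kp : 0 < Kn by exact: card_gt0R k0.
have Lp : 0 < Ln by exact: card_gt0R (s0, j0).
have Sp : 0 < #|S|%:R :> R by exact: card_gt0R s0.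
pose A c := (Kn * Ln)^-1 * \sum_k \sum_l err_code c k l.
pose D c := (Kn * #|S|%:R)^-1 * \sum_k \sum_s1 leak fz c k s1.
have A0 c : 0 <= A c.
  rewrite mulr_ge0 ?invr_ge0 ?mulr_ge0 //; do 2 (apply: sumr_ge0 => ? _); exact: err_code_ge0.
have D0 c : 0 <= D c.
  rewrite mulr_ge0 ?invr_ge0 ?mulr_ge0 //; do 2 (apply: sumr_ge0 => ? _); exact: leak_ge0.
have const2 (T T' : finType) (F : cb -> T -> T' -> R) (y : R) : 0 < #|T|%:R :> R -> 0 < #|T'|%:R
  :> R ->
    (forall t t', \sum_c P c * F c t t' <= y) ->
    \sum_c P c * ((#|T|%:R * #|T'|%:R)^-1 * \sum_t \sum_t' F c t t') <= y.
  move=> Tp T'p h.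
  have -> : \sum_c P c * ((#|T|%:R * #|T'|%:R)^-1 * \sum_t \sum_t' F c t t') =
     (#|T|%:R * #|T'|%:R)^-1 * \sum_t \sum_t' \sum_c P c * F c t t'.
    under eq_bigr => c _ do rewrite mulrCA mulr_sumr.
    rewrite -mulr_sumr exchange_big; congr (_ * _); apply: eq_bigr => t _.
    under eq_bigr => c _ do rewrite mulr_sumr.
    by rewrite exchange_big.
  rewrite ler_pdivrMl ?mulr_gt0 //.
  apply: (@le_trans _ _ (\sum_(t : T) \sum_(t' : T') y)).
    by do 2 (apply: ler_sum => ? _).
  by rewrite !sumr_const -[leLHS]mulr_natl -[y *+ _]mulr_natl mulrA.
have EA : \sum_c P c * A c <= eps.
  by apply: const2 => // k l; apply: le_trans (err_code_mean k l s01 eta0) eb.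
have ED : \sum_c P c * D c <= C.
  by apply: const2 => // k s1; apply: le_trans (leak_mean fz k s1 s01) lb.
apply: contrapT => /forallNP nex.
have big c : 2 < A c / eps + D c / C.
  have h1 : A c <= 2 * eps -> D c <= 2 * C -> False by move=> ? ?; apply: (nex c).
  have [a|a] := leP (A c) (2 * eps); last first.
    apply: (@lt_le_trans _ _ (A c / eps)); first by rewrite ltr_pdivlMr.
    by rewrite lerDl divr_ge0 // ltW.
  have [d|d] := leP (D c) (2 * C); first by have := h1 a d.
  apply: (@lt_le_trans _ _ (D c / C)); first by rewrite ltr_pdivlMr.
  by rewrite lerDr divr_ge0 // ltW.
have : \sum_c P c * (A c / eps + D c / C) <= 2.
  have -> : \sum_c P c * (A c / eps + D c / C) = (\sum_c P c * A c) / eps + (\sum_c P c * D c) / C.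
    by rewrite !mulr_suml -big_split /=; apply: eq_bigr => c _; ring.
  have -> : 2 = 1 + 1 :> R by [].
  by apply: lerD; rewrite ler_pdivrMr // mul1r.
apply/negP; rewrite -ltNge.
(* A codebook of positive probability makes the comparison of means strict. *)
have [c0 Pc0] : exists c0, 0 < P c0.
  apply: contrapT => /forallNP h; have : \sum_c P c <= 0.
    by apply: sumr_le0 => c _; rewrite leNgt; apply/negP => /h.
  by rewrite Psum leNgt ltr01.
have e2 : \sum_c P c * 2 = 2 by rewrite -mulr_suml Psum mul1r.
rewrite -[ltLHS]e2.
rewrite (bigD1 c0) //= [ltRHS](bigD1 c0) //=; apply: ltr_leD.
  by rewrite ltr_pM2l.
by apply: ler_sum => c _; rewrite ler_wpM2l ?P_ge0 // ltW.
Qed.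

End Receivers.

End OneShot.

(** * Tensorization *)

Section TupleSums.
Variables (R : realType) (n : nat).

Lemma tuple_sum (A : finType) (F : 'I_n -> A -> R) :
  \sum_(x : n.-tuple A) \prod_(i < n) F i (tnth x i) = \prod_(i < n) \sum_a F i a.
Proof.
rewrite bigA_distr_bigA.
rewrite (reindex (fun f : {ffun 'I_n -> A} => [tuple f i | i < n])) /=.
  by apply: eq_bigr => f _; apply: eq_bigr => i _; rewrite tnth_mktuple.
exists (fun x : n.-tuple A => [ffun i => tnth x i]) => [f _|x _].
  by apply/ffunP => i; rewrite ffunE tnth_mktuple.
by apply: eq_from_tnth => i; rewrite tnth_mktuple ffunE.
Qed.

Lemma tuple_sum_map (A B : finType) (f : A -> B) (F : 'I_n -> A -> R) (b : n.-tuple B) :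
  \sum_(x : n.-tuple A | map_tuple f x == b) \prod_(i < n) F i (tnth x i)
  = \prod_(i < n) \sum_(a | f a == tnth b i) F i a.
Proof.
rewrite big_mkcond /=.
under [RHS]eq_bigr => i _ do rewrite big_mkcond /=.
rewrite -tuple_sum; apply: eq_bigr => x _.
case: eqP => [<-|ne].
  by apply: eq_bigr => i _; rewrite tnth_map eqxx.
have [i ni] : exists i, f (tnth x i) != tnth b i.
  apply/existsP; rewrite -negb_forall; apply/forallP => h.
  by apply: ne; apply: eq_from_tnth => i; rewrite tnth_map; apply/eqP.
by rewrite (bigD1 i) //= (negbTE ni) mul0r.
Qed.

Definition ten1 (A : finType) (f : A -> R) (a : n.-tuple A) : R := \prod_(i < n) f (tnth a i).
Definition ten2 (A B : finType) (f : A -> B -> R) (a : n.-tuple A) (b : n.-tuple B) : R :=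
  \prod_(i < n) f (tnth a i) (tnth b i).
Definition ten3 (A B C : finType) (f : A -> B -> C -> R)
    (a : n.-tuple A) (b : n.-tuple B) (c : n.-tuple C) : R :=
  \prod_(i < n) f (tnth a i) (tnth b i) (tnth c i).
Definition ten4 (A B C D : finType) (f : A -> B -> C -> D -> R)
    (a : n.-tuple A) (b : n.-tuple B) (c : n.-tuple C) (d : n.-tuple D) : R :=
  \prod_(i < n) f (tnth a i) (tnth b i) (tnth c i) (tnth d i).
Definition ten5 (A B C D E : finType) (f : A -> B -> C -> D -> E -> R)
    (a : n.-tuple A) (b : n.-tuple B) (c : n.-tuple C) (d : n.-tuple D) (e : n.-tuple E) : R :=
  \prod_(i < n) f (tnth a i) (tnth b i) (tnth c i) (tnth d i) (tnth e i).

Lemma prodfV_ten (F : 'I_n -> R) : (\prod_(i < n) F i)^-1 = \prod_(i < n) (F i)^-1.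
Proof. by elim/big_rec2: _ => [|i x y _ <-]; rewrite ?invr1 // invfM. Qed.

Lemma prod_powR (F : 'I_n -> R) s : (forall i, 0 <= F i) ->
  (\prod_(i < n) F i) `^ s = \prod_(i < n) F i `^ s.
Proof.
move=> F0; suff [_ ->] : 0 <= \prod_(i < n) F i /\
   (\prod_(i < n) F i) `^ s = \prod_(i < n) F i `^ s by [].
elim/big_rec2: _ => [|i y x _ [y0 <-]]; first by rewrite powR1.
by rewrite mulr_ge0 // powRM.
Qed.

End TupleSums.

Arguments ten1 {R} n {A}.
Arguments ten2 {R} n {A B}.
Arguments ten3 {R} n {A B C}.
Arguments ten4 {R} n {A B C D}.
Arguments ten5 {R} n {A B C D E}.

Section Tensor.
Variables (R : realType) (n : nat) (U V0 V1 V2 X O B : finType).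
Variables (pu : U -> R) (pv0 : U -> V0 -> R) (q : V0 -> V1 -> V2 -> R)
  (G : V0 -> V1 -> V2 -> B -> R).
Local Notation punt := (ten1 n pu).
Local Notation pv0t := (ten2 n pv0).
Local Notation qt := (ten3 n q).
Local Notation Gt := (ten4 n G).

Lemma swp_ten3 : swp qt = ten3 n (swp q).
Proof. by []. Qed.

Lemma swp_ten4 : swp Gt = ten4 n (swp G).
Proof. by []. Qed.

(** A product channel seen through a letterwise map is the product of the letter channels; hence the
    one-shot bound can be instantiated at tensor powers and read off from single-letter kernels. *)
Lemma chan_ten (px : V0 -> V1 -> V2 -> X -> R) (W : X -> O -> R) (f : O -> B) :
  chan (ten4 n px) (ten2 n W) (map_tuple f) = ten4 n (chan px W f).
Proof.
apply/funext => v0; apply/funext => v1; apply/funext => v2; apply/funext => b.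
rewrite /chan /ten4 -tuple_sum; apply: eq_bigr => x _.
by rewrite (tuple_sum_map f (fun i o => W (tnth x i) o)) -big_split.
Qed.

Lemma marg_ten v0 v1 : marg qt v0 v1 = ten2 n (marg q) v0 v1.
Proof. exact: tuple_sum. Qed.

Lemma kap_ten v0 v1 b : kap qt Gt v0 v1 b = ten3 n (kap q G) v0 v1 b.
Proof.
rewrite /kap /ten3 -tuple_sum; apply: eq_bigr => v2 _.
by rewrite -big_split.
Qed.

Lemma out0_ten v0 b : out0 qt Gt v0 b = ten2 n (out0 q G) v0 b.
Proof.
rewrite /out0 /ten2 -tuple_sum; apply: eq_bigr => v1 _; exact: kap_ten.
Qed.

Lemma outu_ten u b : outu pv0t qt Gt u b = ten2 n (outu pv0 q G) u b.
Proof.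
rewrite /outu /ten2 -tuple_sum; apply: eq_bigr => v0 _.
by rewrite out0_ten -big_split.
Qed.

Lemma outm_ten b : outm punt pv0t qt Gt b = ten1 n (outm pu pv0 q G) b.
Proof.
rewrite /outm /ten1 -tuple_sum; apply: eq_bigr => u _.
by rewrite outu_ten -big_split.
Qed.

Lemma EP_ten F : EP punt pv0t qt Gt (ten5 n F) = EP pu pv0 q G F ^+ n.
Proof.
rewrite /EP -[in RHS](card_ord n) -prodr_const.
rewrite -tuple_sum; apply: eq_bigr => u _.
rewrite -tuple_sum; apply: eq_bigr => v0 _.
rewrite -tuple_sum; apply: eq_bigr => v1 _.
rewrite -tuple_sum; apply: eq_bigr => v2 _.
rewrite -tuple_sum; apply: eq_bigr => b _.
by rewrite /ten1 /ten2 /ten3 /ten4 /ten5 -!big_split.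
Qed.

End Tensor.

Section TensorRatios.
Variables (R : realType) (n : nat) (U V0 V1 V2 B : finType).
Variables (pu : U -> R) (pv0 : U -> V0 -> R) (q : V0 -> V1 -> V2 -> R)
  (G : V0 -> V1 -> V2 -> B -> R).
Hypotheses (pu_ge0 : forall u, 0 <= pu u) (pv0_ge0 : forall u v, 0 <= pv0 u v)
  (q_ge0 : forall v0 v1 v2, 0 <= q v0 v1 v2) (G_ge0 : forall v0 v1 v2 b, 0 <= G v0 v1 v2 b).
Local Notation punt := (ten1 n pu).
Local Notation pv0t := (ten2 n pv0).
Local Notation qt := (ten3 n q).
Local Notation Gt := (ten4 n G).

(** Non-negativity of [F] lets the real power distribute over the product of the letters. *)
Lemma EP_ten_pow s (Ft : n.-tuple U -> n.-tuple V0 -> n.-tuple V1 -> n.-tuple V2 -> n.-tuple B -> R)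
    (F : U -> V0 -> V1 -> V2 -> B -> R) :
  (forall u v0 v1 v2 b, 0 <= F u v0 v1 v2 b) ->
  (forall u v0 v1 v2 b, Ft u v0 v1 v2 b = ten5 n F u v0 v1 v2 b) ->
  EP punt pv0t qt Gt (fun u v0 v1 v2 b => Ft u v0 v1 v2 b `^ s) =
  EP pu pv0 q G (fun u v0 v1 v2 b => F u v0 v1 v2 b `^ s) ^+ n.
Proof.
move=> F0 FE; rewrite -EP_ten; apply: eq_bigr => u _; apply: eq_bigr => v0 _.
apply: eq_bigr => v1 _; apply: eq_bigr => v2 _; apply: eq_bigr => b _.
by rewrite FE /ten5 prod_powR.
Qed.

Let p1_ge0 := marg_ge0 q_ge0.
Let p2_ge0 := margs_ge0 q_ge0.
Let kap0 v0 v1 b : 0 <= kap q G v0 v1 b.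
Proof. exact: kap_ge0. Qed.
Let out00 v0 b : 0 <= out0 q G v0 b.
Proof. exact: out0_ge0. Qed.
Let outu0 u b : 0 <= outu pv0 q G u b.
Proof. exact: outu_ge0. Qed.
Let outm0 b : 0 <= outm pu pv0 q G b.
Proof. exact: outm_ge0. Qed.

Lemma rho_m_ge0 u v0 v1 v2 b : 0 <= rho_m pu pv0 q G u v0 v1 v2 b.
Proof. exact: divr_ge0 (outm0 _) (divr_ge0 (kap0 _ _ _) (p1_ge0 _ _)). Qed.
Lemma rho_u_ge0 u v0 v1 v2 b : 0 <= rho_u pv0 q G u v0 v1 v2 b.
Proof. exact: divr_ge0 (outu0 _ _) (divr_ge0 (kap0 _ _ _) (p1_ge0 _ _)). Qed.
Lemma rho_z_ge0 u v0 v1 v2 b : 0 <= rho_z pu pv0 q G u v0 v1 v2 b.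
Proof. exact: divr_ge0 (outm0 _) (outu0 _ _). Qed.
Lemma rho_0_ge0 u v0 v1 v2 b : 0 <= rho_0 pv0 q G u v0 v1 v2 b.
Proof. exact: divr_ge0 (out00 _ _) (outu0 _ _). Qed.
Lemma rho_1_ge0 u v0 v1 v2 b : 0 <= rho_1 pv0 q G u v0 v1 v2 b.
Proof. exact: divr_ge0 (divr_ge0 (kap0 _ _ _) (p1_ge0 _ _)) (outu0 _ _). Qed.
Lemma rho_w_ge0 u v0 v1 v2 (b : B) : 0 <= rho_w pv0 q u v0 v1 v2 b.
Proof. exact: wt_ge0. Qed.
Lemma rho_12_ge0 u v0 v1 v2 b : 0 <= rho_12 pv0 q G u v0 v1 v2 b.
Proof. exact: divr_ge0 (mulr_ge0 (wt_ge0 pv0_ge0 q_ge0 _ _ _ _) (G_ge0 _ _ _ _)) (outu0 _ _). Qed.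

Lemma rho_m_ten s :
  EP punt pv0t qt Gt (fun u v0 v1 v2 b => rho_m punt pv0t qt Gt u v0 v1 v2 b `^ s) =
  EP pu pv0 q G (fun u v0 v1 v2 b => rho_m pu pv0 q G u v0 v1 v2 b `^ s) ^+ n.
Proof.
apply: EP_ten_pow; first exact: rho_m_ge0.
move=> u v0 v1 v2 b; rewrite /rho_m outm_ten kap_ten marg_ten.
by rewrite /ten1 /ten2 /ten3 /ten5 !prodfV_ten -!big_split /= prodfV_ten -big_split.
Qed.

Lemma rho_u_ten s :
  EP punt pv0t qt Gt (fun u v0 v1 v2 b => rho_u pv0t qt Gt u v0 v1 v2 b `^ s) =
  EP pu pv0 q G (fun u v0 v1 v2 b => rho_u pv0 q G u v0 v1 v2 b `^ s) ^+ n.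
Proof.
apply: EP_ten_pow; first exact: rho_u_ge0.
move=> u v0 v1 v2 b; rewrite /rho_u outu_ten kap_ten marg_ten.
by rewrite /ten1 /ten2 /ten3 /ten5 !prodfV_ten -!big_split /= prodfV_ten -big_split.
Qed.

Lemma rho_z_ten s :
  EP punt pv0t qt Gt (fun u v0 v1 v2 b => rho_z punt pv0t qt Gt u v0 v1 v2 b `^ s) =
  EP pu pv0 q G (fun u v0 v1 v2 b => rho_z pu pv0 q G u v0 v1 v2 b `^ s) ^+ n.
Proof.
apply: EP_ten_pow; first exact: rho_z_ge0.
move=> u v0 v1 v2 b; rewrite /rho_z outu_ten outm_ten.
by rewrite /ten1 /ten2 /ten5 !prodfV_ten -!big_split.
Qed.

Lemma rho_0_ten s :
  EP punt pv0t qt Gt (fun u v0 v1 v2 b => rho_0 pv0t qt Gt u v0 v1 v2 b `^ s) =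
  EP pu pv0 q G (fun u v0 v1 v2 b => rho_0 pv0 q G u v0 v1 v2 b `^ s) ^+ n.
Proof.
apply: EP_ten_pow; first exact: rho_0_ge0.
move=> u v0 v1 v2 b; rewrite /rho_0 outu_ten out0_ten.
by rewrite /ten2 /ten5 !prodfV_ten -!big_split.
Qed.

Lemma rho_1_ten s :
  EP punt pv0t qt Gt (fun u v0 v1 v2 b => rho_1 pv0t qt Gt u v0 v1 v2 b `^ s) =
  EP pu pv0 q G (fun u v0 v1 v2 b => rho_1 pv0 q G u v0 v1 v2 b `^ s) ^+ n.
Proof.
apply: EP_ten_pow; first exact: rho_1_ge0.
move=> u v0 v1 v2 b; rewrite /rho_1 outu_ten kap_ten marg_ten.
by rewrite /ten2 /ten3 /ten5 !prodfV_ten -!big_split.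
Qed.

Lemma wt_ten u v0 v1 v2 : wt pv0t qt u v0 v1 v2 = ten4 n (wt pv0 q) u v0 v1 v2.
Proof.
rewrite /wt swp_ten3 !marg_ten /ten2 /ten3 /ten4 -!big_split /= prodfV_ten.
by rewrite -big_split.
Qed.

Lemma rho_w_ten s :
  EP punt pv0t qt Gt (fun u v0 v1 v2 b => rho_w pv0t qt u v0 v1 v2 b `^ s) =
  EP pu pv0 q G (fun u v0 v1 v2 b => rho_w pv0 q u v0 v1 v2 b `^ s) ^+ n.
Proof.
apply: EP_ten_pow; first exact: rho_w_ge0.
by move=> u v0 v1 v2 b; rewrite /rho_w wt_ten.
Qed.

Lemma rho_12_ten s :
  EP punt pv0t qt Gt (fun u v0 v1 v2 b => rho_12 pv0t qt Gt u v0 v1 v2 b `^ s) =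
  EP pu pv0 q G (fun u v0 v1 v2 b => rho_12 pv0 q G u v0 v1 v2 b `^ s) ^+ n.
Proof.
apply: EP_ten_pow; first exact: rho_12_ge0.
move=> u v0 v1 v2 b; rewrite /rho_12 outu_ten wt_ten.
by rewrite /ten2 /ten4 /ten5 !prodfV_ten -!big_split.
Qed.

End TensorRatios.

Import numFieldNormedType.Exports.
Local Open Scope classical_set_scope.

(** * Chernoff bounds with moments of small order *)

Section Chernoff.
Variable R : realType.

(** From exp x * (1 - x) <= 1 and (1 - x) (1 + x + 2 x^2) = 1 + x^2 (1 - 2 x). *)
Lemma expR_le_quad (x : R) : x <= 2^-1 -> expR x <= 1 + x + 2 * x ^+ 2.
Proof.
move=> x2; have x1 : 0 < 1 - x by lra.
have h : 1 - x <= expR (- x) by have := expR_ge1Dx (- x).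
have : expR x * (1 - x) <= 1.
  by rewrite -[leRHS](expRxMexpNx_1 x) ler_wpM2l // expR_ge0.
rewrite -ler_pdivlMr // => /le_trans; apply.
rewrite ler_pdivrMr //; nra.
Qed.

(** With f = ln rho + r the left side is E exp(s f), whose slope at s = 0 is E f < 0; on a finite
    alphabet the second-order term is uniformly controlled. Stating it for all small s > 0 lets
    finitely many such bounds share one s. *)
Lemma chernoff (T : finType) (p rho : T -> R) (r : R) :
  (forall t, 0 <= p t) -> \sum_t p t = 1 -> (forall t, 0 < p t -> 0 < rho t) ->
  \sum_t p t * ln (rho t) < - r ->
  \forall s \near 0^'+, expR (s * r) * \sum_t p t * rho t `^ s < 1.
Proof.
move=> p_ge0 p_sum rho_gt0 mean.
pose f t := ln (rho t) + r.
pose m := - \sum_t p t * f t.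
have m0 : 0 < m.
  rewrite oppr_gt0; under eq_bigr do rewrite mulrDr.
  by rewrite big_split /= -mulr_suml p_sum mul1r -ltrBrDr sub0r.
pose K := \sum_t p t * f t ^+ 2 + 1.
have K0 : 0 < K by rewrite ltr_wpDl // sumr_ge0 // => t _; rewrite mulr_ge0 // sqr_ge0.
pose M := \sum_t `|f t| + 1.
have M0 : 0 < M by rewrite ltr_wpDl // sumr_ge0.
near=> s.
have s0 : 0 < s by near: s; exact: nbhs_right_gt.
have sM : s < (2 * M)^-1 by near: s; apply: nbhs_right_lt; rewrite invr_gt0 mulr_gt0.
have sK : s < m / (2 * K) by near: s; apply: nbhs_right_lt; rewrite divr_gt0 // mulr_gt0.
have e : expR (s * r) * \sum_t p t * rho t `^ s = \sum_t p t * expR (s * f t).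
  rewrite mulr_sumr; apply: eq_bigr => t _; have [->|pn] := eqVneq (p t) 0.
    by rewrite !mul0r mulr0.
  have rp : 0 < rho t by apply: rho_gt0; rewrite lt_def pn p_ge0.
  by rewrite mulrCA /powR gt_eqF // -expRD /f; congr (_ * expR _); ring.
rewrite e.
apply: (@le_lt_trans _ _ (\sum_t p t * (1 + s * f t + 2 * (s * f t) ^+ 2))).
  apply: ler_sum => t _; rewrite ler_wpM2l // expR_le_quad //.
  apply: (@le_trans _ _ (s * M)).
    rewrite ler_wpM2l ?(ltW s0) //; apply: le_trans (ler_norm _) _.
    rewrite /M (bigD1 t) //= -addrA lerDl addr_ge0 // sumr_ge0 //.
  rewrite -ler_pdivlMr //; apply: le_trans (ltW sM) _.
  by rewrite invfM lexx.
rewrite [ltLHS](_ : _ = 1 - s * m + 2 * s ^+ 2 * (K - 1)).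
  have h : 2 * s * K < m.
    by move: sK; rewrite ltr_pdivlMr ?mulr_gt0 // => h; rewrite (_ : 2 * s * K = s * (2 * K)) //;
      ring.
  have : s * (2 * s * K) < s * m by rewrite ltr_pM2l.
  have : 0 < s ^+ 2 by rewrite exprn_gt0.
  nra.
transitivity (\sum_t (p t + s * (p t * f t) + 2 * s ^+ 2 * (p t * f t ^+ 2))).
  by apply: eq_bigr => t _; ring.
by rewrite !big_split /= -!mulr_sumr p_sum /m /K; ring.
Unshelve. all: by end_near.
Qed.

End Chernoff.

Section ChernoffEP.
Variables (R : realType) (U V0 V1 V2 B : finType).
Variables (pu : U -> R) (pv0 : U -> V0 -> R) (q : V0 -> V1 -> V2 -> R)
  (G : V0 -> V1 -> V2 -> B -> R).
Hypotheses (pu_ge0 : forall u, 0 <= pu u) (pv0_ge0 : forall u v, 0 <= pv0 u v)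
  (q_ge0 : forall v0 v1 v2, 0 <= q v0 v1 v2) (G_ge0 : forall v0 v1 v2 b, 0 <= G v0 v1 v2 b).
Hypotheses (pu_sum : \sum_u pu u = 1) (pv0_sum : forall u, \sum_v pv0 u v = 1)
  (q_sum : forall v0, \sum_v1 \sum_v2 q v0 v1 v2 = 1)
  (G_sum : forall v0 v1 v2, \sum_b G v0 v1 v2 b = 1).

Definition supp u v0 v1 v2 b : Prop :=
  [/\ 0 < pu u, 0 < pv0 u v0, 0 < q v0 v1 v2 & 0 < G v0 v1 v2 b].

Lemma EP_pair F : EP pu pv0 q G F = \sum_(w : wordT U V0 V1 V2 * B)
  piw pu pv0 q w.1 * Gx G w.2 w.1 * F w.1.1.1.1 w.1.1.1.2 w.1.1.2 w.1.2 w.2.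
Proof. by rewrite EPE pair_bigA. Qed.

Lemma EP_chernoff F (r : R) :
  (forall u v0 v1 v2 b, supp u v0 v1 v2 b -> 0 < F u v0 v1 v2 b) ->
  EP pu pv0 q G (fun u v0 v1 v2 b => ln (F u v0 v1 v2 b)) < - r ->
  \forall s \near 0^'+, expR (s * r) * EP pu pv0 q G (fun u v0 v1 v2 b => F u v0 v1 v2 b `^ s) < 1.
Proof.
move=> F0; rewrite EP_pair => mean.
pose p (w : wordT U V0 V1 V2 * B) := piw pu pv0 q w.1 * Gx G w.2 w.1.
have p0 w : 0 <= p w by rewrite mulr_ge0 ?piw_ge0 ?Gx_ge0.
have p1 : \sum_w p w = 1.
  transitivity (\sum_x \sum_b piw pu pv0 q x * Gx G b x); first by rewrite pair_bigA.
  rewrite -[RHS](piw_sum pu_sum pv0_sum q_sum); apply: eq_bigr => -[[[u v0] v1] v2] _.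
  by rewrite -mulr_sumr /Gx G_sum mulr1.
have Fp w : 0 < p w -> 0 < F w.1.1.1.1 w.1.1.1.2 w.1.1.2 w.1.2 w.2.
  case: w => [[[[u v0] v1] v2] b]; rewrite /p /piw /Gx /= => h; apply: F0.
  have n0 : pu u * pv0 u v0 * q v0 v1 v2 * G v0 v1 v2 b != 0 by rewrite gt_eqF.
  move: n0; rewrite !mulf_eq0 !negb_or -!andbA => /and4P[? ? ? ?].
  by split; rewrite lt_def; apply/andP; split.
have := chernoff p0 p1 Fp mean.
by under eq_near => s do rewrite -(EP_pair (fun u v0 v1 v2 b => F u v0 v1 v2 b `^ s)).
Qed.

Lemma sum_gt0_term (I : finType) (F : I -> R) i : (forall i, 0 <= F i) -> 0 < F i -> 0 < \sum_i F i.
Proof.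
move=> F_ge0 Fi; rewrite (bigD1 i) //= ltr_pwDl // sumr_ge0 //.
Qed.

Section Support.
Variables (u : U) (v0 : V0) (v1 : V1) (v2 : V2) (b : B).
Hypothesis sp : supp u v0 v1 v2 b.

Lemma supp_marg : 0 < marg q v0 v1.
Proof. by case: sp => _ _ h _; apply: (@sum_gt0_term _ _ v2). Qed.

Lemma supp_margs : 0 < marg (swp q) v0 v2.
Proof. by case: sp => _ _ h _; apply: (@sum_gt0_term _ _ v1) => // ?; exact: q_ge0. Qed.

Lemma supp_kap : 0 < kap q G v0 v1 b.
Proof.
case: sp => _ _ h h'; apply: (@sum_gt0_term _ _ v2) => [?|]; first by rewrite mulr_ge0.
exact: mulr_gt0.
Qed.

Lemma supp_out0 : 0 < out0 q G v0 b.
Proof. by apply: (@sum_gt0_term _ _ v1) supp_kap => ?; apply: kap_ge0. Qed.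

Lemma supp_outu : 0 < outu pv0 q G u b.
Proof.
case: sp => _ h _ _; apply: (@sum_gt0_term _ _ v0) => [?|]; last exact: mulr_gt0 h supp_out0.
by rewrite mulr_ge0 ?out0_ge0.
Qed.

Lemma supp_outm : 0 < outm pu pv0 q G b.
Proof.
case: sp => h _ _ _; apply: (@sum_gt0_term _ _ u) => [?|]; last exact: mulr_gt0 h supp_outu.
by rewrite mulr_ge0 ?outu_ge0.
Qed.

Lemma supp_wt : 0 < wt pv0 q u v0 v1 v2.
Proof.
case: sp => _ h h' _; apply: divr_gt0; first exact: mulr_gt0.
exact: mulr_gt0 (mulr_gt0 h supp_marg) supp_margs.
Qed.

Lemma supp_m0 : 0 < \sum_u pu u * pv0 u v0.
Proof.
case: sp => h h' _ _; apply: (@sum_gt0_term _ _ u) => [?|]; last exact: mulr_gt0.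
by rewrite mulr_ge0.
Qed.

End Support.

Lemma rho_m_gt0 u v0 v1 v2 b : supp u v0 v1 v2 b -> 0 < rho_m pu pv0 q G u v0 v1 v2 b.
Proof.
by move=> h; exact: divr_gt0 (supp_outm h) (divr_gt0 (supp_kap h) (supp_marg h)).
Qed.
Lemma rho_u_gt0 u v0 v1 v2 b : supp u v0 v1 v2 b -> 0 < rho_u pv0 q G u v0 v1 v2 b.
Proof.
by move=> h; exact: divr_gt0 (supp_outu h) (divr_gt0 (supp_kap h) (supp_marg h)).
Qed.
Lemma rho_z_gt0 u v0 v1 v2 b : supp u v0 v1 v2 b -> 0 < rho_z pu pv0 q G u v0 v1 v2 b.
Proof. by move=> h; exact: divr_gt0 (supp_outm h) (supp_outu h). Qed.
Lemma rho_0_gt0 u v0 v1 v2 b : supp u v0 v1 v2 b -> 0 < rho_0 pv0 q G u v0 v1 v2 b.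
Proof. by move=> h; exact: divr_gt0 (supp_out0 h) (supp_outu h). Qed.
Lemma rho_1_gt0 u v0 v1 v2 b : supp u v0 v1 v2 b -> 0 < rho_1 pv0 q G u v0 v1 v2 b.
Proof.
by move=> h; exact: divr_gt0 (divr_gt0 (supp_kap h) (supp_marg h)) (supp_outu h).
Qed.
Lemma rho_w_gt0 u v0 v1 v2 b : supp u v0 v1 v2 b -> 0 < rho_w pv0 q u v0 v1 v2 b.
Proof. exact: supp_wt. Qed.
Lemma rho_12_gt0 u v0 v1 v2 b : supp u v0 v1 v2 b -> 0 < rho_12 pv0 q G u v0 v1 v2 b.
Proof.
move=> h; case: (h) => _ _ _ h'; exact: divr_gt0 (mulr_gt0 (supp_wt h) h') (supp_outu h).
Qed.

End ChernoffEP.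

Section Decay.
Variable R : realType.

(** The constant [c] absorbs the rounding of the sizes of the index sets. *)
Lemma pow_decay (N g c r s : R) (n : nat) : 0 <= N -> 0 <= g -> 0 <= c -> 0 <= s ->
  N <= c * expR (n%:R * r) ->
  N `^ s * g ^+ n <= c `^ s * (expR (s * r) * g) ^+ n.
Proof.
move=> N0 g0 c0 s0 Nle.
rewrite exprMn mulrA ler_wpM2r ?exprn_ge0 //.
apply: (@le_trans _ _ ((c * expR (n%:R * r)) `^ s)).
  by apply: ge0_ler_powR => //; rewrite nnegrE ?mulr_ge0 ?expR_ge0.
rewrite powRM ?expR_ge0 // ler_wpM2l ?powR_ge0 //.
by rewrite -expRM -expRM_natl le_eqVlt; apply/orP; left; apply/eqP; congr expR; ring.
Qed.

End Decay.

(** * Mutual informations as mean log-likelihoods *)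

Section Information.
Variables (R : realType) (Om : finType) (P : Om -> R).
Hypotheses (P_ge0 : forall w, 0 <= P w) (P_sum : \sum_w P w = 1).

Lemma law_sum (A : finType) (f : Om -> A) (F : A -> R) :
  \sum_a law P f a * F a = \sum_w P w * F (f w).
Proof.
rewrite [RHS](partition_big f xpredT) //=; apply: eq_bigr => a _.
by rewrite mulr_suml; apply: eq_bigr => w /eqP ->.
Qed.

Lemma entE (A : finType) (f : Om -> A) : ent P f = - \sum_w P w * log2 (law P f (f w)).
Proof. by rewrite /ent (law_sum f (fun a => log2 (law P f a))). Qed.

Lemma miE (A B : finType) (f : Om -> A) (g : Om -> B) :
  mi P f g = \sum_w P w * (log2 (law P (fun w => (f w, g w)) (f w, g w))
     - log2 (law P f (f w)) - log2 (law P g (g w))).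
Proof.
rewrite /mi /cent !entE.
under [RHS]eq_bigr => w _ do rewrite !mulrBr.
by rewrite !sumrB; ring.
Qed.

Lemma cmiE (A B C : finType) (f : Om -> A) (g : Om -> B) (h : Om -> C) :
  cmi P f g h = \sum_w P w * (log2 (law P (fun w => (f w, (g w, h w))) (f w, (g w, h w)))
     + log2 (law P h (h w)) - log2 (law P (fun w => (f w, h w)) (f w, h w))
     - log2 (law P (fun w => (g w, h w)) (g w, h w))).
Proof.
rewrite /cmi /cent !entE.
under [RHS]eq_bigr => w _ do rewrite !mulrBr mulrDr.
by rewrite !sumrB big_split /=; ring.
Qed.

Lemma law_ge0 (A : finType) (f : Om -> A) a : 0 <= law P f a.
Proof. exact: sumr_ge0. Qed.

Lemma law_gt0 (A : finType) (f : Om -> A) w : 0 < P w -> 0 < law P f (f w).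
Proof.
by move=> Pw; rewrite /law (bigD1 w) //= ltr_pwDl // sumr_ge0.
Qed.

Lemma sum_law (A : finType) (f : Om -> A) : \sum_a law P f a = 1.
Proof.
transitivity (\sum_a law P f a * 1); first by apply: eq_bigr => a _; rewrite mulr1.
by rewrite (law_sum f (fun=> 1)) -mulr_suml P_sum mulr1.
Qed.

Lemma law_marg (A B : finType) (f : Om -> A) (g : Om -> B) b :
  \sum_a law P (fun w => (f w, g w)) (a, b) = law P g b.
Proof.
rewrite /law [RHS](partition_big f xpredT) //=; apply: eq_bigr => a _.
by apply: eq_bigl => w; rewrite xpair_eqE andbC.
Qed.

Lemma ln2_gt0 : 0 < ln 2 :> R.
Proof. by rewrite ln_gt0 // ltr1n. Qed.

(* ln x >= 1 - 1/x with x = p(f,g,h) p(h) / (p(f,h) p(g,h)) *)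
Lemma cmi_ge0 (A B C : finType) (f : Om -> A) (g : Om -> B) (h : Om -> C) : 0 <= cmi P f g h.
Proof.
rewrite cmiE.
pose l3 w := law P (fun w => (f w, (g w, h w))) (f w, (g w, h w)).
pose lh w := law P h (h w).
pose lf w := law P (fun w => (f w, h w)) (f w, h w).
pose lg w := law P (fun w => (g w, h w)) (g w, h w).
rewrite -(pmulr_rge0 _ ln2_gt0) mulr_sumr.
apply: (@le_trans _ _ (\sum_w P w * (1 - lf w * lg w / (l3 w * lh w)))).
  under eq_bigr => w _ do rewrite mulrBr mulr1.
  rewrite sumrB P_sum subr_ge0.
  rewrite -(law_sum (fun w => (f w, (g w, h w))) (fun x =>
    law P (fun w => (f w, h w)) (x.1, x.2.2) * law P (fun w => (g w, h w)) x.2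
    / (law P (fun w => (f w, (g w, h w))) x * law P h x.2.2))).
  apply: (@le_trans _ _ (\sum_(x : A * (B * C)) law P (fun w => (f w, h w)) (x.1, x.2.2) *
     law P (fun w => (g w, h w)) x.2 / law P h x.2.2)).
    apply: ler_sum => x _; set a := law P (fun w => (f w, (g w, h w))) x.
    have [->|an] := eqVneq a 0; first by rewrite mul0r divr_ge0 ?mulr_ge0 ?law_ge0.
    by rewrite invfM [leLHS]mulrCA (mulrA a) divff // mul1r lexx.
  rewrite -(pair_bigA _ (fun a y => law P (fun w => (f w, h w)) (a, y.2) *
     law P (fun w => (g w, h w)) y / law P h y.2)) exchange_big /=.
  rewrite -[leRHS](sum_law (fun w => (g w, h w))); apply: ler_sum => -[b c] _ /=.
  rewrite -!mulr_suml law_marg.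
  have [->|hn] := eqVneq (law P h c) 0; first by rewrite !mul0r law_ge0.
  by rewrite mulrAC divff // mul1r.
apply: ler_sum => w _; rewrite mulrCA.
have [->|Pn] := eqVneq (P w) 0; first by rewrite !mul0r.
have Pw : 0 < P w by rewrite lt_def Pn P_ge0.
have a3 : 0 < l3 w by exact: (law_gt0 (fun w => (f w, (g w, h w))) Pw).
have ah : 0 < lh w by exact: law_gt0.
have af : 0 < lf w by exact: (law_gt0 (fun w => (f w, h w)) Pw).
have ag : 0 < lg w by exact: (law_gt0 (fun w => (g w, h w)) Pw).
rewrite ler_wpM2l //.
have := ge1BV_ln (divr_gt0 (mulr_gt0 a3 ah) (mulr_gt0 af ag)).
rewrite invf_div => /le_trans; apply.
rewrite ln_div ?posrE ?mulr_gt0 // !lnM ?posrE // /log2.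
rewrite -/(l3 w) -/(lh w) -/(lf w) -/(lg w) le_eqVlt; apply/orP; left; apply/eqP.
by field; rewrite gt_eqF // ln2_gt0.
Qed.

End Information.

(** * Laws and informations under the auxiliary pmf *)

Section AuxModel.
Variables (R : realType) (U V0 V1 V2 X Y1 Y2 Z : finType).
Variables (pu : {ffun U -> R}) (pv0 : U -> {ffun V0 -> R})
  (pv12 : V0 -> {ffun (V1 * V2) -> R}) (px : V0 * V1 * V2 -> {ffun X -> R})
  (W : X -> {ffun (Y1 * Y2 * Z) -> R}).
Hypotheses (pu_pmf : is_pmf pu) (pv0_pmf : forall u, is_pmf (pv0 u))
  (pv12_pmf : forall v0, is_pmf (pv12 v0)) (px_pmf : forall v, is_pmf (px v))
  (W_pmf : is_channel W).
Local Notation O := (Y1 * Y2 * Z)%type.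
Local Notation Om := (aux_space U V0 V1 V2 X Y1 Y2 Z).
Local Notation P := (aux_pmf pu pv0 pv12 px W).

Definition kq v0 v1 v2 : R := pv12 v0 (v1, v2).
Definition kx v0 v1 v2 x : R := px (v0, v1, v2) x.
Definition kW x (o : O) : R := W x o.
Local Notation kU := (pu : U -> R).
Local Notation kV := ((fun u v0 => pv0 u v0) : U -> V0 -> R).

Let pu0 u : 0 <= kU u. Proof. by have [h _] := pu_pmf; exact: h. Qed.
Let pv00 u v : 0 <= kV u v. Proof. by have [h _] := (pv0_pmf u); exact: h. Qed.
Let q0 v0 v1 v2 : 0 <= kq v0 v1 v2. Proof. by have [h _] := (pv12_pmf v0); exact: h. Qed.
Let px0 v0 v1 v2 x : 0 <= kx v0 v1 v2 x. Proof. by have [h _] := (px_pmf (v0, v1, v2));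
  exact: h. Qed.
Let W0 x o : 0 <= kW x o. Proof. by have [h _] := (W_pmf x); exact: h. Qed.
Let pu1 : \sum_u kU u = 1. Proof. by have [_ h] := pu_pmf; exact: h. Qed.
Let pv01 u : \sum_v kV u v = 1. Proof. by have [_ h] := (pv0_pmf u); exact: h. Qed.
Lemma kq_sum v0 : \sum_v1 \sum_v2 kq v0 v1 v2 = 1.
Proof.
case: (pv12_pmf v0) => _ <-; rewrite pair_bigA; by apply: eq_bigr => -[].
Qed.
Let px1 v0 v1 v2 : \sum_x kx v0 v1 v2 x = 1. Proof. by have [_ h] := (px_pmf (v0, v1, v2));
  exact: h. Qed.
Let W1 x : \sum_o kW x o = 1. Proof. by have [_ h] := (W_pmf x); exact: h. Qed.

Lemma aux_ge0 w : 0 <= P w.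
Proof.
case: w => [[[[[u v0] v1] v2] x] y] /=.
exact: (mulr_ge0 (mulr_ge0 (mulr_ge0 (mulr_ge0 (pu0 u) (pv00 u v0)) (q0 v0 v1 v2)) (px0 v0 v1 v2
  x)) (W0 x y)).
Qed.

Lemma sum_aux (F : Om -> R) : \sum_w F w =
  \sum_u \sum_v0 \sum_v1 \sum_v2 \sum_x \sum_o F (u, v0, v1, v2, x, o).
Proof.
rewrite pair_bigA /= pair_bigA /= pair_bigA /= pair_bigA /= pair_bigA /=.
by apply: eq_bigr => -[[[[[? ?] ?] ?] ?] ?] _.
Qed.

(** [None] sums a coordinate out and [Some y] fixes it, so that the single lemma [aux_law] yields
    the law of every tuple formed from u, v0, v1, v2 and the observed output. *)
Definition pick (T : finType) (o : option T) (x : T) : bool := if o is Some y then x == y else true.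
Definition psum (T : finType) (o : option T) (F : T -> R) : R :=
  if o is Some y then F y else \sum_x F x.

Lemma sum_pick (T : finType) (o : option T) (F : T -> R) :
  \sum_x F x * (pick o x)%:R = psum o F.
Proof.
case: o => [y|] /=; last by apply: eq_bigr => x _; rewrite mulr1.
rewrite (bigD1 y) //= eqxx mulr1 big1 ?addr0 // => x /negbTE ->; exact: mulr0.
Qed.

Section Output.
Variables (B : finType) (f : O -> B).
Local Notation G := (chan kx kW f).
Local Notation Y := (fun w : Om => f w.2).
Local Notation EPG := (EP kU kV kq G).

Let G0 v0 v1 v2 b : 0 <= G v0 v1 v2 b.
Proof. by apply: sumr_ge0 => x _; rewrite mulr_ge0 // sumr_ge0. Qed.
Let G1 v0 v1 v2 : \sum_b G v0 v1 v2 b = 1.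
Proof.
rewrite exchange_big -[RHS](px1 v0 v1 v2); apply: eq_bigr => x _.
rewrite -mulr_sumr -[RHS]mulr1 -[in RHS](W1 x); congr (_ * _).
by rewrite [RHS](partition_big f xpredT).
Qed.

(** The input letter and the unobserved part of the output are summed into the kernel [chan]; this
    links the entropies on [aux_space] to the moments of the one-shot bound. *)
Lemma aux_EP (phi : U -> V0 -> V1 -> V2 -> B -> R) :
  \sum_w P w * phi (aU w) (aV0 w) (aV1 w) (aV2 w) (f w.2) = EPG phi.
Proof.
rewrite sum_aux; apply: eq_bigr => u _; apply: eq_bigr => v0 _; apply: eq_bigr => v1 _.
apply: eq_bigr => v2 _; rewrite /aU /aV0 /aV1 /aV2 /chan /=.
under [RHS]eq_bigr => b _ do rewrite mulr_sumr mulr_suml.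
rewrite [RHS]exchange_big; apply: eq_bigr => x _.
rewrite (partition_big f xpredT) //=; apply: eq_bigr => b _.
rewrite !mulr_sumr mulr_suml; apply: eq_bigr => o /eqP ->.
by rewrite !mulrA.
Qed.

(** Logarithms of products split only for positive factors, so identities between log-likelihoods
    are asked for on the support alone; elsewhere P w = 0. *)
Lemma aux_EP_supp (Psi : Om -> R) (phi : U -> V0 -> V1 -> V2 -> B -> R) :
  (forall w, supp kU kV kq G (aU w) (aV0 w) (aV1 w) (aV2 w) (f w.2) ->
    Psi w = phi (aU w) (aV0 w) (aV1 w) (aV2 w) (f w.2)) ->
  \sum_w P w * Psi w = EPG phi.
Proof.
move=> h; rewrite -aux_EP; apply: eq_bigr => w _.
have [->|Pn] := eqVneq (P w) 0; first by rewrite !mul0r.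
congr (_ * _); apply: h; case: w Pn => [[[[[u v0] v1] v2] x] o].
rewrite /aux_pmf /aU /aV0 /aV1 /aV2 /= !mulf_eq0 !negb_or -!andbA => /and5P[n1 n2 n3 n4 n5].
have gt (y : R) : 0 <= y -> y != 0 -> 0 < y by move=> y0 yn; rewrite lt_def yn.
have px_gt : 0 < kx v0 v1 v2 x by apply: gt.
have W_gt : 0 < kW x o by apply: gt.
split; [exact: gt|exact: gt|exact: gt|].
rewrite /chan (bigD1 x) //= ltr_pwDl //; last first.
  by apply: sumr_ge0 => x' _; rewrite mulr_ge0 // sumr_ge0.
rewrite mulr_gt0 // (bigD1 o) //= ltr_pwDl // sumr_ge0 //.
Qed.

Lemma aux_sum : \sum_w P w = 1.
Proof.
transitivity (\sum_w P w * 1); first by apply: eq_bigr => w _; rewrite mulr1.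
rewrite (aux_EP (fun _ _ _ _ _ => 1)) (EP_sum1 kU kV kq G1 (fun _ _ _ _ => 1)).
rewrite -[RHS](piw_sum pu1 pv01 kq_sum); apply: eq_bigr => x _; exact: mulr1.
Qed.

Lemma aux_law (A : finType) (F : Om -> A) (a : A) ou o0 o1 o2 ob :
  (forall w, (F w == a) = [&& pick ou (aU w), pick o0 (aV0 w), pick o1 (aV1 w),
      pick o2 (aV2 w) & pick ob (f w.2)]) ->
  law P F a = psum ou (fun u => pu u * psum o0 (fun v0 => pv0 u v0 *
    psum o1 (fun v1 => psum o2 (fun v2 => kq v0 v1 v2 * psum ob (G v0 v1 v2))))).
Proof.
move=> h.
transitivity (\sum_w P w * ((pick ou (aU w))%:R * ((pick o0 (aV0 w))%:R * ((pick o1 (aV1 w))%:R *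
   ((pick o2 (aV2 w))%:R * (pick ob (f w.2))%:R))))).
  rewrite /law big_mkcond; apply: eq_bigr => w _; rewrite h -!natrM !mulnb.
  by case: ifP => _; rewrite ?mulr1 ?mulr0.
rewrite (aux_EP (fun u v0 v1 v2 b => (pick ou u)%:R * ((pick o0 v0)%:R * ((pick o1 v1)%:R *
   ((pick o2 v2)%:R * (pick ob b)%:R))))).
rewrite -sum_pick; apply: eq_bigr => u _; rewrite -sum_pick mulr_sumr mulr_suml.
apply: eq_bigr => v0 _; rewrite -sum_pick.
rewrite !(mulr_sumr, mulr_suml); apply: eq_bigr => v1 _; rewrite -sum_pick.
rewrite !(mulr_sumr, mulr_suml); apply: eq_bigr => v2 _; rewrite -sum_pick.
rewrite !(mulr_sumr, mulr_suml); apply: eq_bigr => b _; ring.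
Qed.

Definition m0 v0 : R := \sum_u pu u * pv0 u v0.

Lemma sumG v0 v1 v2 : kq v0 v1 v2 * (\sum_b G v0 v1 v2 b) = kq v0 v1 v2.
Proof. by rewrite G1 mulr1. Qed.

Lemma sum_m0 v0 (y : R) : \sum_u pu u * (pv0 u v0 * y) = m0 v0 * y.
Proof. by rewrite /m0 mulr_suml; apply: eq_bigr => u _; rewrite mulrA. Qed.

Lemma psum_q v0 : \sum_v1 \sum_v2 kq v0 v1 v2 * (\sum_b G v0 v1 v2 b) = 1.
Proof.
by rewrite -[RHS](kq_sum v0); apply: eq_bigr => v1 _; apply: eq_bigr => v2 _; rewrite sumG.
Qed.

Lemma psum_marg v0 v1 : \sum_v2 kq v0 v1 v2 * (\sum_b G v0 v1 v2 b) = marg kq v0 v1.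
Proof. by apply: eq_bigr => v2 _; rewrite sumG. Qed.

Lemma psum_margs v0 v2 : \sum_v1 kq v0 v1 v2 * (\sum_b G v0 v1 v2 b) = marg (swp kq) v0 v2.
Proof. by apply: eq_bigr => v1 _; rewrite sumG. Qed.

Local Notation U_ := (@aU U V0 V1 V2 X Y1 Y2 Z).
Local Notation V0_ := (@aV0 U V0 V1 V2 X Y1 Y2 Z).
Local Notation V1_ := (@aV1 U V0 V1 V2 X Y1 Y2 Z).
Local Notation V2_ := (@aV2 U V0 V1 V2 X Y1 Y2 Z).

Ltac law_of ou o0 o1 o2 ob :=
  rewrite (@aux_law _ _ _ ou o0 o1 o2 ob);
  [rewrite /psum ?(sum_m0, psum_q, psum_marg, psum_margs, sumG, mulr1)
  |move=> w; rewrite ?xpair_eqE /pick; do !case: (_ == _)=> //].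

Lemma sum_v0_q u : \sum_v0 pv0 u v0 * (\sum_v1 \sum_v2 kq v0 v1 v2 * (\sum_b G v0 v1 v2 b)) = 1.
Proof. by rewrite -[RHS](pv01 u); apply: eq_bigr => v0 _; rewrite psum_q mulr1. Qed.

Lemma law_U u : law P U_ u = pu u.
Proof. by law_of (Some u) (@None V0) (@None V1) (@None V2) (@None B); rewrite sum_v0_q mulr1. Qed.

Lemma law_V0 v0 : law P V0_ v0 = m0 v0.
Proof. by law_of (@None U) (Some v0) (@None V1) (@None V2) (@None B). Qed.

Lemma law_Y b : law P Y b = outm kU kV kq G b.
Proof. by law_of (@None U) (@None V0) (@None V1) (@None V2) (Some b). Qed.

Lemma law_UY u b : law P (fun w => (U_ w, f w.2)) (u, b) = pu u * outu kV kq G u b.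
Proof. by law_of (Some u) (@None V0) (@None V1) (@None V2) (Some b). Qed.

Lemma law_YU u b : law P (fun w => (f w.2, U_ w)) (b, u) = pu u * outu kV kq G u b.
Proof. by law_of (Some u) (@None V0) (@None V1) (@None V2) (Some b). Qed.

Lemma law_YV0 v0 b : law P (fun w => (f w.2, V0_ w)) (b, v0) = m0 v0 * out0 kq G v0 b.
Proof. by law_of (@None U) (Some v0) (@None V1) (@None V2) (Some b). Qed.

Lemma law_V0U u v0 : law P (fun w => (V0_ w, U_ w)) (v0, u) = pu u * pv0 u v0.
Proof. by law_of (Some u) (Some v0) (@None V1) (@None V2) (@None B). Qed.

Lemma law_V0YU u v0 b :
  law P (fun w => (V0_ w, (f w.2, U_ w))) (v0, (b, u)) = pu u * (pv0 u v0 * out0 kq G v0 b).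
Proof. by law_of (Some u) (Some v0) (@None V1) (@None V2) (Some b). Qed.

Lemma law_V01 v0 v1 : law P (fun w => (V0_ w, V1_ w)) (v0, v1) = m0 v0 * marg kq v0 v1.
Proof. by law_of (@None U) (Some v0) (Some v1) (@None V2) (@None B). Qed.

Lemma law_V10 v0 v1 : law P (fun w => (V1_ w, V0_ w)) (v1, v0) = m0 v0 * marg kq v0 v1.
Proof. by law_of (@None U) (Some v0) (Some v1) (@None V2) (@None B). Qed.

Lemma law_V02 v0 v2 : law P (fun w => (V0_ w, V2_ w)) (v0, v2) = m0 v0 * marg (swp kq) v0 v2.
Proof. by law_of (@None U) (Some v0) (@None V1) (Some v2) (@None B). Qed.

Lemma law_V20 v0 v2 : law P (fun w => (V2_ w, V0_ w)) (v2, v0) = m0 v0 * marg (swp kq) v0 v2.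
Proof. by law_of (@None U) (Some v0) (@None V1) (Some v2) (@None B). Qed.

Lemma law_V01Y v0 v1 b : law P (fun w => ((V0_ w, V1_ w), f w.2)) ((v0, v1), b) =
  m0 v0 * kap kq G v0 v1 b.
Proof. by law_of (@None U) (Some v0) (Some v1) (@None V2) (Some b). Qed.

Lemma law_V02Y v0 v2 b : law P (fun w => ((V0_ w, V2_ w), f w.2)) ((v0, v2), b) =
  m0 v0 * kap (swp kq) (swp G) v0 v2 b.
Proof. by law_of (@None U) (Some v0) (@None V1) (Some v2) (Some b). Qed.

Lemma law_V01U u v0 v1 : law P (fun w => ((V0_ w, V1_ w), U_ w)) ((v0, v1), u) =
  pu u * (pv0 u v0 * marg kq v0 v1).
Proof. by law_of (Some u) (Some v0) (Some v1) (@None V2) (@None B). Qed.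

Lemma law_V02U u v0 v2 : law P (fun w => ((V0_ w, V2_ w), U_ w)) ((v0, v2), u) =
  pu u * (pv0 u v0 * marg (swp kq) v0 v2).
Proof. by law_of (Some u) (Some v0) (@None V1) (Some v2) (@None B). Qed.

Lemma law_V01YU u v0 v1 b :
  law P (fun w => ((V0_ w, V1_ w), (f w.2, U_ w))) ((v0, v1), (b, u)) =
  pu u * (pv0 u v0 * kap kq G v0 v1 b).
Proof. by law_of (Some u) (Some v0) (Some v1) (@None V2) (Some b). Qed.

Lemma law_V02YU u v0 v2 b :
  law P (fun w => ((V0_ w, V2_ w), (f w.2, U_ w))) ((v0, v2), (b, u)) =
  pu u * (pv0 u v0 * kap (swp kq) (swp G) v0 v2 b).
Proof. by law_of (Some u) (Some v0) (@None V1) (Some v2) (Some b). Qed.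

Lemma law_V10U u v0 v1 : law P (fun w => ((V1_ w, V0_ w), U_ w)) ((v1, v0), u) =
  pu u * (pv0 u v0 * marg kq v0 v1).
Proof. by law_of (Some u) (Some v0) (Some v1) (@None V2) (@None B). Qed.

Lemma law_V20U u v0 v2 : law P (fun w => ((V2_ w, V0_ w), U_ w)) ((v2, v0), u) =
  pu u * (pv0 u v0 * marg (swp kq) v0 v2).
Proof. by law_of (Some u) (Some v0) (@None V1) (Some v2) (@None B). Qed.

Lemma law_V10YU u v0 v1 b :
  law P (fun w => ((V1_ w, V0_ w), (f w.2, U_ w))) ((v1, v0), (b, u)) =
  pu u * (pv0 u v0 * kap kq G v0 v1 b).
Proof. by law_of (Some u) (Some v0) (Some v1) (@None V2) (Some b). Qed.

Lemma law_V20YU u v0 v2 b :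
  law P (fun w => ((V2_ w, V0_ w), (f w.2, U_ w))) ((v2, v0), (b, u)) =
  pu u * (pv0 u v0 * kap (swp kq) (swp G) v0 v2 b).
Proof. by law_of (Some u) (Some v0) (@None V1) (Some v2) (Some b). Qed.

Lemma law_V1YV0 v0 v1 b : law P (fun w => (V1_ w, (f w.2, V0_ w))) (v1, (b, v0)) =
  m0 v0 * kap kq G v0 v1 b.
Proof. by law_of (@None U) (Some v0) (Some v1) (@None V2) (Some b). Qed.

Lemma law_V2YV0 v0 v2 b : law P (fun w => (V2_ w, (f w.2, V0_ w))) (v2, (b, v0)) =
  m0 v0 * kap (swp kq) (swp G) v0 v2 b.
Proof. by law_of (@None U) (Some v0) (@None V1) (Some v2) (Some b). Qed.

Lemma law_V12YV0 v0 v1 v2 b :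
  law P (fun w => ((V1_ w, V2_ w), (f w.2, V0_ w))) ((v1, v2), (b, v0)) =
  m0 v0 * (kq v0 v1 v2 * G v0 v1 v2 b).
Proof. by law_of (@None U) (Some v0) (Some v1) (Some v2) (Some b). Qed.

Lemma law_V12V0 v0 v1 v2 : law P (fun w => ((V1_ w, V2_ w), V0_ w)) ((v1, v2), v0) =
  m0 v0 * kq v0 v1 v2.
Proof. by law_of (@None U) (Some v0) (Some v1) (Some v2) (@None B). Qed.

Lemma law_V1V2V0 v0 v1 v2 : law P (fun w => (V1_ w, (V2_ w, V0_ w))) (v1, (v2, v0)) =
  m0 v0 * kq v0 v1 v2.
Proof. by law_of (@None U) (Some v0) (Some v1) (Some v2) (@None B). Qed.

Section Log.
Variables (u : U) (v0 : V0) (v1 : V1) (v2 : V2) (b : B).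
Hypothesis sp : supp kU kV kq G u v0 v1 v2 b.
Lemma pos_all :
  [/\ [/\ 0 < pu u, 0 < pv0 u v0, 0 < kq v0 v1 v2, 0 < G v0 v1 v2 b & 0 < m0 v0],
      [/\ 0 < marg kq v0 v1, 0 < marg (swp kq) v0 v2, 0 < kap kq G v0 v1 b
        & 0 < kap (swp kq) (swp G) v0 v2 b]
    & [/\ 0 < out0 kq G v0 b, 0 < outu kV kq G u b & 0 < outm kU kV kq G b]].
Proof.
have [? ? h h'] := sp.
have kp : 0 < kap (swp kq) (swp G) v0 v2 b.
  apply: (@sum_gt0_term _ _ _ v1) => [w|]; first exact: (mulr_ge0 (q0 _ _ _) (G0 _ _ _ _)).
  exact: mulr_gt0 h h'.
by split; split=> //; [exact: (supp_m0 pu0 pv00 sp)|exact: (supp_marg q0 sp)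
  |exact: (supp_margs q0 sp)|exact: (supp_kap q0 G0 sp)|exact: (supp_out0 q0 G0 sp)
  |exact: (supp_outu pv00 q0 G0 sp)|exact: (supp_outm pu0 pv00 q0 G0 sp)].
Qed.
End Log.

Local Notation Om1 := (fun w => (V0_ w, V1_ w)).
Local Notation Om2 := (fun w => (V0_ w, V2_ w)).
Local Notation EPS := (EP kU kV (swp kq) (swp G)).

Lemma scale_sum (c : R) (Psi : Om -> R) : c * (\sum_w P w * Psi w) = \sum_w P w * (c * Psi w).
Proof. by rewrite mulr_sumr; apply: eq_bigr => w _; rewrite mulrCA. Qed.

Lemma add_sum (Psi Psi' : Om -> R) :
  (\sum_w P w * Psi w) + (\sum_w P w * Psi' w) = \sum_w P w * (Psi w + Psi' w).
Proof. by rewrite -big_split; apply: eq_bigr => w _; rewrite mulrDr. Qed.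

Ltac pos := first [assumption | apply: mulr_gt0; pos | apply: divr_gt0; pos].
Ltac logs := have ln2 := ln2_gt0 R;
  match goal with h : supp _ _ _ _ _ _ _ _ _ |- _ =>
    case: (pos_all h) => -[? ? ? ? ?] [? ? ? ?] [? ? ?] end;
  rewrite /log2 !(ln_div, lnM) ?posrE; try pos; field; rewrite gt_eqF.

Lemma info_m1 : EPG (fun u v0 v1 v2 b => ln (rho_m kU kV kq G u v0 v1 v2 b)) =
  - (ln 2 * mi P Om1 Y).
Proof.
by rewrite miE -mulNr scale_sum; apply/esym/aux_EP_supp => w spt;
  rewrite !(law_V01Y, law_V01, law_Y) /rho_m; logs.
Qed.

Lemma info_u1 : EPG (fun u v0 v1 v2 b => ln (rho_u kV kq G u v0 v1 v2 b)) =
  - (ln 2 * cmi P Om1 Y U_).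
Proof.
by rewrite cmiE -mulNr scale_sum; apply/esym/aux_EP_supp => w spt;
  rewrite !(law_V01YU, law_U, law_V01U, law_YU) /rho_u; logs.
Qed.

Lemma info_m2 : EPS (fun u v0 v2 v1 b => ln (rho_m kU kV (swp kq) (swp G) u v0 v2 v1 b)) =
  - (ln 2 * mi P Om2 Y).
Proof.
rewrite (EP_swp kU kV kq G (fun u v0 v2 v1 b => ln (rho_m kU kV (swp kq) (swp G) u v0 v2 v1 b))).
by rewrite miE -mulNr scale_sum; apply/esym/aux_EP_supp => w spt;
  rewrite !(law_V02Y, law_V02, law_Y) /rho_m (outm_swp kU kV kq G); logs.
Qed.

Lemma info_u2 : EPS (fun u v0 v2 v1 b => ln (rho_u kV (swp kq) (swp G) u v0 v2 v1 b)) =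
  - (ln 2 * cmi P Om2 Y U_).
Proof.
rewrite (EP_swp kU kV kq G (fun u v0 v2 v1 b => ln (rho_u kV (swp kq) (swp G) u v0 v2 v1 b))).
by rewrite cmiE -mulNr scale_sum; apply/esym/aux_EP_supp => w spt;
  rewrite !(law_V02YU, law_U, law_V02U, law_YU) /rho_u (outu_swp kV kq G); logs.
Qed.

Lemma info_z : EPG (fun u v0 v1 v2 b => ln (rho_z kU kV kq G u v0 v1 v2 b)) =
  - (ln 2 * mi P U_ Y).
Proof.
by rewrite miE -mulNr scale_sum; apply/esym/aux_EP_supp => w spt;
  rewrite !(law_UY, law_U, law_Y) /rho_z; logs.
Qed.

Lemma info_0 : EPG (fun u v0 v1 v2 b => ln (rho_0 kV kq G u v0 v1 v2 b)) =
  ln 2 * cmi P V0_ Y U_.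
Proof.
by rewrite cmiE scale_sum; apply/esym/aux_EP_supp => w spt;
  rewrite !(law_V0YU, law_U, law_V0U, law_YU) /rho_0; logs.
Qed.

Lemma info_1 : EPG (fun u v0 v1 v2 b => ln (rho_1 kV kq G u v0 v1 v2 b)) =
  ln 2 * cmi P Om1 Y U_.
Proof.
by rewrite cmiE scale_sum; apply/esym/aux_EP_supp => w spt;
  rewrite !(law_V01YU, law_U, law_V01U, law_YU) /rho_1; logs.
Qed.

Lemma info_2 : EPS (fun u v0 v2 v1 b => ln (rho_1 kV (swp kq) (swp G) u v0 v2 v1 b)) =
  ln 2 * cmi P Om2 Y U_.
Proof.
rewrite (EP_swp kU kV kq G (fun u v0 v2 v1 b => ln (rho_1 kV (swp kq) (swp G) u v0 v2 v1 b))).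
by rewrite cmiE scale_sum; apply/esym/aux_EP_supp => w spt;
  rewrite !(law_V02YU, law_U, law_V02U, law_YU) /rho_1 (outu_swp kV kq G); logs.
Qed.

Lemma info_w : EPG (fun u v0 v1 v2 b => ln (rho_w kV kq u v0 v1 v2 b)) =
  ln 2 * cmi P V1_ V2_ V0_.
Proof.
by rewrite cmiE scale_sum; apply/esym/aux_EP_supp => w spt;
  rewrite !(law_V1V2V0, law_V0, law_V10, law_V20) /rho_w /wt; logs.
Qed.

(** The factor [wt] contributes I(V1;V2|V0); the rest is the chain rule for I(V0,V1,V2;Y|U), where
    the Markov chain U - V0 - (V1,V2) - Y removes U once V0 is given. *)
Lemma info_12 : EPG (fun u v0 v1 v2 b => ln (rho_12 kV kq G u v0 v1 v2 b)) =
  ln 2 * (cmi P V0_ Y U_ + cmi P (fun w => (V1_ w, V2_ w)) Y V0_ + cmi P V1_ V2_ V0_).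
Proof.
by rewrite !cmiE !add_sum scale_sum; apply/esym/aux_EP_supp => w spt;
  rewrite !(law_V0YU, law_U, law_V0U, law_YU, law_V12YV0, law_V0, law_V12V0, law_YV0, law_V1V2V0,
  law_V10, law_V20) /rho_12 /wt; logs.
Qed.

Lemma info_swap1 : cmi P (fun w => (V1_ w, V0_ w)) Y U_ = cmi P Om1 Y U_.
Proof.
by rewrite !cmiE; apply: eq_bigr => w _; rewrite law_V10U law_V10YU law_V01U law_V01YU.
Qed.

Lemma info_swap2 : cmi P (fun w => (V2_ w, V0_ w)) Y U_ = cmi P Om2 Y U_.
Proof.
by rewrite !cmiE; apply: eq_bigr => w _; rewrite law_V20U law_V20YU law_V02U law_V02YU.
Qed.

(** Chain rule in which I(V1;Y|V0,U) = I(V1;Y|V0), since U - V0 - (V1,Y) is a Markov chain. *)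
Lemma info_chain1 : cmi P Om1 Y U_ = cmi P V0_ Y U_ + cmi P V1_ Y V0_.
Proof.
apply: (mulfI (lt0r_neq0 (ln2_gt0 R))); rewrite -info_1 !cmiE add_sum scale_sum.
by apply/esym/aux_EP_supp => w spt; rewrite !(law_V0YU, law_U, law_V0U, law_YU, law_V1YV0,
  law_V0, law_V10, law_YV0) /rho_1; logs.
Qed.

Lemma info_chain2 : cmi P Om2 Y U_ = cmi P V0_ Y U_ + cmi P V2_ Y V0_.
Proof.
apply: (mulfI (lt0r_neq0 (ln2_gt0 R))); rewrite -info_2.
rewrite (EP_swp kU kV kq G (fun u v0 v2 v1 b => ln (rho_1 kV (swp kq) (swp G) u v0 v2 v1 b))).
rewrite !cmiE add_sum scale_sum.
by apply/esym/aux_EP_supp => w spt; rewrite !(law_V0YU, law_U, law_V0U, law_YU, law_V2YV0,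
  law_V0, law_V20, law_YV0) /rho_1 (outu_swp kV kq G); logs.
Qed.

End Output.
End AuxModel.

(** * Codes and equivocation *)

(* [K] is decoded by everyone, [S] is the secret part and [J] the remaining index; [qk k] is the
   output law at [Z] given the cloud centre alone. *)
Definition good_code (R : realType) (X O B1 B2 Z K S J : finType) (W : X -> O -> R)
    (f1 : O -> B1) (f2 : O -> B2) (fz : O -> Z) (E : K -> S -> J -> X -> R)
    (d1 : B1 -> K * (S * J)) (d2 : B2 -> K * (S * J)) (d3 : Z -> K)
    (qk : K -> Z -> R) (eps C : R) : Prop :=
  let Pk k s z := #|J|%:R^-1 * \sum_j \sum_x E k s j x * \sum_(o | fz o == z) W x o in
  [/\ (forall k s j x, 0 <= E k s j x) /\ (forall k s j, \sum_x E k s j x = 1),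
      (forall k z, 0 <= qk k z) /\ (forall k, \sum_z qk k z = 1),
      (forall k s z, qk k z = 0 -> Pk k s z = 0),
      (#|K|%:R * #|{: S * J}|%:R)^-1 * \sum_k \sum_(l : S * J) \sum_x E k l.1 l.2 x *
        \sum_o W x o * ([|| d1 (f1 o) != (k, l), d2 (f2 o) != (k, l) | d3 (fz o) != k])%:R <= eps
    & (#|K|%:R * #|S|%:R)^-1 * \sum_k \sum_s \sum_z Pk k s z * ln (1 + Pk k s z / qk k z) <= C].

Lemma one_shot_code (R : realType) (U V0 V1 V2 X O : finType)
    (pu : U -> R) (pv0 : U -> V0 -> R) (q : V0 -> V1 -> V2 -> R)
    (px : V0 -> V1 -> V2 -> X -> R) (W : X -> O -> R)
    (pu_ge0 : forall u, 0 <= pu u) (pv0_ge0 : forall u v, 0 <= pv0 u v)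
    (q_ge0 : forall v0 v1 v2, 0 <= q v0 v1 v2)
    (px_ge0 : forall v0 v1 v2 x, 0 <= px v0 v1 v2 x) (W_ge0 : forall x o, 0 <= W x o)
    (pu_sum : \sum_u pu u = 1) (pv0_sum : forall u, \sum_v pv0 u v = 1)
    (q_sum : forall v0, \sum_v1 \sum_v2 q v0 v1 v2 = 1)
    (px_sum : forall v0 v1 v2, \sum_x px v0 v1 v2 x = 1) (W_sum : forall x, \sum_o W x o = 1)
    (K S J T1 T2 B1 B2 Z : finType) (k0 : K) (s0 : S) (j0 : J) (t10 : T1) (t20 : T2)
    (f1 : O -> B1) (f2 : O -> B2) (fz : O -> Z) (s eta eps C : R) :
  0 < s <= 1 -> 0 < eta -> 0 < eps -> 0 < C ->
  err_bound pu pv0 q px W K S J T1 T2 f1 f2 fz s eta <= eps ->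
  2 * ln 2 + 1 + leak_bound pu pv0 q px W J T1 T2 fz s <= C ->
  exists (E : K -> S -> J -> X -> R) d1 d2 d3 qk,
    good_code W f1 f2 fz E d1 d2 d3 qk (2 * eps) (2 * C).
Proof.
move=> s01 eta0 eps0 C0 eb lb.
have [c [cerr cleak]] := one_shot pu_ge0 pv0_ge0 q_ge0 px_ge0 W_ge0 pu_sum pv0_sum q_sum
  px_sum W_sum k0 s0 j0 t10 t20 s01 eta0 eps0 C0 eb lb.
exists (fun k s j x => encE pv0 q px c k (s, j) x).
exists (decode1 q px W k0 s0 j0 t10 t20 f1 c).
exists (decode2 q px W k0 s0 j0 t10 t20 f2 c).
exists (decode3 pv0 q px W k0 s0 j0 t10 t20 fz c).
exists (fun k z => outu pv0 q (chan px W fz) (c k).1 z).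
have G_ge0 := chan_ge0 px_ge0 W_ge0 fz.
have G_sum := chan_sum px_sum W_sum fz.
split.
- split; first by move=> k s' j x; exact: encE_ge0.
  by move=> k s' j; exact: encE_sum.
- split; first by move=> k z; exact: outu_ge0.
  by move=> k; exact: outu_sum.
- by move=> k s' z; apply: Pz_dom => //; exact: j0.
- apply: le_trans cerr; rewrite le_eqVlt; apply/orP; left; apply/eqP; congr (_ * _).
  by apply: eq_bigr => k _; apply: eq_bigr => -[s' j] _.
- exact: cleak.
Qed.

Section Equivocation.
Variables (R : realType) (M0 A S B Z : finType) (p : M0 -> A -> S -> B -> Z -> R)
  (qk : M0 * A -> Z -> R).
Hypotheses (p_ge0 : forall m0 a s b z, 0 <= p m0 a s b z)
  (p_sum : forall m0 a s b, \sum_z p m0 a s b z = 1)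
  (qk_ge0 : forall k z, 0 <= qk k z) (qk_sum : forall k, \sum_z qk k z = 1).
Variables (m00 : M0) (a0 : A) (s0 : S) (b0 : B).
Let n : R := #|M0|%:R * #|A|%:R * #|S|%:R * #|B|%:R.
(** For uniform messages, [Pms] is the law of z given m0, a and s, [pj] the joint law of (a, s, b)
    and z, and [pzl] its marginal in z. *)
Definition Pms m0 a s z : R := #|B|%:R^-1 * \sum_b p m0 a s b z.
Definition pj a s b z : R := n^-1 * \sum_m0 p m0 a s b z.
Definition pzl z : R := \sum_a \sum_s \sum_b pj a s b z.
Hypothesis dom : forall m0 a s z, qk (m0, a) z = 0 -> Pms m0 a s z = 0.

Let cM := card_gt0R R m00.
Let cA := card_gt0R R a0.
Let cS := card_gt0R R s0.
Let cB := card_gt0R R b0.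

Lemma pj_ge0 a s b z : 0 <= pj a s b z.
Proof. by rewrite mulr_ge0 ?sumr_ge0 // invr_ge0 !mulr_ge0. Qed.

(** The right side is the equivocation of (a, s, b) in nats. Put r = Pms / qk and let y be the
    posterior pj / pzl. By ln x <= x - 1, ln y + ln #|S| - ln(1 + r) <= y * #|S| / r - 1, and the
    factor 1 / r replaces the true law of z by [qk]. As [qk] does not depend on s and b, the
    posterior can then be summed over them, with total at most 1. *)
Lemma equivocation_core :
  ln #|S|%:R - (#|M0|%:R * #|A|%:R * #|S|%:R)^-1 *
    \sum_m0 \sum_a \sum_s \sum_z Pms m0 a s z * ln (1 + Pms m0 a s z / qk (m0, a) z)
  <= - \sum_a \sum_s \sum_b \sum_z pj a s b z * ln (pj a s b z / pzl z).
Proof.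
have n_gt0 : 0 < n by rewrite !mulr_gt0.
have n0 : n != 0 by rewrite gt_eqF.
pose lk m0 a s z := ln (1 + Pms m0 a s z / qk (m0, a) z).
have Pms_ge0 m0 a s z : 0 <= Pms m0 a s z by rewrite mulr_ge0 ?invr_ge0 ?sumr_ge0.
have pz_ge0 z : 0 <= pzl z by do 3 (apply: sumr_ge0 => ? _); exact: pj_ge0.
pose t m0 a s b z := n^-1 * p m0 a s b z *
   (ln (pj a s b z / pzl z) + ln #|S|%:R - lk m0 a s z).
have key : \sum_m0 \sum_a \sum_s \sum_b \sum_z t m0 a s b z <= 0.
  have term m0 a s b z : t m0 a s b z <=
     (#|M0|%:R * #|A|%:R)^-1 * (qk (m0, a) z * (pj a s b z / pzl z)) - n^-1 * p m0 a s b z.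
    have rhs1 : 0 <= (#|M0|%:R * #|A|%:R)^-1 * (qk (m0, a) z * (pj a s b z / pzl z)).
      apply: mulr_ge0; first by rewrite invr_ge0 mulr_ge0.
      by apply: mulr_ge0 => //; apply: divr_ge0 => //; exact: pj_ge0.
    rewrite /t; have [->|pn] := eqVneq (p m0 a s b z) 0.
      by rewrite mulr0 mul0r subr0.
    have pp : 0 < p m0 a s b z by rewrite lt_def pn p_ge0.
    (* Passing from b to the average over b costs a factor #|B|, which cancels against the one in
       n^-1. *)
    have pPms : p m0 a s b z <= #|B|%:R * Pms m0 a s z.
      rewrite /Pms mulrA divff ?gt_eqF // mul1r (bigD1 b) //= lerDl sumr_ge0 //.
    have Pp : 0 < Pms m0 a s z.
      by rewrite -(pmulr_rgt0 _ cB); apply: lt_le_trans pPms.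
    have qp : 0 < qk (m0, a) z.
      rewrite lt_def qk_ge0 andbT; apply/eqP => e.
      by move: Pp; rewrite (dom _ e) ltxx.
    have pjp : 0 < pj a s b z.
      rewrite mulr_gt0 ?invr_gt0 // (bigD1 m0) //= ltr_pwDl // sumr_ge0 //.
    have pzp : 0 < pzl z.
      rewrite /pzl (bigD1 a) //= ltr_pwDl //; last first.
        by do 3 (apply: sumr_ge0 => ? _); exact: pj_ge0.
      rewrite (bigD1 s) //= ltr_pwDl //; last first.
        by do 2 (apply: sumr_ge0 => ? _); exact: pj_ge0.
      by rewrite (bigD1 b) //= ltr_pwDl // sumr_ge0 // => ? _; exact: pj_ge0.
    set r := Pms m0 a s z / qk (m0, a) z.
    have rp : 0 < r by exact: divr_gt0.
    have l1 : ln r <= lk m0 a s z by rewrite ler_ln ?posrE ?addr_gt0 // lerDr.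
    have l2' (y : R) : 0 < y -> ln y + ln #|S|%:R - lk m0 a s z <= y * #|S|%:R / r - 1.
      move=> yp; apply: (@le_trans _ _ (ln (y * #|S|%:R / r))).
        have yS : 0 < y * #|S|%:R by exact: mulr_gt0.
        rewrite [leRHS]ln_div ?posrE // lnM ?posrE //.
        by rewrite lerD2l lerN2.
      have := le_ln1Dx (x := y * #|S|%:R / r - 1); rewrite [1 + _]addrC subrK; apply.
      by rewrite ltrBrDr addNr divr_gt0 // mulr_gt0.
    set y := pj a s b z / pzl z.
    have yp : 0 < y by exact: divr_gt0.
    have l2 := l2' y yp.
    have np : 0 <= n^-1 * p m0 a s b z by rewrite mulr_ge0 ?invr_ge0 ?ltW.
    apply: le_trans (ler_wpM2l np l2) _.
    rewrite mulrBr mulr1 lerD2r.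
    apply: (@le_trans _ _ (n^-1 * (#|B|%:R * Pms m0 a s z) * (y * #|S|%:R / r))).
      apply: ler_wpM2r; first by rewrite ltW // divr_gt0 // mulr_gt0.
      by apply: ler_wpM2l => //; rewrite invr_ge0 ltW.
    rewrite le_eqVlt; apply/orP; left; apply/eqP; rewrite /r /n -/y.
    by field; rewrite !gt_eqF.
  apply: (@le_trans _ _ (\sum_m0 \sum_a \sum_s \sum_b \sum_z
     ((#|M0|%:R * #|A|%:R)^-1 * (qk (m0, a) z * (pj a s b z / pzl z)) - n^-1 * p m0 a s b z))).
    by do 5 (apply: ler_sum => ? _); exact: term.
  have cst (T : finType) (y : R) : \sum_(i : T) y = #|T|%:R * y.
    by rewrite sumr_const -[LHS]mulr_natl.
  have s1 : \sum_m0 \sum_a \sum_s \sum_b \sum_z n^-1 * p m0 a s b z = 1.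
    under eq_bigr => m0 _. under eq_bigr => a _. under eq_bigr => s _. under eq_bigr => b _.
      rewrite -mulr_sumr p_sum; over.
    over. over. over.
    by rewrite !cst /n; field; rewrite !gt_eqF.
  have s2 : \sum_m0 \sum_a \sum_s \sum_b \sum_z
     (#|M0|%:R * #|A|%:R)^-1 * (qk (m0, a) z * (pj a s b z / pzl z)) <= 1.
    apply: (@le_trans _ _ (\sum_(m0 : M0) \sum_(a : A) (#|M0|%:R * #|A|%:R)^-1)).
      apply: ler_sum => m0 _; apply: ler_sum => a _.
      rewrite [leRHS](_ : _ = (#|M0|%:R * #|A|%:R)^-1 * \sum_z qk (m0, a) z); last first.
        by rewrite qk_sum mulr1.
      under eq_bigr => s _ do rewrite exchange_big.
      rewrite exchange_big /= mulr_sumr; apply: ler_sum => z _.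
      have -> : \sum_s \sum_b (#|M0|%:R * #|A|%:R)^-1 * (qk (m0, a) z * (pj a s b z / pzl z)) =
         (#|M0|%:R * #|A|%:R)^-1 * (qk (m0, a) z * ((\sum_s \sum_b pj a s b z) / pzl z)).
        rewrite mulr_suml 2!mulr_sumr; apply: eq_bigr => s _.
        by rewrite mulr_suml 2!mulr_sumr.
      rewrite ler_wpM2l ?invr_ge0 //.
      (* Summed over s and b, the ratio is the posterior probability of a. *)
      rewrite -[leRHS]mulr1 ler_wpM2l //.
      have [->|zn] := eqVneq (pzl z) 0; first by rewrite invr0 mulr0 ler01.
      have zp : 0 < pzl z by rewrite lt_def zn pz_ge0.
      rewrite ler_pdivrMr // mul1r /pzl [leRHS](bigD1 a) //= lerDl.
      by do 3 (apply: sumr_ge0 => ? _); exact: pj_ge0.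
    by rewrite !cst mulrA divff // gt_eqF // mulr_gt0.
  rewrite [leLHS](_ : _ = \sum_m0 \sum_a \sum_s \sum_b \sum_z
     (#|M0|%:R * #|A|%:R)^-1 * (qk (m0, a) z * (pj a s b z / pzl z)) -
     \sum_m0 \sum_a \sum_s \sum_b \sum_z n^-1 * p m0 a s b z).
    by rewrite s1 subr_le0.
  rewrite -sumrB; apply: eq_bigr => m0 _; rewrite -sumrB; apply: eq_bigr => a _.
  rewrite -sumrB; apply: eq_bigr => s _; rewrite -sumrB; apply: eq_bigr => b _.
  by rewrite -sumrB.
rewrite -subr_le0; apply: le_trans key; rewrite opprK.
have cst (T : finType) (y : R) : \sum_(i : T) y = #|T|%:R * y.
  by rewrite sumr_const -[LHS]mulr_natl.
have e1 : ln #|S|%:R = \sum_m0 \sum_a \sum_s \sum_b \sum_z n^-1 * p m0 a s b z * ln #|S|%:R.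
  under eq_bigr => m0 _. under eq_bigr => a _. under eq_bigr => s _. under eq_bigr => b _.
    rewrite -mulr_suml -mulr_sumr p_sum; over.
  over. over. over.
  by rewrite !cst /n; field; rewrite !gt_eqF.
have e2 : (#|M0|%:R * #|A|%:R * #|S|%:R)^-1 * \sum_m0 \sum_a \sum_s \sum_z Pms m0 a s z * lk m0 a
  s z
   = \sum_m0 \sum_a \sum_s \sum_b \sum_z n^-1 * p m0 a s b z * lk m0 a s z.
  rewrite mulr_sumr; apply: eq_bigr => m0 _; rewrite mulr_sumr; apply: eq_bigr => a _.
  rewrite mulr_sumr; apply: eq_bigr => s _; rewrite mulr_sumr exchange_big; apply: eq_bigr => z _.
  rewrite -mulr_suml -mulr_sumr /Pms mulrA; congr (_ * _).
  by rewrite mulrA; congr (_ * _); rewrite /n [RHS]invfM.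
have e3 : \sum_a \sum_s \sum_b \sum_z pj a s b z * ln (pj a s b z / pzl z) =
   \sum_m0 \sum_a \sum_s \sum_b \sum_z n^-1 * p m0 a s b z * ln (pj a s b z / pzl z).
  rewrite [RHS]exchange_big; apply: eq_bigr => a _.
  rewrite [RHS]exchange_big; apply: eq_bigr => s _.
  rewrite [RHS]exchange_big; apply: eq_bigr => b _.
  rewrite [RHS]exchange_big; apply: eq_bigr => z _.
  by rewrite -mulr_suml -mulr_sumr.
rewrite [in leLHS]e1 e2 e3.
rewrite -sumrB -big_split /=; apply: ler_sum => m0 _.
rewrite -sumrB -big_split /=; apply: ler_sum => a _.
rewrite -sumrB -big_split /=; apply: ler_sum => s _.
rewrite -sumrB -big_split /=; apply: ler_sum => b _.
rewrite -sumrB -big_split /=; apply: ler_sum => z _.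
by rewrite le_eqVlt; apply/orP; left; apply/eqP; rewrite /t; ring.
Qed.

End Equivocation.

(** * From an indexed one-shot code to a code for the messages *)

Section CodeOfGood.
Variables (R : realType) (X Y1 Y2 Z : finType) (W : X -> {ffun (Y1 * Y2 * Z) -> R}).
Hypothesis W_pmf : is_channel W.
Variables (n N0 N1 : nat) (A S B T : finType).
Variables (phi : 'I_N1 -> A * S * B) (psi : A * S * B -> 'I_N1).
Hypotheses (phiK : cancel phi psi) (psiK : cancel psi phi).
Variables (m00 : 'I_N0) (a0 : A) (s0 : S) (b0 : B) (t0 : T).
Local Notation O := (n.-tuple (Y1 * Y2 * Z)).
Local Notation K := ('I_N0 * A)%type.
Local Notation J := (B * T)%type.
Definition WT : n.-tuple X -> O -> R := ten2 n (fun x o => W x o).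
Definition g1 : O -> n.-tuple Y1 := map_tuple (fun t : Y1 * Y2 * Z => t.1.1).
Definition g2 : O -> n.-tuple Y2 := map_tuple (fun t : Y1 * Y2 * Z => t.1.2).
Definition gz : O -> n.-tuple Z := map_tuple (fun t : Y1 * Y2 * Z => t.2).
Variables (E : K -> S -> J -> n.-tuple X -> R).
Variables (d1 : n.-tuple Y1 -> K * (S * J)) (d2 : n.-tuple Y2 -> K * (S * J))
  (d3 : n.-tuple Z -> K) (qk : K -> n.-tuple Z -> R) (eps C : R).
Hypothesis good : good_code WT g1 g2 gz E d1 d2 d3 qk eps C.

(** The index t is local randomness of the encoder and is averaged here, whereas b belongs to the
    message. *)
Definition encA (m0 : 'I_N0) (m : A * S * B) (x : n.-tuple X) : R :=
  #|T|%:R^-1 * \sum_t E (m0, m.1.1) m.1.2 (m.2, t) x.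
Definition msg (y : K * (S * J)) : 'I_N0 * 'I_N1 := (y.1.1, psi (y.1.2, y.2.1, y.2.2.1)).
Definition the_code : Defs.code R X Y1 Y2 Z N0 N1 n :=
  Code (fun m0 m1 => [ffun x => encA m0 (phi m1) x]) (fun y => msg (d1 y))
    (fun y => msg (d2 y)) (fun z => (d3 z).1).

Let cT := card_gt0R R t0.
Let cB := card_gt0R R b0.
Let cS := card_gt0R R s0.
Let cA := card_gt0R R a0.
Let cM := card_gt0R R m00.

Lemma E_ge0 k s j x : 0 <= E k s j x. Proof. by have [[h _] _ _ _ _] := good; exact: h. Qed.
Lemma E_sum k s j : \sum_x E k s j x = 1. Proof. by have [[_ h] _ _ _ _] := good; exact: h. Qed.
Lemma WT_ge0 x o : 0 <= WT x o.
Proof. by apply: prodr_ge0 => i _; have [h _] := W_pmf (tnth x i); exact: h. Qed.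
Lemma WT_sum x : \sum_o WT x o = 1.
Proof.
rewrite /WT /ten2 (tuple_sum (fun i o => W (tnth x i) o)) big1 // => i _.
by have [_ h] := W_pmf (tnth x i).
Qed.

Lemma encA_ge0 m0 m x : 0 <= encA m0 m x.
Proof. by rewrite mulr_ge0 ?invr_ge0 // sumr_ge0 // => t _; exact: E_ge0. Qed.

Lemma encA_sum m0 m : \sum_x encA m0 m x = 1.
Proof.
rewrite -mulr_sumr exchange_big /=; under eq_bigr => t _ do rewrite E_sum.
by rewrite sumr_const -[_ *+ _]mulr_natl mulr1 mulVf // gt_eqF.
Qed.

Lemma the_code_valid : valid_code the_code.
Proof.
move=> m0 m1; split=> [x|]; first by rewrite ffunE encA_ge0.
by rewrite -[RHS](encA_sum m0 (phi m1)); apply: eq_bigr => x _; rewrite ffunE.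
Qed.

Local Notation CP := (code_pmf W the_code).
Local Notation Om := (code_space X Y1 Y2 Z N0 N1 n).

Lemma card_N1 : N1 = (#|A| * #|S| * #|B|)%N.
Proof.
by rewrite -!card_prod -[LHS]card_ord; apply: bij_eq_card; exists psi; [exact: phiK|exact: psiK].
Qed.

Lemma sum_msg (F : 'I_N1 -> R) : \sum_m1 F m1 = \sum_a \sum_s \sum_b F (psi (a, s, b)).
Proof.
rewrite pair_bigA /= pair_bigA /= (reindex psi) /=; last first.
  by exists phi => ? _; [exact: psiK|exact: phiK].
by apply: eq_bigr => -[[? ?] ?].
Qed.

Lemma code_sum (F : Om -> R) : \sum_w CP w * F w = (N0 * N1)%:R^-1 *
  \sum_m0 \sum_a \sum_s \sum_b \sum_x \sum_o encA m0 (a, s, b) x * WT x o *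
     F (m0, psi (a, s, b), x, o).
Proof.
transitivity (\sum_m0 \sum_m1 \sum_x \sum_o CP (m0, m1, x, o) * F (m0, m1, x, o)).
  rewrite pair_bigA /= pair_bigA /= pair_bigA /=.
  by apply: eq_bigr => -[[[? ?] ?] ?].
rewrite mulr_sumr; apply: eq_bigr => m0 _; rewrite sum_msg mulr_sumr; apply: eq_bigr => a _.
rewrite mulr_sumr; apply: eq_bigr => s _; rewrite mulr_sumr; apply: eq_bigr => b _.
rewrite mulr_sumr; apply: eq_bigr => x _; rewrite mulr_sumr; apply: eq_bigr => o _.
by rewrite /code_pmf /= ffunE psiK -!mulrA.
Qed.

(** Right indices give right messages, so the message error is dominated by the index error averaged
    over t. *)
Lemma the_code_err : err_prob W the_code <= eps.
Proof.
have [_ _ _ + _] := good; apply: le_trans.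
have -> : err_prob W the_code = \sum_w CP w * (err_event the_code w)%:R.
  rewrite /err_prob big_mkcond; apply: eq_bigr => w _.
  by case: ifP => _; rewrite ?mulr1 ?mulr0.
rewrite code_sum.
have sumK (F : K -> R) : \sum_k F k = \sum_m0 \sum_a F (m0, a).
  by rewrite pair_bigA; apply: eq_bigr => -[].
have sumL (F : S * J -> R) : \sum_l F l = \sum_s \sum_b \sum_t F (s, (b, t)).
  rewrite pair_bigA /= pair_bigA /= (reindex (fun y : S * B * T => (y.1.1, (y.1.2, y.2)))) /=.
    by apply: eq_bigr => -[[? ?] ?].
  exists (fun y : S * J => (y.1, y.2.1, y.2.2)); first by move=> [[? ?] ?] _.
  by move=> [? [? ?]] _.
have -> : (#|{: K}|%:R * #|{: S * J}|%:R)^-1 = (N0 * N1)%:R^-1 * #|T|%:R^-1 :> R.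
  rewrite card_N1 !card_prod card_ord !natrM -invfM; congr (_^-1); ring.
rewrite -mulrA ler_wpM2l ?invr_ge0 // sumK mulr_sumr; apply: ler_sum => m0 _.
rewrite mulr_sumr; apply: ler_sum => a _; rewrite sumL mulr_sumr; apply: ler_sum => s _.
rewrite mulr_sumr; apply: ler_sum => b _.
rewrite exchange_big mulr_sumr [leRHS](_ : _ = \sum_x \sum_t #|T|%:R^-1 * (E (m0, a) s (b, t) x *
  \sum_o WT x o * ([|| d1 (g1 o) != (m0, a, (s, (b, t))), d2 (g2 o) != (m0, a, (s, (b, t))) |
     d3 (gz o) != (m0, a)])%:R)); last first.
  rewrite [RHS]exchange_big; apply: eq_bigr => t _; by rewrite mulr_sumr.
rewrite exchange_big; apply: ler_sum => x _.
rewrite /encA /=.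
have -> : \sum_o #|T|%:R^-1 * (\sum_t E (m0, a) s (b, t) x) * WT x o *
    (err_event the_code (m0, psi (a, s, b), x, o))%:R =
  \sum_t #|T|%:R^-1 * (E (m0, a) s (b, t) x *
  \sum_o WT x o * (err_event the_code (m0, psi (a, s, b), x, o))%:R).
  under [RHS]eq_bigr => t _ do rewrite mulrA mulr_sumr.
  rewrite [RHS]exchange_big; apply: eq_bigr => o _.
  by rewrite mulr_sumr !mulr_suml; apply: eq_bigr => t _; rewrite !mulrA.
apply: ler_sum => t _; rewrite ler_wpM2l ?invr_ge0 // ler_wpM2l ?E_ge0 //.
apply: ler_sum => o _; rewrite ler_wpM2l ?WT_ge0 // ler_nat.
rewrite /err_event /rvM0 /rvM1 /rvY1n /rvY2n /rvZn /= -/(g1 o) -/(g2 o) -/(gz o).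
have [e1|_] := eqVneq (d1 (g1 o)) (m0, a, (s, (b, t))); last exact: leq_b1.
have [e2|_] := eqVneq (d2 (g2 o)) (m0, a, (s, (b, t))); last by rewrite orbT leq_b1.
have [e3|_] := eqVneq (d3 (gz o)) (m0, a); last by rewrite !orbT leq_b1.
by rewrite e1 e2 e3 /msg /= !eqxx.
Qed.

Definition pA (m0 : 'I_N0) a s b (z : n.-tuple Z) : R :=
  \sum_x encA m0 (a, s, b) x * \sum_(o | gz o == z) WT x o.

Lemma law_M1Z m1 z : law CP (fun w => (rvM1 w, rvZn w)) (m1, z) =
  pj pA (phi m1).1.1 (phi m1).1.2 (phi m1).2 z.
Proof.
transitivity (\sum_w CP w * ((rvM1 w == m1) && (rvZn w == z))%:R).
  rewrite /law big_mkcond; apply: eq_bigr => w _; rewrite xpair_eqE.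
  by case: ifP => _; rewrite ?mulr1 ?mulr0.
rewrite code_sum /pj -mulrA; congr (_ * _).
  by rewrite card_ord card_N1 !natrM !mulrA.
apply: eq_bigr => m0 _; set m := phi m1.
have col (I : finType) (i0 : I) (F : I -> R) : (forall i, i != i0 -> F i = 0) -> \sum_i F i = F i0.
  by move=> h; rewrite (bigD1 i0) //= big1 ?addr0.
have ne a s b : (a, s, b) != m -> \sum_x \sum_o encA m0 (a, s, b) x * WT x o *
   ((rvM1 ((m0, psi (a, s, b), x, o) : Om) == m1) && (rvZn ((m0, psi (a, s, b), x, o) : Om) ==
     z))%:R = 0.
  move=> nm; rewrite big1 // => x _; rewrite big1 // => o _; rewrite /rvM1 /=.
  by rewrite -(phiK m1) (inj_eq (can_inj psiK)) (negbTE nm) mulr0.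
rewrite (col _ m.1.1); last first.
  move=> a na; rewrite big1 // => s _; rewrite big1 // => b _; apply: ne.
  by apply: contraNneq na => <-.
rewrite (col _ m.1.2); last first.
  by move=> s na; rewrite big1 // => b _; apply: ne; apply: contraNneq na => <-.
rewrite (col _ m.2); last first.
  by move=> b na; apply: ne; apply: contraNneq na => <-.
rewrite /pA; apply: eq_bigr => x _; rewrite mulr_sumr [RHS]big_mkcond; apply: eq_bigr => o _.
rewrite /rvM1 /rvZn /= -/(gz o) -!surjective_pairing /m phiK eqxx /=.
by case: ifP => _; rewrite ?mulr1 ?mulr0.
Qed.

Lemma law_Zn z : law CP (@rvZn X Y1 Y2 Z N0 N1 n) z = pzl pA z.
Proof.
rewrite -(law_marg CP (@rvM1 X Y1 Y2 Z N0 N1 n)) sum_msg.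
apply: eq_bigr => a _; apply: eq_bigr => s _; apply: eq_bigr => b _.
by rewrite law_M1Z psiK.
Qed.

Lemma pA_ge0 m0 a s b z : 0 <= pA m0 a s b z.
Proof.
by apply: sumr_ge0 => x _; rewrite mulr_ge0 ?encA_ge0 // sumr_ge0 // => o _; exact: WT_ge0.
Qed.

Lemma pA_sum m0 a s b : \sum_z pA m0 a s b z = 1.
Proof.
rewrite exchange_big -[RHS](encA_sum m0 (a, s, b)); apply: eq_bigr => x _.
rewrite -mulr_sumr -[RHS]mulr1 -[in RHS](WT_sum x); congr (_ * _).
by rewrite [RHS](partition_big gz xpredT).
Qed.

(** For Z the message part b and the randomness t act alike: both mask s, and averaging over both is
    averaging over [J]. *)
Lemma PmsE m0 a s z : Pms pA m0 a s z =
  #|{: J}|%:R^-1 * \sum_j \sum_x E (m0, a) s j x * \sum_(o | gz o == z) WT x o.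
Proof.
rewrite /Pms card_prod natrM invfM -mulrA; congr (_ * _).
have sumJ (F : J -> R) : \sum_j F j = \sum_b \sum_t F (b, t).
  by rewrite pair_bigA; apply: eq_bigr => -[].
rewrite sumJ mulr_sumr; apply: eq_bigr => b _; rewrite exchange_big mulr_sumr.
by apply: eq_bigr => x _; rewrite /encA /= -mulrA mulr_suml.
Qed.

Lemma the_code_equivocation : ln #|S|%:R - C <= ln 2 * equivocation W the_code.
Proof.
have [_ [qk_ge0 qk_sum] dom _ leakC] := good.
have dom' m0 a s z : qk (m0, a) z = 0 -> Pms pA m0 a s z = 0.
  by move=> q0; rewrite PmsE; exact: dom q0.
have := equivocation_core pA_ge0 pA_sum qk_ge0 qk_sum m00 a0 s0 b0 dom'.
have -> : - \sum_a \sum_s \sum_b \sum_z pj pA a s b z * ln (pj pA a s b z / pzl pA z) =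
   ln 2 * equivocation W the_code.
  rewrite /equivocation /cent /ent.
  have pair (F : 'I_N1 * n.-tuple Z -> R) : \sum_y F y = \sum_a \sum_s \sum_b \sum_z F (psi (a,
    s, b), z).
    transitivity (\sum_m1 \sum_z F (m1, z)); last by rewrite sum_msg.
    by rewrite pair_bigA; apply: eq_bigr => -[].
  rewrite pair.
  have -> : \sum_z law CP (@rvZn X Y1 Y2 Z N0 N1 n) z * log2 (law CP (@rvZn X Y1 Y2 Z N0 N1 n) z) =
     \sum_a \sum_s \sum_b \sum_z pj pA a s b z * log2 (pzl pA z).
    under eq_bigr => z _ do rewrite law_Zn {1}/pzl mulr_suml.
    rewrite exchange_big; apply: eq_bigr => a _.
    under eq_bigr => z _ do rewrite mulr_suml.
    rewrite exchange_big; apply: eq_bigr => s _.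
    under eq_bigr => z _ do rewrite mulr_suml.
    by rewrite exchange_big.
  rewrite opprK addrC -sumrB -sumrN mulr_sumr; apply: eq_bigr => a _.
  rewrite -sumrB -sumrN mulr_sumr; apply: eq_bigr => s _.
  rewrite -sumrB -sumrN mulr_sumr; apply: eq_bigr => b _.
  rewrite -sumrB -sumrN mulr_sumr; apply: eq_bigr => z _.
  rewrite law_M1Z psiK /=; set y := pj _ _ _ _ _.
  have y0 : 0 <= y by exact: pj_ge0 pA_ge0 _ _ _ _.
  have [->|yn] := eqVneq y 0; first by rewrite !mul0r subrr mulr0 oppr0.
  have yp : 0 < y by rewrite lt_def yn.
  have zp : 0 < pzl pA z.
    rewrite /pzl; have j0 := pj_ge0 pA_ge0.
    apply: lt_le_trans yp _; rewrite /y.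
    rewrite (bigD1 a) //= (bigD1 s) //= (bigD1 b) //= -!addrA lerDl !addr_ge0 //.
    - by apply: sumr_ge0 => ? _.
    - by do 2 (apply: sumr_ge0 => ? _).
    - by do 3 (apply: sumr_ge0 => ? _).
  by rewrite ln_div ?posrE // /log2; field; rewrite gt_eqF // ln2_gt0.
move=> h; apply: le_trans h; rewrite lerD2l lerN2; apply: le_trans leakC.
rewrite le_eqVlt; apply/orP; left; apply/eqP; congr (_ * _).
  by rewrite card_prod natrM.
rewrite pair_bigA /=; apply: eq_bigr => -[m0 a] _; apply: eq_bigr => s _; apply: eq_bigr => z _ /=.
by rewrite PmsE.
Qed.

End CodeOfGood.

(** * Rates and asymptotics *)

Section Limits.
Variable R : realType.

Lemma limn_einf_ge (u w : nat -> \bar R) (l : \bar R) :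
  (forall n, (w n <= u n)%E) -> w @ \oo --> l -> (l <= limn_einf u)%E.
Proof.
move=> wu wl; have [<- _] := cvg_limn_einf_sup wl.
rewrite !limn_einf_lim; apply: lee_lim; [exact/is_cvg_einfs|exact/is_cvg_einfs|].
apply: nearW => n; apply: le_ereal_inf_tmp => _ [k /= nk <-].
apply: le_trans (wu k); apply: ereal_inf_lbound; by exists k.
Qed.

Lemma exists_small (s : seq R) : all (fun x => 0 < x) s ->
  exists2 d : R, 0 < d & all (fun x => d < x) s.
Proof.
elim: s => [|x s IH] /=; first by exists 1.
move=> /andP[x0 /IH[d d0 ds]]; exists (Num.min d (x / 2)).
  by rewrite lt_min d0 divr_gt0.
apply/andP; split; first by rewrite gt_min; apply/orP; right; lra.
by apply: sub_all ds => y; rewrite gt_min => ->.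
Qed.

(** Here a stands for I(U;Z), z0 for I(V0;Z|U), and A and B for the receiver bounds after
    subtraction of I(Vi;Z|V0). The part of R1 beyond Re goes to b up to z0, the rate that masks s;
    the excess goes to the cloud centre until this is full up to d, and what is left goes to b
    again. Local randomness raises the masking rate above z0. The three cases below are these
    regimes. *)
Lemma rate_split (a A B z0 R0 R1 Re : R) :
  0 <= z0 -> 0 <= Re -> Re <= R1 -> R0 < a -> R0 + R1 < a + A -> R0 + R1 < B ->
  Re + z0 < A -> R0 + Re + z0 < B ->
  exists ra rb rt d : R, [/\ [/\ 0 <= ra, 0 <= rb, 0 <= rt & 0 < d], ra + Re + rb = R1 &
    [/\ R0 + ra < a, z0 < rb + rt, Re + rb + rt + d < A & R0 + ra + (Re + rb + rt) + d < B]].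
Proof.
move=> z00 Re0 ReR1 h1 h2 h3 h4 h5.
(* At most three margins d accumulate in a constraint, hence the thirds. *)
have [d d0] := @exists_small [:: a - R0; (a + A - (R0 + R1)) / 3; (B - (R0 + R1)) / 3;
   (A - (Re + z0)) / 3; (B - (R0 + Re + z0)) / 3]
   ltac:(by rewrite /= ?andbT; do ![apply/andP; split]; lra).
rewrite /= andbT => /and5P[e1 e2 e3 e4 e5] {h1 h2 h3 h4 h5}.
have [c|c] := leP R1 (Re + z0).
  exists 0, (R1 - Re), (Re + z0 - R1 + d), d.
  by split; [split; lra|lra|split; lra].
have [c'|c'] := leP (R1 - (a - R0) + d) (Re + z0).
  exists (R1 - (Re + z0)), z0, d, d.
  by split; [split; lra|lra|split; lra].
exists (a - R0 - d), (R1 - (a - R0) + d - Re), d, d.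
by split; [split; lra|lra|split; lra].
Qed.

(** Satellite rates are t_i = z_i + d, just above z_i = I(Vi;Z|V0). Then I12 + m <= z1 + z2 gives
    the masking of the satellite pair and, since I12 >= 0, also the condition m < t1 + t2 of the
    draw. *)
Lemma rate_choice (a A1 A2 B1 B2 z0 z1 z2 m I12 R0 R1 Re : R) :
  0 <= z0 -> 0 <= z1 -> 0 <= z2 -> 0 <= I12 -> I12 <= z1 + z2 - m ->
  0 <= R0 -> 0 <= Re -> Re <= R1 ->
  R0 < a ->
  R0 + R1 < a + Num.min (A1 - z1) (A2 - z2) ->
  R0 + R1 < Num.min (B1 - z1) (B2 - z2) ->
  Re < Num.min (A1 - (z0 + z1)) (A2 - (z0 + z2)) ->
  R0 + Re < Num.min (B1 - (z0 + z1)) (B2 - (z0 + z2)) ->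
  exists ra rb rt t1 t2 : R, [/\
    [/\ 0 <= ra, 0 <= rb, 0 <= rt, 0 < t1 & 0 < t2],
    ra + Re + rb = R1,
    [/\ R0 + ra < a, Re + rb + rt + t1 < A1, Re + rb + rt + t2 < A2,
      R0 + ra + (Re + rb + rt) + t1 < B1 & R0 + ra + (Re + rb + rt) + t2 < B2] &
    [/\ z0 < rb + rt, z0 + z1 < rb + rt + t1, z0 + z2 < rb + rt + t2,
      z0 + I12 + m < rb + rt + t1 + t2 & m < t1 + t2]].
Proof.
move=> z00 z10 z20 I0 Ile R00 Re0 ReR1 h1 h2 h3.
have sub x y z : x - (y + z) = x - z - y :> R by rewrite opprD addrAC addrA.
rewrite !sub => h5 h6.
have addl (x y z w : R) : x < Num.min (y - w) (z - w) -> x + w < Num.min y z.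
  by rewrite !lt_min !ltrBrDr.
have [ra [rb [rt [d [[ra0 rb0 rt0 d0] sumR [k1 k2]]]]]] :=
  rate_split z00 Re0 ReR1 h1 h2 h3 (addl _ _ _ _ h5) (addl _ _ _ _ h6).
rewrite !lt_min => /andP[a1 a2] /andP[b1 b2].
have addz (x y z : R) : x + d < y - z -> x + (z + d) < y.
  by rewrite ltrBrDr addrAC addrA.
exists ra, rb, rt, (z1 + d), (z2 + d).
clear h1 h2 h3 h5 h6.
by split=> //; split; rewrite ?addz //; clear -Ile k2 d0 z10 z20 z00 I0; lra.
Qed.

Lemma natr_exp2 (k : nat) : (2 ^ k)%N%:R = expR (k%:R * ln 2) :> R.
Proof. by rewrite natrX expRM_natl lnK // posrE. Qed.

Lemma exp2_le (k n : nat) (r c : R) : k%:R <= n%:R * r + c ->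
  (2 ^ k)%N%:R <= expR (c * ln 2) * expR (n%:R * (r * ln 2)) :> R.
Proof.
move=> h; rewrite natr_exp2 -expRD ler_expR [leRHS](_ : _ = (n%:R * r + c) * ln 2); last by ring.
by rewrite ler_wpM2r // ln_ge0 // ler1n.
Qed.

Lemma exp2_inv_le (k n : nat) (r c : R) : n%:R * r - c <= k%:R ->
  ((2 ^ k)%N%:R)^-1 <= expR (c * ln 2) * expR (n%:R * (- (r * ln 2))) :> R.
Proof.
move=> h; rewrite natr_exp2 -expRN -expRD ler_expR.
rewrite [leRHS](_ : _ = - ((n%:R * r - c) * ln 2)); last by ring.
by rewrite lerN2 ler_wpM2r // ln_ge0 // ler1n.
Qed.

(** The sizes of A, S and B must multiply exactly to the message set size, so kA and kS are rounded
    down and kB is the remainder, at most n rb + 3; the other exponents are rounded up. With kM, kT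
    and one satellite exponent the total excess is at most 6, while the masking exponents lose
    nothing. *)
Lemma sizes (n : nat) (R0 R1 Re ra rb rt t1 t2 : R) :
  0 <= R0 -> 0 <= Re -> 0 <= ra -> 0 <= rb -> 0 <= rt -> 0 <= t1 -> 0 <= t2 ->
  ra + Re + rb = R1 ->
  exists kA kS kB kT k1 k2 : nat, let kM := `|Num.ceil (n%:R * R0)|%N in
  [/\ [/\ `|Num.ceil (n%:R * R1)|%N = (kA + kS + kB)%N, n%:R * Re - 1 <= kS%:R,
      n%:R * t1 <= k1%:R & n%:R * t2 <= k2%:R],
    [/\ (kM + kA + (kS + (kB + kT)) + k1)%N%:R <= n%:R * (R0 + ra + (Re + rb + rt) + t1) + 6,
      (kM + kA + (kS + (kB + kT)) + k2)%N%:R <= n%:R * (R0 + ra + (Re + rb + rt) + t2) + 6,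
      (kS + (kB + kT) + k1)%N%:R <= n%:R * (Re + rb + rt + t1) + 6,
      (kS + (kB + kT) + k2)%N%:R <= n%:R * (Re + rb + rt + t2) + 6 &
      (kM + kA)%N%:R <= n%:R * (R0 + ra) + 6] &
    [/\ n%:R * (rb + rt) <= (kB + kT)%N%:R, n%:R * (rb + rt + t1) <= (kB + kT + k1)%N%:R,
      n%:R * (rb + rt + t2) <= (kB + kT + k2)%N%:R,
      n%:R * (rb + rt + t1 + t2) <= (kB + kT + (k1 + k2))%N%:R &
      n%:R * (t1 + t2) <= (k1 + k2)%N%:R]].
Proof.
move=> R00 Re0 ra0 rb0 rt0 t10 t20 sumR.
have n0 : 0 <= n%:R :> R by [].
have cl (x : R) : 0 <= x -> x <= (`|Num.ceil x|%N)%:R /\ (`|Num.ceil x|%N)%:R <= x + 1.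
  move=> x0; have c0 : 0 <= Num.ceil x.
    by rewrite -(ler_int R); apply: le_trans x0 (ceil_ge x).
  have -> : (`|Num.ceil x|%N)%:R = (Num.ceil x)%:~R :> R.
    by rewrite -[in RHS](gez0_abs c0).
  have /andP[h1 h2] := ceil_itv x; split=> //.
  by move: h1; rewrite intrB => h1; lra.
have tr (x : R) : 0 <= x -> (Num.truncn x)%:R <= x /\ x - 1 <= (Num.truncn x)%:R.
  move=> x0; have /andP[h1] := truncn_itv x0; rewrite -natr1 => h2; split=> //; lra.
have R10 : 0 <= R1 by lra.
have [c1 c1'] := cl _ (mulr_ge0 n0 R10).
have [c0 c0'] := cl _ (mulr_ge0 n0 R00).
have [a1 a2] := tr _ (mulr_ge0 n0 ra0).
have [s1 s2] := tr _ (mulr_ge0 n0 Re0).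
have [x1 x1'] := cl _ (mulr_ge0 n0 rt0).
have [x2 x2'] := cl _ (mulr_ge0 n0 t10).
have [x3 x3'] := cl _ (mulr_ge0 n0 t20).
set c := `|Num.ceil (n%:R * R1)|%N in c1 c1' *.
set kA := Num.truncn (n%:R * ra) in a1 a2 *.
set kS := Num.truncn (n%:R * Re) in s1 s2 *.
have nR1 : n%:R * R1 = n%:R * ra + n%:R * Re + n%:R * rb by rewrite -sumR; ring.
have nrb0 : 0 <= n%:R * rb by exact: mulr_ge0.
have le : (kA + kS <= c)%N by rewrite -(ler_nat R) natrD; lra.
exists kA, kS, (c - (kA + kS))%N, `|Num.ceil (n%:R * rt)|%N, `|Num.ceil (n%:R * t1)|%N,
  `|Num.ceil (n%:R * t2)|%N.
have ek : (c - (kA + kS))%N%:R = c%:R - (kA%:R + kS%:R) :> R by rewrite natrB // natrD.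
have [d1 d2] : n%:R * rb <= (c - (kA + kS))%N%:R /\ (c - (kA + kS))%N%:R <= n%:R * rb + 3.
  by rewrite ek; clear -c1 c1' a1 a2 s1 s2 nR1; split; lra.
move: (c - (kA + kS))%N (subnKC le) d1 d2 => kB e d1 d2.
clear -c0' a1 s1 s2 x1 x1' x2 x2' x3 x3' d1 d2 e.
rewrite !natrD !mulrDr; split; first by split.
  by clear -c0' a1 s1 x1' x2' x3' d2; split; lra.
by clear -x1 x2 x3 d1; split; lra.
Qed.

End Limits.

(** * Codes of length n with exponentially small error and bounded leakage *)

Section Asymptotic.
Variables (R : realType) (U V0 V1 V2 X Y1 Y2 Z : finType).
Variables (pu : U -> R) (pv0 : U -> V0 -> R) (q : V0 -> V1 -> V2 -> R)
  (px : V0 -> V1 -> V2 -> X -> R) (W : X -> {ffun (Y1 * Y2 * Z) -> R}).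
Hypotheses (pu_ge0 : forall u, 0 <= pu u) (pv0_ge0 : forall u v, 0 <= pv0 u v)
  (q_ge0 : forall v0 v1 v2, 0 <= q v0 v1 v2)
  (px_ge0 : forall v0 v1 v2 x, 0 <= px v0 v1 v2 x) (W_pmf : is_channel W).
Hypotheses (pu_sum : \sum_u pu u = 1) (pv0_sum : forall u, \sum_v pv0 u v = 1)
  (q_sum : forall v0, \sum_v1 \sum_v2 q v0 v1 v2 = 1)
  (px_sum : forall v0 v1 v2, \sum_x px v0 v1 v2 x = 1).
Local Notation O := (Y1 * Y2 * Z)%type.
Local Notation f1 := (fun t : O => t.1.1).
Local Notation f2 := (fun t : O => t.1.2).
Local Notation fz := (fun t : O => t.2).
Local Notation G1 := (chan px (kW W) f1).
Local Notation G2 := (chan px (kW W) f2).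
Local Notation Gz := (chan px (kW W) fz).
Local Notation l2 := (ln 2 : R).

Variables (R0 R1 Re ra rb rt t1 t2 s gam : R).
Hypotheses (R00 : 0 <= R0) (Re0 : 0 <= Re) (ra0 : 0 <= ra) (rb0 : 0 <= rb) (rt0 : 0 <= rt)
  (t10 : 0 <= t1) (t20 : 0 <= t2) (sumR : ra + Re + rb = R1) (s01 : 0 < s <= 1)
  (gam0 : 0 < gam) (gam1 : gam < 1).
Local Notation decays r e := (expR (s * (r * l2)) * e <= gam).
Hypotheses
  (d1m : decays (R0 + ra + (Re + rb + rt) + t1)
    (EP pu pv0 q G1 (fun u v0 v1 v2 b => rho_m pu pv0 q G1 u v0 v1 v2 b `^ s)))
  (d1u : decays (Re + rb + rt + t1)
    (EP pu pv0 q G1 (fun u v0 v1 v2 b => rho_u pv0 q G1 u v0 v1 v2 b `^ s)))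
  (d2m : decays (R0 + ra + (Re + rb + rt) + t2)
    (EP pu pv0 (swp q) (swp G2)
      (fun u v0 v2 v1 b => rho_m pu pv0 (swp q) (swp G2) u v0 v2 v1 b `^ s)))
  (d2u : decays (Re + rb + rt + t2)
    (EP pu pv0 (swp q) (swp G2)
      (fun u v0 v2 v1 b => rho_u pv0 (swp q) (swp G2) u v0 v2 v1 b `^ s)))
  (d3 : decays (R0 + ra)
    (EP pu pv0 q Gz (fun u v0 v1 v2 b => rho_z pu pv0 q Gz u v0 v1 v2 b `^ s)))
  (dw : decays (- (t1 + t2))
    (EP pu pv0 q Gz (fun u v0 v1 v2 b => rho_w pv0 q u v0 v1 v2 b `^ s)))
  (dl0 : decays (- (rb + rt))
    (EP pu pv0 q Gz (fun u v0 v1 v2 b => rho_0 pv0 q Gz u v0 v1 v2 b `^ s)))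
  (dl1 : decays (- (rb + rt + t1))
    (EP pu pv0 q Gz (fun u v0 v1 v2 b => rho_1 pv0 q Gz u v0 v1 v2 b `^ s)))
  (dl2 : decays (- (rb + rt + t2))
    (EP pu pv0 (swp q) (swp Gz)
      (fun u v0 v2 v1 b => rho_1 pv0 (swp q) (swp Gz) u v0 v2 v1 b `^ s)))
  (dl12 : decays (- (rb + rt + t1 + t2))
    (EP pu pv0 q Gz (fun u v0 v1 v2 b => rho_12 pv0 q Gz u v0 v1 v2 b `^ s)))
  (dt1 : expR (- (t1 * l2)) <= gam) (dt2 : expR (- (t2 * l2)) <= gam).

(** A rounding excess of 6 bits costs a factor 2^6 in a codebook size. In [errC], 5 counts the
    decoding terms, 3 stands for eta and the two inverse satellite sizes, and the last summand
    belongs to the moment of [rho_w]. *)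
Definition cc : R := expR (6 * l2) `^ s.
Definition errC : R := 5 * cc + 3 + (1 + s^-1) * cc.
Definition leakC : R := 2 * l2 + 1 + (l2 + (1 + s^-1) * (4 * cc)).

Lemma term_le (k n : nat) (r g : R) : 0 <= g -> expR (s * (r * l2)) * g <= gam ->
  k%:R <= n%:R * r + 6 -> ((2 ^ k)%N%:R : R) `^ s * g ^+ n <= cc * gam ^+ n.
Proof.
move=> g0 dg kn; have s0 : 0 <= s by case/andP: s01 => /ltW.
apply: le_trans (pow_decay _ g0 _ s0 (exp2_le kn)) _; rewrite ?expR_ge0 //.
rewrite ler_wpM2l ?powR_ge0 // lerXn2r // nnegrE ?mulr_ge0 ?expR_ge0 //.
exact: ltW.
Qed.

Lemma inv_term_le (k n : nat) (r g : R) : 0 <= g -> expR (s * (- r * l2)) * g <= gam ->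
  n%:R * r <= k%:R -> ((2 ^ k)%N%:R^-1 : R) `^ s * g ^+ n <= cc * gam ^+ n.
Proof.
move=> g0 dg kn; have s0 : 0 <= s by case/andP: s01 => /ltW.
have kn6 : n%:R * r - 6 <= k%:R by lra.
apply: le_trans (pow_decay _ g0 _ s0 (exp2_inv_le kn6)) _; rewrite ?expR_ge0 //.
rewrite ler_wpM2l ?powR_ge0 // lerXn2r // ?nnegrE ?mulr_ge0 ?expR_ge0 ?(ltW gam0) //.
by move: dg; rewrite mulNr.
Qed.

Let W0 x o : 0 <= kW W x o. Proof. by have [h _] := W_pmf x; exact: h. Qed.

Lemma Gf_ge0 (B : finType) (f : O -> B) v0 v1 v2 b : 0 <= chan px (kW W) f v0 v1 v2 b.
Proof. by apply: chan_ge0. Qed.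

Lemma EP_ge0 (A1 A2 B : finType) (k : V0 -> A1 -> A2 -> R) (G : V0 -> A1 -> A2 -> B -> R) F :
  (forall a b c, 0 <= k a b c) -> (forall a b c d, 0 <= G a b c d) ->
  (forall u v0 v1 v2 b, 0 <= F u v0 v1 v2 b) -> 0 <= EP pu pv0 k G F.
Proof.
move=> k0 G0 F0; do 5 (apply: sumr_ge0 => ? _).
exact: (mulr_ge0 (mulr_ge0 (mulr_ge0 (mulr_ge0 _ _) _) _) _).
Qed.

Lemma ten_sum (n : nat) (A : finType) (f : A -> R) : \sum_a f a = 1 -> \sum_x ten1 n f x = 1.
Proof. by move=> f1; rewrite (tuple_sum (fun _ a => f a)) big1. Qed.

Lemma code_n (n : nat) : exists c : Defs.code R X Y1 Y2 Z (msize n R0) (msize n R1) n,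
  [/\ valid_code c, err_prob W c <= 2 * (errC * Num.sqrt gam ^+ n) &
    (n%:R * Re - 1) * l2 - 2 * leakC <= l2 * equivocation W c].
Proof.
have [kA [kS [kB [kT [k1 [k2]]]]]] := sizes n R00 Re0 ra0 rb0 rt0 t10 t20 sumR.
set kM := `|Num.ceil (n%:R * R0)|%N.
move=> [[cR1 b1 b4 b5] [c1m c2m c1u c2u c3] [cl0 cl1 cl2 cl12 cw]].
have p2 k : (0 < 2 ^ k)%N by rewrite expn_gt0.
pose o0 k : 'I_(2 ^ k) := Ordinal (p2 k).
have cardN : #|{: 'I_(2 ^ kA) * 'I_(2 ^ kS) * 'I_(2 ^ kB)}| = msize n R1.
  by rewrite !card_prod !card_ord -!expnD /msize cR1.
have e1 : msize n R1 = #|{: 'I_(2 ^ kA) * 'I_(2 ^ kS) * 'I_(2 ^ kB)}| by rewrite cardN.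
pose phi (i : 'I_(msize n R1)) := enum_val (cast_ord e1 i).
pose psi (y : 'I_(2 ^ kA) * 'I_(2 ^ kS) * 'I_(2 ^ kB)) := cast_ord (esym e1) (enum_rank y).
have phiK : cancel phi psi by move=> i; rewrite /phi /psi enum_valK cast_ordK.
have psiK : cancel psi phi by move=> i; rewrite /phi /psi cast_ordKV enum_rankK.
have s_gt0 : 0 < s by case/andP: s01.
have sV : 0 <= 1 + s^-1 by rewrite addr_ge0 // invr_ge0 ltW.
(* [eta] will be h^n, which balances eta against eta^-1 * gam^n in the deficit bound. *)
set h := Num.sqrt gam.
have h0 : 0 < h by rewrite sqrtr_gt0.
have hh : h ^+ n * h ^+ n = gam ^+ n by rewrite -exprMn -expr2 sqr_sqrtr // ltW.
have h1 : h <= 1 by rewrite -sqrtr1 ler_wsqrtr // ltW.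
have hn0 : 0 < h ^+ n by exact: exprn_gt0.
have hn1 : h ^+ n <= 1 by rewrite exprn_ile1 // ltW.
have gn0 : 0 < gam ^+ n by exact: exprn_gt0.
have gn1 : gam ^+ n <= 1 by rewrite exprn_ile1 // ltW.
have gh : gam ^+ n <= h ^+ n by rewrite -hh -[leRHS]mulr1 ler_wpM2l // ltW.
have cc0 : 0 < cc by rewrite powR_gt0 // expR_gt0.
have l20 : 0 < l2 by exact: ln2_gt0.
have errC0 : 0 < errC.
  have := mulr_ge0 sV (ltW cc0); rewrite /errC; lra.
have leakC0 : 0 < leakC.
  have : 0 <= (1 + s^-1) * (4 * cc) by rewrite mulr_ge0 // mulr_ge0 // ltW.
  rewrite /leakC; lra.
have eps0 : 0 < errC * h ^+ n by exact: mulr_gt0.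
have cardK : #|{: 'I_(msize n R0) * 'I_(2 ^ kA)}|%:R = (2 ^ (kM + kA))%N%:R :> R.
  by rewrite card_prod !card_ord expnD.
have cardL : #|{: 'I_(2 ^ kS) * ('I_(2 ^ kB) * 'I_(2 ^ kT))}|%:R = (2 ^ (kS + (kB + kT)))%N%:R :> R.
  by rewrite !card_prod !card_ord !expnD.
have cardJ : #|{: 'I_(2 ^ kB) * 'I_(2 ^ kT)}|%:R = (2 ^ (kB + kT))%N%:R :> R.
  by rewrite !card_prod !card_ord !expnD.
have card1 k : #|'I_(2 ^ k)|%:R = (2 ^ k)%N%:R :> R by rewrite card_ord.
have pd k k' : (2 ^ k)%N%:R * (2 ^ k')%N%:R = (2 ^ (k + k'))%N%:R :> R by rewrite -natrM -expnD.
have q1_ge0 := q_ge0; have qs_ge0 v0 v2 v1 : 0 <= swp q v0 v2 v1 by exact: q_ge0.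
have G1_ge0 := @Gf_ge0 _ f1; have G2_ge0 := @Gf_ge0 _ f2; have Gz_ge0 := @Gf_ge0 _ fz.
have G2s_ge0 v0 v2 v1 b : 0 <= swp G2 v0 v2 v1 b by exact: G2_ge0.
have Gzs_ge0 v0 v2 v1 b : 0 <= swp Gz v0 v2 v1 b by exact: Gz_ge0.
have cG1 : chan (ten4 n px) (WT W (n := n)) (@g1 Y1 Y2 Z n) = ten4 n G1.
  exact: (chan_ten n px (kW W) f1).
have cG2 : chan (ten4 n px) (WT W (n := n)) (@g2 Y1 Y2 Z n) = ten4 n G2.
  exact: (chan_ten n px (kW W) f2).
have cGz : chan (ten4 n px) (WT W (n := n)) (@gz Y1 Y2 Z n) = ten4 n Gz.
  exact: (chan_ten n px (kW W) fz).
have tinv k t : 0 <= t -> expR (- (t * l2)) <= gam -> n%:R * t <= k%:R ->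
    ((2 ^ k)%N%:R)^-1 <= h ^+ n.
  move=> t0 dt kt; apply: le_trans gh.
  have kt' : n%:R * t - 0 <= k%:R by rewrite subr0.
  apply: le_trans (exp2_inv_le kt') _; rewrite mul0r expR0 mul1r expRM_natl.
  by rewrite lerXn2r // ?nnegrE ?expR_ge0 // ltW.
have EPp (A1 A2 B : finType) (k : V0 -> A1 -> A2 -> R) (G : V0 -> A1 -> A2 -> B -> R)
   (F : U -> V0 -> A1 -> A2 -> B -> R) :
  (forall a b c, 0 <= k a b c) -> (forall a b c d, 0 <= G a b c d) ->
  0 <= EP pu pv0 k G (fun u v0 v1 v2 b => F u v0 v1 v2 b `^ s).
  by move=> ? ?; apply: EP_ge0 => // *; exact: powR_ge0.
have eb : err_bound (ten1 n pu) (ten2 n pv0) (ten3 n q) (ten4 n px) (WT W (n := n))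
    ('I_(msize n R0) * 'I_(2 ^ kA))%type 'I_(2 ^ kS) ('I_(2 ^ kB) * 'I_(2 ^ kT))%type
    'I_(2 ^ k1) 'I_(2 ^ k2) (@g1 Y1 Y2 Z n) (@g2 Y1 Y2 Z n) (@gz Y1 Y2 Z n) s (h ^+ n)
    <= errC * h ^+ n.
  rewrite /err_bound cG1 cG2 cGz cardK cardL !card1 !pd !swp_ten3 !swp_ten4.
  rewrite !rho_m_ten // !rho_u_ten // rho_z_ten // rho_w_ten //.
  have T1 : (2 ^ (kM + kA + (kS + (kB + kT)) + k1))%N%:R `^ s *
      EP pu pv0 q G1 (fun u v0 v1 v2 b => rho_m pu pv0 q G1 u v0 v1 v2 b `^ s) ^+ n
      <= cc * gam ^+ n.
    by apply: (term_le _ d1m c1m); exact: EPp.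
  have T2 : (2 ^ (kS + (kB + kT) + k1))%N%:R `^ s *
      EP pu pv0 q G1 (fun u v0 v1 v2 b => rho_u pv0 q G1 u v0 v1 v2 b `^ s) ^+ n
      <= cc * gam ^+ n.
    by apply: (term_le _ d1u c1u); exact: EPp.
  have T3 : (2 ^ (kM + kA + (kS + (kB + kT)) + k2))%N%:R `^ s *
      EP pu pv0 (swp q) (swp G2)
      (fun u v0 v2 v1 b => rho_m pu pv0 (swp q) (swp G2) u v0 v2 v1 b `^ s) ^+ n
      <= cc * gam ^+ n.
    by apply: (term_le _ d2m c2m); exact: EPp.
  have T4 : (2 ^ (kS + (kB + kT) + k2))%N%:R `^ s *
      EP pu pv0 (swp q) (swp G2)
      (fun u v0 v2 v1 b => rho_u pv0 (swp q) (swp G2) u v0 v2 v1 b `^ s) ^+ n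
      <= cc * gam ^+ n.
    by apply: (term_le _ d2u c2u); exact: EPp.
  have T5 : (2 ^ (kM + kA))%N%:R `^ s *
      EP pu pv0 q Gz (fun u v0 v1 v2 b => rho_z pu pv0 q Gz u v0 v1 v2 b `^ s) ^+ n
      <= cc * gam ^+ n.
    by apply: (term_le _ d3 c3); exact: EPp.
  have T6 : (2 ^ (k1 + k2))%N%:R^-1 `^ s *
      EP pu pv0 q Gz (fun u v0 v1 v2 b => rho_w pv0 q u v0 v1 v2 b `^ s) ^+ n
      <= cc * gam ^+ n.
    by apply: (inv_term_le _ dw cw); exact: EPp.
  have T7 := tinv k1 t1 t10 dt1 b4.
  have T8 := tinv k2 t2 t20 dt2 b5.
  have T9 : cc * gam ^+ n <= cc * h ^+ n by rewrite ler_wpM2l // ltW.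
  have T10 : (h ^+ n)^-1 * ((2 ^ k1)%N%:R^-1 + (2 ^ k2)%N%:R^-1 + (1 + s^-1) *
      ((2 ^ (k1 + k2))%N%:R^-1 `^ s *
      EP pu pv0 q Gz (fun u v0 v1 v2 b => rho_w pv0 q u v0 v1 v2 b `^ s) ^+ n)) <=
      2 * h ^+ n + (1 + s^-1) * cc * h ^+ n.
    have hV x : x <= gam ^+ n -> (h ^+ n)^-1 * x <= h ^+ n.
      by move=> xg; rewrite ler_pdivrMl // hh.
    have inv_le k t : 0 <= t -> expR (- (t * l2)) <= gam -> n%:R * t <= k%:R ->
        ((2 ^ k)%N%:R)^-1 <= gam ^+ n.
      move=> t0 dt kt; have kt' : n%:R * t - 0 <= k%:R by rewrite subr0.
      apply: le_trans (exp2_inv_le kt') _; rewrite mul0r expR0 mul1r expRM_natl.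
      by rewrite lerXn2r // ?nnegrE ?expR_ge0 // ltW.
    rewrite !mulrDr; apply: lerD; last first.
      rewrite mulrCA -mulrA ler_wpM2l //.
      rewrite ler_pdivrMl // [leRHS]mulrCA hh; exact: T6.
    rewrite mulr_natl mulr2n; apply: lerD; apply: hV.
      exact: (inv_le _ _ t10 dt1 b4).
    exact: (inv_le _ _ t20 dt2 b5).
  rewrite [leRHS](_ : _ = cc * h ^+ n + cc * h ^+ n + (cc * h ^+ n + cc * h ^+ n) + cc * h ^+ n
    + (h ^+ n + (2 * h ^+ n + (1 + s^-1) * cc * h ^+ n))); last by rewrite /errC; ring.
  by rewrite !lerD //; apply: le_trans T9.
have lb : 2 * l2 + 1 + leak_bound (ten1 n pu) (ten2 n pv0) (ten3 n q) (ten4 n px) (WT W (n := n))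
    ('I_(2 ^ kB) * 'I_(2 ^ kT))%type 'I_(2 ^ k1) 'I_(2 ^ k2) (@gz Y1 Y2 Z n) s <= leakC.
  rewrite /leak_bound cGz cardJ !card1 -!invfM !pd swp_ten3 swp_ten4.
  rewrite rho_0_ten // !rho_1_ten // rho_12_ten //.
  have ccg : cc * gam ^+ n <= cc by rewrite -[leRHS]mulr1 ler_wpM2l // ltW.
  have T1 : (2 ^ (kB + kT))%N%:R^-1 `^ s *
     EP pu pv0 q Gz (fun u v0 v1 v2 b => rho_0 pv0 q Gz u v0 v1 v2 b `^ s) ^+ n <= cc.
    by apply: le_trans ccg; apply: (inv_term_le _ dl0 cl0); exact: EPp.
  have T2 : (2 ^ (kB + kT + k1))%N%:R^-1 `^ s *
     EP pu pv0 q Gz (fun u v0 v1 v2 b => rho_1 pv0 q Gz u v0 v1 v2 b `^ s) ^+ n <= cc.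
    by apply: le_trans ccg; apply: (inv_term_le _ dl1 cl1); exact: EPp.
  have T3 : (2 ^ (kB + kT + k2))%N%:R^-1 `^ s *
     EP pu pv0 (swp q) (swp Gz)
      (fun u v0 v2 v1 b => rho_1 pv0 (swp q) (swp Gz) u v0 v2 v1 b `^ s) ^+ n <= cc.
    by apply: le_trans ccg; apply: (inv_term_le _ dl2 cl2); exact: EPp.
  have T4 : (2 ^ (kB + kT + (k1 + k2)))%N%:R^-1 `^ s *
     EP pu pv0 q Gz (fun u v0 v1 v2 b => rho_12 pv0 q Gz u v0 v1 v2 b `^ s) ^+ n <= cc.
    by apply: le_trans ccg; apply: (inv_term_le _ dl12 cl12); exact: EPp.
  rewrite /leakC lerD2l lerD2l ler_wpM2l // [leRHS](_ : _ = cc + cc + cc + cc); last by ring.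
  by rewrite !lerD.
have pun0 x : 0 <= ten1 n pu x by apply: prodr_ge0.
have pvn0 x y : 0 <= ten2 n pv0 x y by apply: prodr_ge0.
have qn0 x y z : 0 <= ten3 n q x y z by apply: prodr_ge0.
have pxn0 x y z w : 0 <= ten4 n px x y z w by apply: prodr_ge0.
have pvn1 u : \sum_v ten2 n pv0 u v = 1.
  by rewrite (tuple_sum (fun i v => pv0 (tnth u i) v)) big1.
have qn1 v0 : \sum_v1 \sum_v2 ten3 n q v0 v1 v2 = 1.
  have -> : \sum_v1 \sum_v2 ten3 n q v0 v1 v2 =
      \sum_v1 \prod_(i < n) marg q (tnth v0 i) (tnth v1 i).
    by apply: eq_bigr => v1 _; exact: marg_ten.
  rewrite (tuple_sum (fun i a => marg q (tnth v0 i) a)) big1 // => i _; exact: q_sum.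
have pxn1 v0 v1 v2 : \sum_x ten4 n px v0 v1 v2 x = 1.
  by rewrite (tuple_sum (fun i x => px (tnth v0 i) (tnth v1 i) (tnth v2 i) x)) big1.
have m00 : 'I_(msize n R0) by exact: o0.
have [E [dd1 [dd2 [dd3 [qk good]]]]] := one_shot_code pun0 pvn0 qn0 pxn0 (WT_ge0 W_pmf (n := n))
  (ten_sum n pu_sum) pvn1 qn1 pxn1 (WT_sum W_pmf (n := n)) (m00, o0 kA) (o0 kS) (o0 kB, o0 kT)
  (o0 k1) (o0 k2) s01 hn0 eps0 leakC0 eb lb.
exists (the_code phi psi E dd1 dd2 dd3); split.
- exact: (the_code_valid phi psi (o0 kT) good).
- exact: (the_code_err W_pmf phiK psiK good).
- apply: le_trans (the_code_equivocation W_pmf phiK psiK m00 (o0 kA) (o0 kS) (o0 kB) (o0 kT) good).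
  by rewrite lerD2r card1 natr_exp2 expRK ler_wpM2r // ltW.
Qed.

End Asymptotic.

(** * Passage to the limit and the theorem *)

Lemma exists_common_bound (R : realType) (s : seq R) : all (fun x => x < 1) s ->
  exists g : R, [/\ 0 < g, g < 1 & all (fun x => x <= g) s].
Proof.
elim: s => [|x s IH] /=; first by exists 2^-1; split=> //; lra.
move=> /andP[x1 /IH[g [g0 g1 gs]]]; exists (Num.max x g); split.
- by rewrite lt_max g0 orbT.
- by rewrite gt_max x1.
- rewrite le_max lexx /=; apply: sub_all gs => y; rewrite le_max => ->; exact: orbT.
Qed.

Lemma err_prob_ge0 (R : realType) (X Y1 Y2 Z : finType) (W : X -> {ffun (Y1 * Y2 * Z) -> R})
  N0 N1 n (c : Defs.code R X Y1 Y2 Z N0 N1 n) :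
  is_channel W -> valid_code c -> 0 <= err_prob W c.
Proof.
move=> Wc cv; apply: sumr_ge0 => -[[[m0 m1] x] y] _ /=.
rewrite mulr_ge0 ?mulr_ge0 ?invr_ge0 ?prodr_ge0 //; first by have [h _] := cv m0 m1.
by move=> i _; have [h _] := Wc (tnth x i).
Qed.

Lemma achievable_of_codes (R : realType) (X Y1 Y2 Z : finType)
  (W : X -> {ffun (Y1 * Y2 * Z) -> R}) (R0 R1 Re C K h : R) :
  is_channel W -> 0 <= R0 -> 0 <= R1 -> 0 <= Re -> 0 <= K -> 0 <= h < 1 ->
  (forall n, exists c : Defs.code R X Y1 Y2 Z (msize n R0) (msize n R1) n,
    [/\ valid_code c, err_prob W c <= C * h ^+ n & n%:R * Re - K <= equivocation W c]) ->
  achievable W (R0, R1, Re).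
Proof.
move=> Wc R00 R10 Re0 K0 /andP[h0 h1] cn.
pose c n := sval (cid (cn n)); have cP n := svalP (cid (cn n)).
split=> //; split=> //; exists c; split; first by move=> n; have [] := cP n.
split.
  apply: (@squeeze_cvgr _ _ _ _ (fun=> 0) (fun n => C * h ^+ n)).
  - apply: nearW => n; have [cv ce _] := cP n; apply/andP; split=> //.
    exact: err_prob_ge0.
  - exact: cvg_cst.
  - by apply: cvg_geometric; rewrite ger0_norm.
(* 2 K gives K / n <= K' / (n + 1) for n >= 1; the summand Re covers n = 0, where the normalized
   equivocation is 0 because 0^-1 = 0. *)
pose K' := 2 * K + Re.
apply: (@limn_einf_ge _ _ (fun n => (Re - K' * n.+1%:R^-1)%:E)).
  move=> n; rewrite lee_fin; case: n => [|n]; first by rewrite invr0 mul0r invr1 /K'; lra.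
  have [_ _ ce] := cP n.+1.
  have n0 : 0 < n.+1%:R :> R by [].
  have n2 : 0 < n.+2%:R :> R by [].
  rewrite [leRHS]mulrC ler_pdivlMr //; apply: le_trans ce.
  have e : n.+2%:R = n.+1%:R + 1 :> R by rewrite -natr1.
  have : K <= K' * n.+2%:R^-1 * n.+1%:R.
    rewrite mulrAC ler_pdivlMr // /K' e.
    have n1 : 1 <= n.+1%:R :> R by rewrite ler1n.
    nra.
  by rewrite mulrBl [Re * _]mulrC lerD2l lerN2.
apply: cvg_EFin; first exact: nearW.
rewrite -[X in _ --> X]subr0 -(mulr0 K'); apply: cvgB; first exact: cvg_cst.
by apply: cvgM; [exact: cvg_cst | exact: cvg_harmonic].
Qed.

Unset Implicit Arguments.
Theorem theorem2 (R : realType) (X Y1 Y2 Z : finType)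
  (W : X -> {ffun (Y1 * Y2 * Z) -> R}) (R0 R1 Re : R) :
  is_channel W ->
  0 <= R0 -> 0 <= R1 -> 0 <= Re ->
  (exists (U V0 V1 V2 : finType)
     (pu : {ffun U -> R}) (pv0 : U -> {ffun V0 -> R})
     (pv12 : V0 -> {ffun (V1 * V2) -> R}) (px : V0 * V1 * V2 -> {ffun X -> R}),
     is_pmf pu /\ (forall u, is_pmf (pv0 u)) /\ (forall v0, is_pmf (pv12 v0)) /\
     (forall v, is_pmf (px v)) /\
     let P := aux_pmf pu pv0 pv12 px W in
     let U_ := @aU U V0 V1 V2 X Y1 Y2 Z in
     let V0_ := @aV0 U V0 V1 V2 X Y1 Y2 Z in
     let V1_ := @aV1 U V0 V1 V2 X Y1 Y2 Z in
     let V2_ := @aV2 U V0 V1 V2 X Y1 Y2 Z in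
     let Y1_ := @aY1 U V0 V1 V2 X Y1 Y2 Z in
     let Y2_ := @aY2 U V0 V1 V2 X Y1 Y2 Z in
     let Z_ := @aZ U V0 V1 V2 X Y1 Y2 Z in
     let V01 := fun w => (V0_ w, V1_ w) in
     let V02 := fun w => (V0_ w, V2_ w) in
     let V10 := fun w => (V1_ w, V0_ w) in
     let V20 := fun w => (V2_ w, V0_ w) in
     let V12 := fun w => (V1_ w, V2_ w) in
     (* constraint on the pmf *)
     cmi P V12 Z_ V0_ <= cmi P V1_ Z_ V0_ + cmi P V2_ Z_ V0_ - cmi P V1_ V2_ V0_ /\
     (* rate constraints *)
     R0 < mi P U_ Z_ /\
     R0 + R1 < mi P U_ Z_ + Num.min (cmi P V01 Y1_ U_ - cmi P V1_ Z_ V0_)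
                                    (cmi P V02 Y2_ U_ - cmi P V2_ Z_ V0_) /\
     R0 + R1 < Num.min (mi P V01 Y1_ - cmi P V1_ Z_ V0_)
                       (mi P V02 Y2_ - cmi P V2_ Z_ V0_) /\
     Re <= R1 /\
     Re < Num.min (cmi P V01 Y1_ U_ - cmi P V01 Z_ U_)
                  (cmi P V02 Y2_ U_ - cmi P V02 Z_ U_) /\
     R0 + Re < Num.min (mi P V01 Y1_ - cmi P V10 Z_ U_)
                       (mi P V02 Y2_ - cmi P V20 Z_ U_) /\
     R0 + 2 * Re < mi P V01 Y1_ + cmi P V02 Y2_ U_ - cmi P V1_ V2_ V0_
                   - 2 * cmi P V0_ Z_ U_ /\
     R0 + 2 * Re < mi P V02 Y2_ + cmi P V01 Y1_ U_ - cmi P V1_ V2_ V0_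
                   - 2 * cmi P V0_ Z_ U_ /\
     R0 + R1 + 2 * Re < cmi P V02 Y2_ U_ - cmi P V2_ Z_ V0_ + mi P V01 Y1_
                        + cmi P V02 Y2_ U_ - cmi P V1_ V2_ V0_ - 2 * cmi P V0_ Z_ U_ /\
     R0 + R1 + 2 * Re < cmi P V01 Y1_ U_ - cmi P V1_ Z_ V0_ + mi P V02 Y2_
                        + cmi P V01 Y1_ U_ - cmi P V1_ V2_ V0_ - 2 * cmi P V0_ Z_ U_) ->
  secrecy_capacity_region W (R0, R1, Re).
Proof.
move=> Wc R00 R10 Re0 [U [V0 [V1 [V2 [pu [pv0 [pv12 [px [hu [hv0 [hv12 [hx]]]]]]]]]]]].
move=> /[let] P /[let] U_ /[let] V0_ /[let] V1_ /[let] V2_ /[let] Y1_ /[let] Y2_ /[let] Z_ /[let]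
  V01 /[let] V02 /[let] V10 /[let] V20 /[let] V12.
move=> [Cc [c1 [c2 [c3 [c4 [c5 [c6 _]]]]]]].
suff ach : achievable W (R0, R1, Re) by exact: (@subset_closure _ (achievable W) _ ach).
have W0 := aux_ge0 hu hv0 hv12 hx Wc.
have P1 := aux_sum hu hv0 hv12 hx Wc (fun t : Y1 * Y2 * Z => t.2).
have pos (A B C : finType) f g h := @cmi_ge0 R _ P W0 P1 A B C f g h.
have z00 : 0 <= cmi P V0_ Z_ U_ by exact: pos.
have z10 : 0 <= cmi P V1_ Z_ V0_ by exact: pos.
have z20 : 0 <= cmi P V2_ Z_ V0_ by exact: pos.
have I0 : 0 <= cmi P V12 Z_ V0_ by exact: pos.
(* Splitting I(V0,Vi;Z|U) brings the secrecy constraints into the form of [rate_choice]. *)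
have ch1 : cmi P V01 Z_ U_ = cmi P V0_ Z_ U_ + cmi P V1_ Z_ V0_.
  exact: (info_chain1 hu hv0 hv12 hx Wc (fun t : Y1 * Y2 * Z => t.2)).
have ch2 : cmi P V02 Z_ U_ = cmi P V0_ Z_ U_ + cmi P V2_ Z_ V0_.
  exact: (info_chain2 hu hv0 hv12 hx Wc (fun t : Y1 * Y2 * Z => t.2)).
have sw1 : cmi P V10 Z_ U_ = cmi P V01 Z_ U_.
  have := info_swap1 pu pv0 pv12 hx Wc (fun t : Y1 * Y2 * Z => t.2); apply.
have sw2 : cmi P V20 Z_ U_ = cmi P V02 Z_ U_.
  have := info_swap2 pu pv0 pv12 hx Wc (fun t : Y1 * Y2 * Z => t.2); apply.
move: c5 c6; rewrite sw1 sw2 ch1 ch2 => c5 c6.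
have [ra [rb [rt [t1 [t2 [[ra0 rb0 rt0 t10 t20] sumR [k1 k2 k3 k4 k5] [k6 k7 k8 k9 k10]]]]]]] :=
  rate_choice z00 z10 z20 I0 Cc R00 Re0 c4 c1 c2 c3 c5 c6.
pose f1 (t : Y1 * Y2 * Z) := t.1.1; pose f2 (t : Y1 * Y2 * Z) := t.1.2.
pose fz (t : Y1 * Y2 * Z) := t.2.
pose kV u v0 := pv0 u v0; pose l2 := ln 2 : R.
have l20 : 0 < l2 by exact: ln2_gt0.
have pu_ge0 u : 0 <= pu u by have [h _] := hu; exact: h.
have pu_sum : \sum_u pu u = 1 by case: hu.
have pv0_ge0 u v : 0 <= kV u v by have [h _] := hv0 u; exact: h.
have pv0_sum u : \sum_v kV u v = 1 by case: (hv0 u).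
have q_ge0 v0 v1 v2 : 0 <= kq pv12 v0 v1 v2 by have [h _] := hv12 v0; exact: h.
have q_sum := kq_sum hv12.
have px_ge0 v0 v1 v2 x : 0 <= kx px v0 v1 v2 x by have [h _] := hx (v0, v1, v2); exact: h.
have px_sum v0 v1 v2 : \sum_x kx px v0 v1 v2 x = 1 by case: (hx (v0, v1, v2)).
have W_ge0 x o : 0 <= kW W x o by have [h _] := Wc x; exact: h.
have G_ge0 (B : finType) (f : _ -> B) v0 v1 v2 b : 0 <= chan (kx px) (kW W) f v0 v1 v2 b.
  exact: chan_ge0.
have G_sum (B : finType) (f : _ -> B) v0 v1 v2 : \sum_b chan (kx px) (kW W) f v0 v1 v2 b = 1.
  apply: chan_sum => // x; by case: (Wc x).
have qs_ge0 v0 v2 v1 : 0 <= swp (kq pv12) v0 v2 v1 by exact: q_ge0.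
have qs_sum v0 : \sum_v2 \sum_v1 swp (kq pv12) v0 v2 v1 = 1.
  by rewrite exchange_big; exact: q_sum.
have EPc (B : finType) (f : _ -> B) F (r m : R) :
    (forall u v0 v1 v2 b, supp pu kV (kq pv12) (chan (kx px) (kW W) f) u v0 v1 v2 b ->
      0 < F u v0 v1 v2 b :> R) ->
    EP pu kV (kq pv12) (chan (kx px) (kW W) f) (fun u v0 v1 v2 b => ln (F u v0 v1 v2 b)) = m ->
    m < - r -> \forall s \near 0^'+, expR (s * r) *
      EP pu kV (kq pv12) (chan (kx px) (kW W) f) (fun u v0 v1 v2 b => F u v0 v1 v2 b `^ s) < 1.
  by move=> F0 <-; exact: EP_chernoff.
have Gs_ge0 (B : finType) (f : _ -> B) v0 v2 v1 b : 0 <= swp (chan (kx px) (kW W) f) v0 v2 v1 b.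
  exact: G_ge0.
have Gs_sum (B : finType) (f : _ -> B) v0 v2 v1 : \sum_b swp (chan (kx px) (kW W) f) v0 v2 v1 b = 1.
  exact: G_sum.
have EPs (B : finType) (f : _ -> B) F (r m : R) :
    (forall u v0 v2 v1 b, supp pu kV (swp (kq pv12)) (swp (chan (kx px) (kW W) f)) u v0 v2 v1 b ->
      0 < F u v0 v2 v1 b :> R) ->
    EP pu kV (swp (kq pv12)) (swp (chan (kx px) (kW W) f))
      (fun u v0 v2 v1 b => ln (F u v0 v2 v1 b)) = m ->
    m < - r -> \forall s \near 0^'+, expR (s * r) *
      EP pu kV (swp (kq pv12)) (swp (chan (kx px) (kW W) f))
        (fun u v0 v2 v1 b => F u v0 v2 v1 b `^ s) < 1.
  by move=> F0 <-; exact: EP_chernoff.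
have lN (x y : R) : x < y -> - (l2 * y) < - (x * l2) by rewrite ltrN2 (mulrC x) ltr_pM2l.
have lP (x y : R) : y < x -> l2 * y < - (- x * l2) by rewrite mulNr opprK (mulrC x) ltr_pM2l.
have e1m := EPc _ f1 _ _ _ (rho_m_gt0 pu_ge0 pv0_ge0 q_ge0 (G_ge0 _ f1))
  (info_m1 hu hv0 hv12 hx Wc f1) (lN _ _ k4).
have e1u := EPc _ f1 _ _ _ (rho_u_gt0 pv0_ge0 q_ge0 (G_ge0 _ f1))
  (info_u1 hu hv0 hv12 hx Wc f1) (lN _ _ k2).
have e2m := EPs _ f2 _ _ _ (rho_m_gt0 pu_ge0 pv0_ge0 qs_ge0 (Gs_ge0 _ f2))
  (info_m2 hu hv0 hv12 hx Wc f2) (lN _ _ k5).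
have e2u := EPs _ f2 _ _ _ (rho_u_gt0 pv0_ge0 qs_ge0 (Gs_ge0 _ f2))
  (info_u2 hu hv0 hv12 hx Wc f2) (lN _ _ k3).
have e3 := EPc _ fz _ _ _ (rho_z_gt0 pu_ge0 pv0_ge0 q_ge0 (G_ge0 _ fz))
  (info_z hu hv0 hv12 hx Wc fz) (lN _ _ k1).
have ew := EPc _ fz _ _ _ (fun u v0 v1 v2 b => rho_w_gt0 q_ge0 (pv0 := kV) (b := b))
  (info_w hu hv0 hv12 hx Wc fz) (lP _ _ k10).
have el0 := EPc _ fz _ _ _ (rho_0_gt0 pv0_ge0 q_ge0 (G_ge0 _ fz))
  (info_0 hu hv0 hv12 hx Wc fz) (lP _ _ k6).
(* Back to the joint form, which is the mean of the logarithm of [rho_1]. *)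
rewrite -ch1 in k7; rewrite -ch2 in k8.
have k9' : cmi P V0_ Z_ U_ + cmi P V12 Z_ V0_ + cmi P V1_ V2_ V0_ < rb + rt + t1 + t2 by [].
have el1 := EPc _ fz _ _ _ (rho_1_gt0 pv0_ge0 q_ge0 (G_ge0 _ fz))
  (info_1 hu hv0 hv12 hx Wc fz) (lP _ _ k7).
have el2 := EPs _ fz _ _ _ (rho_1_gt0 pv0_ge0 qs_ge0 (Gs_ge0 _ fz))
  (info_2 hu hv0 hv12 hx Wc fz) (lP _ _ k8).
have el12 := EPc _ fz _ _ _ (rho_12_gt0 pv0_ge0 q_ge0 (G_ge0 _ fz))
  (info_12 hu hv0 hv12 hx Wc fz) (lP _ _ k9').

have dt t : 0 < t -> expR (- (t * l2)) < 1 by move=> t_gt0; rewrite expR_lt1 oppr_lt0 mulr_gt0.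
(* Each of the ten moment bounds holds for all small s > 0, so one s serves them all. The constant
   [gam] chosen next dominates these ten values and the two inverse satellite factors. *)
have [s [s_gt0 [s_le1 [h1m [h1u [h2m [h2u [h3 [hw [hl0 [hl1 [hl2 hl12]]]]]]]]]]]] := filter_ex
  (filterI (nbhs_right_gt (0 : R))
  (filterI (nbhs_right_le (@ltr01 R)) (filterI e1m (filterI e1u (filterI e2m (filterI e2u
    (filterI e3 (filterI ew (filterI el0 (filterI el1 (filterI el2 (el12)))))))))))).
have s01 : 0 < s <= 1 by apply/andP.
have [gam [gam0 gam1]] := exists_common_bound (s := [:: _; _; _; _; _; _; _; _; _; _; _; _])
  (introT andP (conj h1m (introT andP (conj h1u (introT andP (conj h2m (introT andP (conj h2u
    (introT andP (conj h3 (introT andP (conj hw (introT andP (conj hl0 (introT andP (conj hl1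
    (introT andP (conj hl2 (introT andP (conj hl12 (introT andP (conj (dt _ t10) (introT andP
    (conj (dt _ t20) (isT))))))))))))))))))))))))).
rewrite /= => /and5P[d1m d1u d2m d2u /and5P[d3 dw dl0 dl1 /and5P[dl2 dl12 dt1 dt2 _]]].
have cn := code_n pu_ge0 pv0_ge0 q_ge0 px_ge0 Wc pu_sum pv0_sum q_sum px_sum R00 Re0 ra0 rb0 rt0
  (ltW t10) (ltW t20) sumR s01 gam0 gam1 d1m d1u d2m d2u d3 dw dl0 dl1 dl2 dl12 dt1 dt2.
have cc_ge0 : 0 <= cc s by exact: powR_ge0.
have leak0 : 0 <= leakC s.
  rewrite /leakC addr_ge0 ?addr_ge0 ?mulr_ge0 ?addr_ge0 ?invr_ge0 ?(ltW s_gt0) //; exact: ltW.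
apply: (@achievable_of_codes _ _ _ _ _ _ _ _ _ (2 * errC s) (1 + 2 * leakC s / l2) (Num.sqrt
  gam)) => //.
- by rewrite addr_ge0 // divr_ge0 ?mulr_ge0 // ltW.
- by rewrite sqrtr_ge0 /= -sqrtr1 ltr_sqrt.
move=> n; have [c [cv ce cq]] := cn n; exists c; split=> //; first by rewrite -mulrA.
rewrite -(ler_pM2l l20); apply: le_trans cq.
rewrite -/l2 le_eqVlt; apply/orP; left; apply/eqP; field.
by rewrite gt_eqF.
Qed.
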